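(* Let $1/2<\alpha<2$, $d\in\mathbb{N}$, and $\boldsymbol{\gamma}=(\gamma_1,\ldots,\gamma_d)$ with $0<\gamma_j\le\underline{\kappa}_\alpha^{1/2}$ for all $j$. For $1/2\le\lambda<\alpha$ put $V_d(\alpha,\lambda,\boldsymbol{\gamma})=\prod_{j=1}^d\left(1+2\Gamma_{j,\alpha}^{1/\lambda}\zeta(\alpha/\lambda)\right)$ with $\Gamma_{j,\alpha}=\underline{\kappa}_\alpha^{-1/2}\gamma_j$ and $\zeta$ the Riemann zeta function. Assume that the integer $n_{\max}\ge2$ satisfies $$n_{\max}\ge2\inf_{1/2\le\lambda<\alpha}\frac{V_d(\alpha,\lambda,\boldsymbol{\gamma})-1}{1-\tau}\quad\text{with }\tau=31/32.$$ For a growth function $h:\mathbb{N}\to[1,\infty)$ (i.e. $h(n)\to\infty$ as $n\to\infty$), let $Q_{n_{\max},h,\mathrm{med}}$ be the median-of-means tent-transformed lattice rule described in the context. Then, for any $1/2<\lambda<\alpha$, any $0<\delta<\min(\lambda-1/2,1)$, and all such $n_{\max}$ with $h(n_{\max})\ge\lambda+1/2$, the randomized error in the fractional Sobolev space $H_{\alpha,\boldsymbol{\gamma},d}^{\mathrm{sob}}$ satisfies $$e^{\mathrm{ran}}(H_{\alpha,\boldsymbol{\gamma},d}^{\mathrm{sob}};Q_{n_{\max},h,\mathrm{med}})\le C_{\lambda,\delta}\frac{\left(V_d(\alpha,\lambda,\boldsymbol{\gamma})-1\right)^{\lambda}}{n_{\max}^{\lambda+1/2-\delta}},$$ with a constant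 $C_{\lambda,\delta}>0$ depending only on $\lambda,\delta$.
   Context: **Spaces.** Functions are real-valued. Let $\phi_0(x)=1$, $\phi_k(x)=\sqrt2\cos(k\pi x)$ for $k\in\mathbb{N}$, and $\phi_{\boldsymbol{k}}(\boldsymbol{x})=\prod_{j=1}^d\phi_{k_j}(x_j)$ for $\boldsymbol{k}\in\mathbb{N}_0^d$; put $\widetilde f(\boldsymbol{k})=\int_{[0,1]^d}f\phi_{\boldsymbol{k}}$. For $\alpha>1/2$ and weights $\gamma_j>0$ let $r_{\alpha,\gamma}(0)=1$, $r_{\alpha,\gamma}(k)=\gamma^{-1}k^\alpha$ for $k\in\mathbb{N}$, $r_{\alpha,\boldsymbol{\gamma}}(\boldsymbol{k})=\prod_{j=1}^d r_{\alpha,\gamma_j}(k_j)$. The half-period cosine space $H_{\alpha,\boldsymbol{\gamma},d}^{\cos}$ consists of $f\in L_2([0,1]^d)$ with $(\|f\|_{\alpha,\boldsymbol{\gamma},d}^{\cos})^2=\sum_{\boldsymbol{k}\in\mathbb{N}_0^d}|\widetilde f(\boldsymbol{k})|^2r_{\alpha,\boldsymbol{\gamma}}^2(\boldsymbol{k})<\infty$. Let $\mathcal{P}^{\cos}=\operatorname{span}\{\phi_k\mid k\in\mathbb{N}_0\}$ on $[0,1]$. On $\mathcal{P}^{\cos}$ define, for $1/2<\alpha<1$, $$\langle f,g\rangle_{\alpha,\gamma,1}^{\mathrm{sob}}=\int_0^1 f\int_0^1 g+\frac{1}{\gamma^2}\cdot\frac{(1-\alpha)\pi^3}{8}\int_0^1\!\int_0^1(f(x)-f(y))(g(x)-g(y))\left(\frac{1}{|\sin\frac{\pi(x-y)}{2}|^{2\alpha+1}}+\frac{1}{|\sin\frac{\pi(x+y)}{2}|^{2\alpha+1}}\right)dx\,dy,$$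 and, for $1<\alpha<2$, $$\langle f,g\rangle_{\alpha,\gamma,1}^{\mathrm{sob}}=\int_0^1 f\int_0^1 g+\frac{1}{\gamma^2}\left(\int_0^1 f'g'+\mathcal{B}_\alpha(f',g')\right),$$ $$\mathcal{B}_\alpha(f',g')=\frac{(\alpha-1)(2-\alpha)\pi^3}{8}\int_0^1\!\int_0^1\left(\frac{(f'(x)-f'(y))(g'(x)-g'(y))}{|\sin\frac{\pi(x-y)}{2}|^{2\alpha-1}}+\frac{(f'(x)+f'(y))(g'(x)+g'(y))}{|\sin\frac{\pi(x+y)}{2}|^{2\alpha-1}}\right)dx\,dy.$$ For these $\alpha$, $H_{\alpha,\gamma,1}^{\mathrm{sob}}$ is the completion of $\mathcal{P}^{\cos}$ in the induced norm. For $\alpha=1$, $H_{1,\gamma,1}^{\mathrm{sob}}$ is the space of $f$ with weak derivative $f'\in L_2([0,1])$ and inner product $\int_0^1 f\int_0^1 g+\gamma^{-2}\int_0^1 f'g'$. For $d\ge1$, $H_{\alpha,\boldsymbol{\gamma},d}^{\mathrm{sob}}=\bigotimes_{j=1}^dH_{\alpha,\gamma_j,1}^{\mathrm{sob}}$ (Hilbert tensor product), with norm $\|\cdot\|_{\alpha,\boldsymbol{\gamma},d}^{\mathrm{sob}}$. The identity on finite cosine expansions extends to an isomorphism of $H_{\alpha,\boldsymbol{\gamma},d}^{\cos}$ onto $H_{\alpha,\boldsymbol{\gamma},d}^{\mathrm{sob}}$, through which the two spaces are identified; their elements are continuous functions on $[0,1]^d$ (given by absolutely and uniformly convergent cosine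 series). **Constants.** $\underline{\kappa}_\alpha=c_\alpha$ if $1/2<\alpha<1$, $\underline{\kappa}_1=\pi^2$, $\underline{\kappa}_\alpha=c'_\alpha$ if $1<\alpha<2$, where $$c_\alpha=2(1-\alpha)\pi^{2-2\alpha}\int_0^{1/2}\frac{\sin^2(\pi t)}{t^{2\alpha+1}}dt,\qquad c'_\alpha=2(\alpha-1)(2-\alpha)\pi^{6-2\alpha}\int_0^{1/2}\frac{\sin^2(\pi t)}{t^{2\alpha-1}}dt.$$ **Lattice rule and randomized error.** For $\boldsymbol{z}\in\{0,\ldots,n-1\}^d$, $\boldsymbol{y}_i=(\{iz_1/n\},\ldots,\{iz_d/n\})$, $0\le i<n$, with $\{\cdot\}$ the fractional part. The tent transformation is $\varphi(x)=1-|2x-1|$, applied componentwise; $P^{\varphi}_{n,\boldsymbol{z}}=\{\boldsymbol{x}_i=\varphi(\boldsymbol{y}_i)\mid 0\le i<n\}$. Let $I(f)=\int_{[0,1]^d}f(\boldsymbol{x})\,d\boldsymbol{x}$ and $I(f;P^{\varphi}_{n,\boldsymbol{z}})=\frac1n\sum_{i=0}^{n-1}f(\boldsymbol{x}_i)$. For a randomized quadrature rule $Q=(Q^\omega)_{\omega\in\Omega}$ (a family of deterministic rules indexed by a probability space), $e^{\mathrm{ran}}(H;Q)=\sup_{f\in H,\ \|f\|_H\le1}\mathbb{E}_\omega|I(f)-Q^\omega(f)|$. **Median-of-means rule.** Given $n_{\max}\ge2$ and $h$, set $R=2\lceil h(n_{\max})\log_2n_{\max}\rceil+1$. For $r=1,\ldots,R$,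 independently draw a prime $n_r$ uniformly from $\{n\text{ prime}\mid\lceil n_{\max}/2\rceil<n\le n_{\max}\}$ and then $\boldsymbol{z}_r$ uniformly from $\{1,\ldots,n_r-1\}^d$. The rule is $$Q_{n_{\max},h,\mathrm{med}}(f)=\operatorname{median}\left(I(f;P^{\varphi}_{n_1,\boldsymbol{z}_1}),\ldots,I(f;P^{\varphi}_{n_R,\boldsymbol{z}_R})\right).$$ *)

(* Defs.v *)
From HB Require Import structures.
From mathcomp Require Import all_boot all_order all_algebra.
From mathcomp Require Import all_classical all_reals all_analysis.
Set Implicit Arguments.
Unset Strict Implicit.
Unset Printing Implicit Defensive.
Import Order.TTheory GRing.Theory Num.Theory.
Import numFieldNormedType.Exports.
Local Open Scope classical_set_scope.
Local Open Scope ring_scope.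

(* Functions on [0,1] and on [0,1]^d are represented by total functions on R
   and on d.-tuple R; only their values on the cube matter.                   *)

Section IntegralsOnTheCube.
Variable R : realType.

Definition unit_interval : set R := `[0, 1].

Definition int01 (f : R -> R) : R :=
  \int[@lebesgue_measure R]_(x in unit_interval) f x.

Definition cube (d : nat) : set (d.-tuple R) :=
  [set x | forall j, 0 <= tnth x j <= 1].

(* The integral over [0,1]^d, as an iterated Lebesgue integral; it is only
   applied to functions that are continuous on the cube.                      *)
Fixpoint cube_int (d : nat) : (d.-tuple R -> R) -> R :=
  match d with
  | 0 => fun f => f [tuple]
  | d'.+1 => fun f => int01 (fun t => cube_int (fun x => f [tuple of t :: x]))
  end.

End IntegralsOnTheCube.
Arguments cube {R} d.
Arguments unit_interval {R}.

Section SpacesOfFunctions.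
Variable R : realType.

(* A space of real functions on T together with its inner product (no axiom is
   imposed: each of the spaces below is an inner product space).              *)
Record ip_space (T : Type) := IpSpace {
  carrier : set (T -> R) ;
  ip : (T -> R) -> (T -> R) -> R
}.

Definition ip_norm (T : Type) (H : ip_space T) (f : T -> R) : R :=
  Num.sqrt (ip H f f).

Definition cauchy_in (T : Type) (H : ip_space T) (p : nat -> T -> R) : Prop :=
  (forall m, carrier H (p m)) /\
  forall e : R, 0 < e -> exists N, forall m n, (N <= m)%N -> (N <= n)%N ->
    ip_norm H (p m \- p n) < e.

Definition represents (T : choiceType) (D : set T) (H : ip_space T)
    (p : nat -> T -> R) (f : T -> R) : Prop :=
  cauchy_in H p /\ {uniform D, p @ \oo --> f}.

(* The completion of H realized as a space of functions on D: the element
   defined by a Cauchy sequence is the uniform limit on D of that sequence.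
   For the spaces below the norm dominates the supremum norm on D, the map from
   the abstract completion to functions on D is injective, and the limit of
   inner products does not depend on the sequences chosen, so that xget selects
   from a singleton.                                                          *)
Definition completion (T : choiceType) (D : set T) (H : ip_space T) :
    ip_space T :=
  IpSpace
    [set f | exists p, represents D H p f]
    (fun f g => xget 0 [set v | exists p q,
       [/\ represents D H p f, represents D H q g &
           (fun m => ip H (p m) (q m)) @ \oo --> v]]).

Definition tensor_rep (d : nat) (H : 'I_d -> ip_space R)
    (F : d.-tuple R -> R) (n : nat) (f : 'I_n -> 'I_d -> R -> R) : Prop :=
  (forall i j, carrier (H j) (f i j)) /\
  forall x, cube d x -> F x = \sum_(i < n) \prod_(j < d) f i j (tnth x j).

(* Algebraic tensor product, with the inner product determined by
   <(x)_j f_j, (x)_j g_j> = prod_j <f_j, g_j>; again xget selects from a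
   singleton, as the value does not depend on the representations.            *)
Definition algebraic_tensor (d : nat) (H : 'I_d -> ip_space R) :
    ip_space (d.-tuple R) :=
  IpSpace
    [set F | exists (n : nat) (f : 'I_n -> 'I_d -> R -> R), tensor_rep H F f]
    (fun F G => xget 0 [set v |
       exists (n m : nat) (f : 'I_n -> 'I_d -> R -> R)
         (g : 'I_m -> 'I_d -> R -> R),
       [/\ tensor_rep H F f, tensor_rep H G g &
           v = \sum_(i < n) \sum_(k < m) \prod_(j < d)
                 ip (H j) (f i j) (g k j)]]).

Definition hilbert_tensor (d : nat) (H : 'I_d -> ip_space R) :
    ip_space (d.-tuple R) :=
  completion (cube d) (algebraic_tensor H).

End SpacesOfFunctions.

Section SobolevSpaces.
Variable R : realType.

Definition cos_basis (k : nat) (x : R) : R :=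
  if k == 0%N then 1 else Num.sqrt 2 * cos (k%:R * pi * x).

Definition Pcos : set (R -> R) :=
  [set f | exists (n : nat) (c : nat -> R),
     f = fun x => \sum_(k < n) c k * cos_basis k x].

Definition sin_minus (x y : R) : R := `|sin (pi * (x - y) / 2)|.
Definition sin_plus (x y : R) : R := `|sin (pi * (x + y) / 2)|.

(* In the double integrals the zeros of the denominators (where the quotient is
   0 by convention) form a null set on every line, and the integrands
   are absolutely integrable for f and g in Pcos.                             *)
Definition sob_ip_lt1 (alpha gamma : R) (f g : R -> R) : R :=
  int01 f * int01 g +
  gamma ^- 2 * ((1 - alpha) * pi ^+ 3 / 8) *
  int01 (fun y => int01 (fun x =>
    (f x - f y) * (g x - g y) *
    ((sin_minus x y `^ (2 * alpha + 1))^-1 +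
     (sin_plus x y `^ (2 * alpha + 1))^-1))).

Definition sob_B (alpha : R) (u v : R -> R) : R :=
  (alpha - 1) * (2 - alpha) * pi ^+ 3 / 8 *
  int01 (fun y => int01 (fun x =>
    (u x - u y) * (v x - v y) / (sin_minus x y `^ (2 * alpha - 1)) +
    (u x + u y) * (v x + v y) / (sin_plus x y `^ (2 * alpha - 1)))).

Definition sob_ip_gt1 (alpha gamma : R) (f g : R -> R) : R :=
  int01 f * int01 g +
  gamma ^- 2 * (int01 (fun x => derive1 f x * derive1 g x) +
                sob_B alpha (derive1 f) (derive1 g)).

Definition square_integrable01 (g : R -> R) : Prop :=
  measurable_fun unit_interval g /\
  (@lebesgue_measure R).-integrable unit_interval (fun x => (g x ^+ 2)%:E).

Definition is_weak_derivative (f g : R -> R) : Prop :=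
  forall psi : R -> R,
    (forall x, derivable psi x 1) -> continuous (derive1 psi) ->
    (exists a b : R, [/\ 0 < a, b < 1 & forall x, ~~ (a <= x <= b) -> psi x = 0]) ->
    int01 (fun x => f x * derive1 psi x) = - int01 (fun x => g x * psi x).

Definition weak_derivative (f : R -> R) : R -> R :=
  xget (fun _ => 0) [set g | square_integrable01 g /\ is_weak_derivative f g].

(* Elements are taken as their continuous representatives. *)
Definition sob_one (gamma : R) : ip_space R R :=
  IpSpace
    [set f : R -> R | {within unit_interval, continuous f} /\
       exists g, square_integrable01 g /\ is_weak_derivative f g]
    (fun f g => int01 f * int01 g +
       gamma ^- 2 * int01 (fun x => weak_derivative f x * weak_derivative g x)).

Definition sob1 (alpha gamma : R) : ip_space R R :=
  if alpha < 1 then completion unit_interval (IpSpace Pcos (sob_ip_lt1 alpha gamma))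
  else if alpha == 1 then sob_one gamma
  else completion unit_interval (IpSpace Pcos (sob_ip_gt1 alpha gamma)).

Definition sob (d : nat) (alpha : R) (gamma : 'I_d -> R) :
    ip_space R (d.-tuple R) :=
  hilbert_tensor (fun j => sob1 alpha (gamma j)).

Definition kappa (alpha : R) : R :=
  if alpha < 1 then
    2 * (1 - alpha) * pi `^ (2 - 2 * alpha) *
    \int[@lebesgue_measure R]_(t in `[0, 2^-1])
      (sin (pi * t) ^+ 2 / (t `^ (2 * alpha + 1)))
  else if alpha == 1 then pi ^+ 2
  else
    2 * (alpha - 1) * (2 - alpha) * pi `^ (6 - 2 * alpha) *
    \int[@lebesgue_measure R]_(t in `[0, 2^-1])
      (sin (pi * t) ^+ 2 / (t `^ (2 * alpha - 1))).

Definition zeta (s : R) : R :=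
  limn (series (fun k : nat => (k.+1%:R : R) `^ (- s))).

Definition Vd (d : nat) (alpha lambda : R) (gamma : 'I_d -> R) : R :=
  \prod_(j < d)
    (1 + 2 * ((Num.sqrt (kappa alpha))^-1 * gamma j) `^ lambda^-1
           * zeta (alpha / lambda)).

End SobolevSpaces.

Section RandomizedQuadrature.
Variable R : realType.

Definition frac_part (x : R) : R := x - (Num.floor x)%:~R.

Definition tent (x : R) : R := 1 - `|2 * x - 1|.

Definition lattice_point (d n : nat) (z : 'I_d -> nat) (i : nat) : d.-tuple R :=
  [tuple frac_part (i%:R * (z j)%:R / n%:R) | j < d].

Definition tent_lattice_rule (d n : nat) (z : 'I_d -> nat)
    (f : d.-tuple R -> R) : R :=
  n%:R^-1 * \sum_(i < n) f (map_tuple tent (lattice_point n z i)).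

(* Randomized error of a rule indexed by a finite probability space with
   probability mass function P.                                               *)
Definition eran (d : nat) (H : ip_space R (d.-tuple R)) (Omega : finType)
    (P : Omega -> R) (Q : Omega -> (d.-tuple R -> R) -> R) : \bar R :=
  ereal_sup
    [set (\sum_w P w * `|cube_int f - Q w f|)%:E
       | f in [set f | carrier H f /\ ip_norm H f <= 1]].

Definition median (s : seq R) : R :=
  nth 0 (sort (fun x y : R => x <= y) s) (size s)./2.

Section MedianRule.
Variables (nmax d : nat).

Definition admissible (n : nat) : bool :=
  [&& prime n, uphalf nmax < n & n <= nmax]%N.

(* Possible outcomes (n_r, z_r) of one draw. *)
Definition draw : finType :=
  ('I_nmax.+1 * {ffun 'I_d -> 'I_nmax.+1})%type.

Definition draw_prob (w : draw) : R :=
  if admissible w.1 && [forall j, 0 < w.2 j < w.1]%N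
  then (#|[set n : 'I_nmax.+1 | admissible n]|%SET)%:R^-1
       * (((w.1).-1 ^ d)%N%:R)^-1
  else 0.

Definition repetitions (h : nat -> R) : nat :=
  (2 * `|Num.ceil (h nmax * (ln nmax%:R / ln 2))|%N + 1)%N.

(* The R draws are independent, hence the product mass function. *)
Definition med_prob (h : nat -> R)
    (w : {ffun 'I_(repetitions h) -> draw}) : R :=
  \prod_(r < repetitions h) draw_prob (w r).

Definition med_rule (h : nat -> R) (w : {ffun 'I_(repetitions h) -> draw})
    (f : d.-tuple R -> R) : R :=
  median [seq tent_lattice_rule (w r).1 (fun j => (w r).2 j : nat) f
         | r : 'I_(repetitions h)].

End MedianRule.

End RandomizedQuadrature.

(* Main.v *)
(* In one variable the Sobolev inner product is diagonal in the half-period cosine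
   basis, with k-th eigenvalue at least kappa k^(2 alpha) / gamma^2. This spectral form
   survives completion and tensor products, so that, up to a uniformly small Fejer
   error, a function of the unit ball is a cosine polynomial whose coefficients are
   bounded in the l2 norm with weights r(k). Its error under a tent-transformed lattice
   rule is a sum of coefficients over the dual lattice.

   Write N = nmax, W = V_d - 1 and let P be the number of admissible primes. A nonzero
   frequency l is in the dual lattice with probability at most 2/N + nu(l)/P, where nu(l)
   counts the admissible primes dividing all entries of l. With T = (N / (64 W))^lambda
   this shows that, with probability at least 31/32, no dual frequency has weight at most
   T. On that event Cauchy-Schwarz bounds the mean error: the 2/N part by the tail
   r(l) > T, and the nu/P part by the sum of nu^2 r^-2, whose diagonal costs P^(-1/2).
   Erdos' argument for Bertrand's postulate gives P >= c N^(1 - 2 delta) unless P = 0,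
   when no draw is possible. Finally a Chernoff bound shows that the median exceeds 32
   times this mean with probability at most 4^-m / 8, where the error is at most
   W^lambda. *)
Require Import Defs.
From HB Require Import structures.
From mathcomp Require Import all_boot all_order all_algebra.
From mathcomp Require Import all_classical all_reals all_analysis.
From mathcomp Require Import measurable_realfun complex.
From mathcomp Require Import ring lra zify.
Set Implicit Arguments.
Unset Strict Implicit.
Unset Printing Implicit Defensive.
Import Order.TTheory GRing.Theory Num.Theory.
Import numFieldNormedType.Exports.
Local Open Scope classical_set_scope.
Local Open Scope ring_scope.

(** The extra 1/2 in the rate is the gain of randomization: a frequency is dual with probability
    about 2/N, while the l2 tail beyond T is of order N^(1/2 - lambda). Only the term P^(-1/2)
    N^(-alpha) costs [delta]. The plain mean would not do: bad draws have constant probability and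
    their error is only known to be at most W^lambda, so the mean is taken on the good event and the
    median suppresses the rest. The constants fit together as follows: 64 in T makes bad draws have
    probability at most 1/32, Markov's inequality spends another 1/32, and the Chernoff bound is run
    at 1/16.

    Two features of the definitions shape the rest. Inner products carry no axioms and are selected
    by [xget], so each fact about them is derived from finite spectral sums and passed to the limit.
    Real integrals are 0 when they diverge: [0 < gamma j <= sqrt kappa] forces [kappa > 0], and in
    the fractional cases this positivity is what yields the integrability of the singular
    kernels. *)

Section BoundedUniformlyContinuous.
Context {R : realType} {T : Type} (D : set T) (close : R -> T -> T -> Prop).
Hypothesis close_mono : forall a b x y, a <= b -> close a x y -> close b x y.

(** Boundedness and uniform continuity are taken relative to an abstract relation [close], so that
    one closure theory serves the interval and the cube. The class is stable under products and
    uniform limits and its members are integrable, hence it can hold all elements of the completed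
    spaces. *)
Definition buc (F : T -> R) : Prop :=
  (exists M, forall x, D x -> `|F x| <= M) /\
  forall e, 0 < e -> exists2 dl, 0 < dl &
    forall x y, D x -> D y -> close dl x y -> `|F x - F y| <= e.

Lemma buc_bound F : buc F -> exists2 M, 0 < M & forall x, D x -> `|F x| <= M.
Proof.
move=> [[M HM] _]; exists (`|M| + 1); first by rewrite ltr_wpDl.
by move=> x /HM h; rewrite (le_trans h)// (le_trans (ler_norm M))// lerDl.
Qed.

Lemma eq_buc F G : (forall x, D x -> F x = G x) -> buc F -> buc G.
Proof.
move=> FG [[M HM] HF]; split.
  by exists M => x Dx; rewrite -FG// HM.
by move=> e /HF[dl dl0 H]; exists dl => // x y Dx Dy; rewrite -!FG//; exact: H.
Qed.

Lemma buc_cst c : buc (fun=> c).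
Proof.
split; first by exists `|c|.
by move=> e e0; exists 1 => // x y _ _ _; rewrite subrr normr0 ltW.
Qed.

Lemma bucD F G : buc F -> buc G -> buc (fun x => F x + G x).
Proof.
move=> [[M HM] HF] [[N HN] HG]; split.
  by exists (M + N) => x Dx; rewrite (le_trans (ler_normD _ _))// lerD ?HM ?HN.
move=> e e0; have e20 : 0 < e / 2 by rewrite divr_gt0.
have [d1 d10 H1] := HF _ e20; have [d2 d20 H2] := HG _ e20.
exists (Num.min d1 d2); first by rewrite lt_min d10.
move=> x y Dx Dy cl.
have c1 : close d1 x y by apply: close_mono cl; rewrite ge_min lexx.
have c2 : close d2 x y by apply: close_mono cl; rewrite ge_min lexx orbT.
rewrite (_ : _ - _ = (F x - F y) + (G x - G y)); last by ring.
by rewrite (le_trans (ler_normD _ _))// [leRHS]splitr lerD ?H1 ?H2.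
Qed.

Lemma bucM F G : buc F -> buc G -> buc (fun x => F x * G x).
Proof.
move=> bF bG; have [M M0 HM] := buc_bound bF; have [N N0 HN] := buc_bound bG.
case: bF => _ HF; case: bG => _ HG; split.
  by exists (M * N) => x Dx; rewrite normrM ler_pM ?HM ?HN.
move=> e e0; have e1 : 0 < e / 2 / N by rewrite !divr_gt0.
have e2 : 0 < e / 2 / M by rewrite !divr_gt0.
have [d1 d10 H1] := HF _ e1; have [d2 d20 H2] := HG _ e2.
exists (Num.min d1 d2); first by rewrite lt_min d10.
move=> x y Dx Dy cl.
have c1 : close d1 x y by apply: close_mono cl; rewrite ge_min lexx.
have c2 : close d2 x y by apply: close_mono cl; rewrite ge_min lexx orbT.
rewrite (_ : _ - _ = (F x - F y) * G x + F y * (G x - G y)); last by ring.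
rewrite (le_trans (ler_normD _ _))// [leRHS]splitr lerD// normrM.
  rewrite -[leRHS](@divfK _ N) ?gt_eqF//.
  by apply: ler_pM => //; [apply: H1 | apply: HN].
rewrite mulrC -[leRHS](@divfK _ M) ?gt_eqF//.
by apply: ler_pM => //; [apply: H2 | apply: HM].
Qed.

Lemma bucZ c F : buc F -> buc (fun x => c * F x).
Proof. by move=> bF; apply: bucM => //; exact: buc_cst. Qed.

Lemma bucN F : buc F -> buc (fun x => - F x).
Proof.
by move=> /(bucZ (-1)); apply: eq_buc => x _; rewrite mulN1r.
Qed.

Lemma bucB F G : buc F -> buc G -> buc (fun x => F x - G x).
Proof. by move=> bF bG; apply: bucD => //; exact: bucN. Qed.

Lemma buc_sum (I : Type) (r : seq I) (F : I -> T -> R) :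
  (forall i, buc (F i)) -> buc (fun x => \sum_(i <- r) F i x).
Proof.
move=> bF; elim: r => [|i r IH].
  by apply: (eq_buc _ (buc_cst 0)) => x _; rewrite big_nil.
by apply: (eq_buc _ (bucD (bF i) IH)) => x _; rewrite big_cons.
Qed.

Lemma buc_prod (I : Type) (r : seq I) (F : I -> T -> R) :
  (forall i, buc (F i)) -> buc (fun x => \prod_(i <- r) F i x).
Proof.
move=> bF; elim: r => [|i r IH].
  by apply: (eq_buc _ (buc_cst 1)) => x _; rewrite big_nil.
by apply: (eq_buc _ (bucM (bF i) IH)) => x _; rewrite big_cons.
Qed.

(** Three-epsilon argument. This closure keeps the limits of Cauchy sequences inside the class when
    a space is completed. *)
Lemma buc_uniform F :
  (forall e, 0 < e -> exists2 G, buc G & forall x, D x -> `|F x - G x| <= e) ->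
  buc F.
Proof.
move=> H; split.
  have [G /buc_bound[M M0 HM] HG] := H _ (@ltr01 R).
  exists (1 + M) => x Dx; rewrite -[F x](subrK (G x)).
  by rewrite (le_trans (ler_normD _ _))// lerD ?HG ?HM.
move=> e e0; have e3 : 0 < e / 3 by rewrite divr_gt0.
have [G [_ bG] HG] := H _ e3; have [dl dl0 Hd] := bG _ e3.
exists dl => // x y Dx Dy cl.
rewrite (_ : _ - _ = (F x - G x) + (G x - G y) - (F y - G y)); last by ring.
rewrite (le_trans (ler_normB _ _))//.
rewrite (_ : e = e / 3 + e / 3 + e / 3); last by field.
by rewrite lerD ?HG// (le_trans (ler_normD _ _))// lerD ?HG ?Hd.
Qed.

End BoundedUniformlyContinuous.

(** * Integrals over the unit interval and the cube *)

Section IntegralOverUnitInterval.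
Context {R : realType}.
Implicit Types f g : R -> R.
Local Notation mu := (@lebesgue_measure R).

Lemma unit_intervalP (x : R) : unit_interval x = (0 <= x <= 1) :> Prop.
Proof. by rewrite /unit_interval /= in_itv. Qed.

Lemma unit_interval_01 (x : R) : 0 <= x <= 1 -> unit_interval x.
Proof. by rewrite unit_intervalP. Qed.

Lemma unit_interval_le (x : R) : unit_interval x -> 0 <= x <= 1.
Proof. by rewrite unit_intervalP. Qed.

Lemma measurable_unit_interval : measurable (unit_interval : set (measurableTypeR R)).
Proof. exact: measurable_itv. Qed.

Definition integrable01 f := mu.-integrable unit_interval (EFin \o f).

Definition buc01 : (R -> R) -> Prop :=
  buc unit_interval (fun dl x y => `|x - y| < dl).

Lemma ltr_norm_mono (a b x y : R) : a <= b -> `|x - y| < a -> `|x - y| < b.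
Proof. by move=> ab /lt_le_trans; apply. Qed.

Lemma continuous_integrable01 f :
  {within unit_interval, continuous f} -> integrable01 f.
Proof.
by move=> cf; apply: continuous_compact_integrable => //; exact: segment_compact.
Qed.

Lemma buc01_continuous f : buc01 f -> {within unit_interval, continuous f}.
Proof.
move=> [_ H]; apply/continuous_within_itvP; first exact: ltr01.
have K : forall x, unit_interval x -> forall e, 0 < e -> exists2 dl, 0 < dl &
    forall y, unit_interval y -> `|x - y| < dl -> `|f x - f y| < e.
  move=> x Dx e e0; have e2 : 0 < e / 2 by rewrite divr_gt0.
  have [dl dl0 Hd] := H _ e2; exists dl => // y Dy xy.
  by apply: le_lt_trans (Hd _ _ Dx Dy xy) _; rewrite ltr_pdivrMr// ltr_pMr// ltr1n.
split.
- move=> x; rewrite in_itv/= => /andP[x0 x1].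
  apply/cvgrPdist_lt => e e0.
  have Dx : unit_interval x by rewrite unit_intervalP !ltW.
  have [dl dl0 Hd] := K _ Dx _ e0.
  have : \forall y \near x, `|x - y| < dl by apply: nbhsx_ballx.
  move=> Hn; near=> y; apply: Hd; last by near: y.
  rewrite unit_intervalP; apply/andP; split; apply: ltW.
    by near: y; exact: lt_nbhsr.
  by near: y; exact: lt_nbhsl.
- apply/cvgrPdist_lt => e e0.
  have D0 : unit_interval (0 : R) by rewrite unit_intervalP lexx ler01.
  have [dl dl0 Hd] := K _ D0 _ e0.
  near=> y; apply: Hd.
    rewrite unit_intervalP; apply/andP; split; apply: ltW.
      by near: y; exact: nbhs_right_gt.
    by near: y; exact: nbhs_right_lt.
  rewrite sub0r normrN gtr0_norm; first by near: y; exact: nbhs_right_lt.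
  by near: y; exact: nbhs_right_gt.
- apply/cvgrPdist_lt => e e0.
  have D1 : unit_interval (1 : R) by rewrite unit_intervalP lexx ler01.
  have [dl dl0 Hd] := K _ D1 _ e0.
  near=> y; apply: Hd.
    rewrite unit_intervalP; apply/andP; split; apply: ltW.
      by near: y; exact: nbhs_left_gt.
    by near: y; exact: nbhs_left_lt.
  rewrite gtr0_norm; last by rewrite subr_gt0; near: y; exact: nbhs_left_lt.
  rewrite ltrBlDl -ltrBlDr; near: y; apply: nbhs_left_gt.
  by rewrite ltrBlDr ltrDl.
Unshelve. all: by end_near. Qed.

Lemma buc01_integrable f : buc01 f -> integrable01 f.
Proof. by move=> /buc01_continuous; exact: continuous_integrable01. Qed.

Lemma eq_int01 f g : (forall x, 0 <= x <= 1 -> f x = g x) -> int01 f = int01 g.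
Proof.
move=> fg; apply: eq_Rintegral => x; rewrite inE => Dx; apply: fg.
by rewrite -unit_intervalP.
Qed.

Lemma integrable01D f g : integrable01 f -> integrable01 g ->
  integrable01 (fun x => f x + g x).
Proof.
move=> fi gi.
exact: (integrableD measurable_unit_interval fi gi).
Qed.

Lemma integrable01Z c f : integrable01 f -> integrable01 (fun x => c * f x).
Proof.
move=> fi.
exact: (integrableZl measurable_unit_interval c fi).
Qed.

Lemma integrable01_cst (c : R) : integrable01 (fun=> c).
Proof. exact/buc01_integrable/buc_cst. Qed.

Lemma integrable01_sum (I : Type) (r : seq I) (F : I -> R -> R) :
  (forall i, integrable01 (F i)) -> integrable01 (fun x => \sum_(i <- r) F i x).
Proof.
move=> H; elim: r => [|i r IH].
  rewrite (_ : (fun x => _) = fun=> 0); first exact: integrable01_cst.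
  by apply/funext => x; rewrite big_nil.
rewrite (_ : (fun x => _) = fun x => F i x + \sum_(i <- r) F i x).
  exact: integrable01D.
by apply/funext => x; rewrite big_cons.
Qed.

Lemma int01D f g : integrable01 f -> integrable01 g ->
  int01 (fun x => f x + g x) = int01 f + int01 g.
Proof. by move=> fi gi; apply: RintegralD => //; exact: measurable_unit_interval. Qed.

Lemma int01B f g : integrable01 f -> integrable01 g ->
  int01 (fun x => f x - g x) = int01 f - int01 g.
Proof. by move=> fi gi; apply: RintegralB => //; exact: measurable_unit_interval. Qed.

Lemma int01Z c f : integrable01 f -> int01 (fun x => c * f x) = c * int01 f.
Proof. by move=> fi; apply: RintegralZl => //; exact: measurable_unit_interval. Qed.

Lemma int01_cst (c : R) : int01 (fun=> c) = c.
Proof.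
have m1 : mu unit_interval = 1%E by rewrite lebesgue_measure_itv/= lte01 oppr0 adde0.
rewrite /int01 Rintegral_cst; last exact: measurable_unit_interval.
by rewrite (_ : fine _ = 1) ?mulr1// -[RHS]/(fine 1%E); congr fine.
Qed.

Lemma int01_sum (I : Type) (r : seq I) (F : I -> R -> R) :
  (forall i, integrable01 (F i)) ->
  int01 (fun x => \sum_(i <- r) F i x) = \sum_(i <- r) int01 (F i).
Proof.
move=> H; elim: r => [|i r IH].
  rewrite big_nil -[RHS](int01_cst 0); apply: eq_int01 => x _.
  by rewrite big_nil.
rewrite big_cons -IH -int01D//; last exact: integrable01_sum.
by apply: eq_int01 => x _; rewrite big_cons.
Qed.

Lemma int01_ge0 f : (forall x, 0 <= x <= 1 -> 0 <= f x) -> 0 <= int01 f.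
Proof.
by move=> f0; apply: Rintegral_ge0 => x; rewrite unit_intervalP; exact: f0.
Qed.

Lemma le_int01 f g : integrable01 f -> integrable01 g ->
  (forall x, 0 <= x <= 1 -> f x <= g x) -> int01 f <= int01 g.
Proof.
move=> fi gi fg; apply: (le_Rintegral measurable_unit_interval fi gi).
by move=> x; rewrite unit_intervalP; exact: fg.
Qed.

Lemma norm_int01_le f e : integrable01 f ->
  (forall x, 0 <= x <= 1 -> `|f x| <= e) -> `|int01 f| <= e.
Proof.
move=> fi fe; rewrite ler_norml -{1}(int01_cst (- e)) -{2}(int01_cst e).
apply/andP; split; apply: le_int01 => //.
- exact: integrable01_cst.
- by move=> x /fe; rewrite ler_norml => /andP[].
- exact: integrable01_cst.
- by move=> x /fe; rewrite ler_norml => /andP[].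
Qed.

Lemma lipschitz_buc01 f K :
  (forall x y, unit_interval x -> unit_interval y -> `|f x - f y| <= K * `|x - y|) -> buc01 f.
Proof.
move=> H.
have K0 : 0 <= K.
  have := H 1 0; rewrite subr0 normr1 mulr1 !unit_intervalP !lexx !ler01 => /(_ isT isT).
  by apply: le_trans.
split.
  exists (`|f 0| + K) => x Dx; rewrite -[f x](subrK (f 0)) addrC.
  rewrite (le_trans (ler_normD _ _))// lerD2l.
  have D0 : unit_interval (0:R) by rewrite unit_intervalP lexx ler01.
  apply: le_trans (H _ _ Dx D0) _; rewrite ler_piMr// subr0.
  by move: Dx; rewrite unit_intervalP => /andP[x0 x1]; rewrite ger0_norm.
move=> e e0; exists (e / (K + 1)); first by rewrite divr_gt0// ltr_wpDl.
move=> x y Dx Dy xy; apply: le_trans (H _ _ Dx Dy) _.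
rewrite (@le_trans _ _ ((K + 1) * `|x - y|))// ?ler_wpM2r// ?lerDl//.
by rewrite mulrC -ler_pdivlMr ?ltr_wpDl// ltW.
Qed.

End IntegralOverUnitInterval.

Section TrigonometricIntegrals.
Context {R : realType}.
Implicit Types f F : R -> R.

Lemma is_derive_sinZ (c x : R) : is_derive x 1 (fun x => sin (c * x)) (c * cos (c * x)).
Proof. by apply: trigger_derive; rewrite /GRing.scale/= mulr1 mulrC. Qed.

Lemma is_derive_cosZ (c x : R) : is_derive x 1 (fun x => cos (c * x)) (- (c * sin (c * x))).
Proof. by apply: trigger_derive; rewrite /GRing.scale/= mulr1 mulNr mulrC. Qed.

Lemma is_derive_continuous F f : (forall x : R, is_derive x 1 F (f x)) -> continuous F.
Proof.
move=> dF x; apply: differentiable_continuous; rewrite -derivable1_diffP.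
by have := dF x => ?; exact: ex_derive.
Qed.

Lemma continuous_sinZ (c : R) : continuous (fun x => sin (c * x)).
Proof. exact: (is_derive_continuous (fun x => is_derive_sinZ c x)). Qed.

Lemma continuous_cosZ (c : R) : continuous (fun x => cos (c * x)).
Proof. exact: (is_derive_continuous (fun x => is_derive_cosZ c x)). Qed.

Lemma int01_derive F f : (forall x : R, is_derive x 1 F (f x)) -> continuous f ->
  int01 f = F 1 - F 0.
Proof.
move=> dF cf; have cF := is_derive_continuous dF.
rewrite /int01 /Rintegral (@continuous_FTC2 _ f F)//.
- exact: continuous_subspaceT.
- split.
  + by move=> x ?; have := dF x => ?; exact: ex_derive.
  + by apply: cvg_at_right_filter; exact: cF.
  + by apply: cvg_at_left_filter; exact: cF.
- by move=> x ?; rewrite derive1E; have := dF x => ?; exact: derive_val.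
Qed.

Lemma is_derive_lipschitz F f K : (forall x : R, is_derive x 1 F (f x)) ->
  (forall x, `|f x| <= K) -> forall x y, `|F x - F y| <= K * `|x - y|.
Proof.
move=> dF fK.
have H x y : x <= y -> `|F y - F x| <= K * `|y - x|.
  move=> xy.
  have h1 : forall z, z \in `]x, y[ -> is_derive z 1 F (f z) by move=> z _; exact: dF.
  have h2 : {within `[x, y], continuous F}.
    exact/continuous_subspaceT/(is_derive_continuous dF).
  by have [c _ ->] := MVT_segment xy h1 h2; rewrite normrM ler_wpM2r.
move=> x y; case: (leP x y) => [xy|/ltW yx]; last exact: H.
by rewrite distrC [`|x - y|]distrC H.
Qed.

Lemma int01_cosZ (c : R) : c != 0 -> int01 (fun x => cos (c * x)) = sin c / c.
Proof.
move=> c0.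
have dF (x : R) : is_derive x 1 (fun x => c^-1 * sin (c * x)) (cos (c * x)).
  by apply: trigger_derive; rewrite /GRing.scale/= mulr1 mulrC mulfK.
rewrite (int01_derive dF (@continuous_cosZ c)).
by rewrite mulr1 mulr0 sin0 mulr0 subr0 mulrC.
Qed.

Lemma sin_natpi (n : nat) : sin (n%:R * pi) = 0 :> R.
Proof.
elim: n => [|n IH]; first by rewrite mul0r sin0.
by rewrite -natr1 mulrDl mul1r sinD IH sinpi mul0r mulr0 addr0.
Qed.

Lemma sin_natpiB (k l : nat) : sin ((k%:R - l%:R) * pi) = 0 :> R.
Proof. by rewrite mulrBl sinB !sin_natpi mul0r mulr0 subrr. Qed.

Lemma int01_cos_natB (k l : nat) :
  int01 (fun x : R => cos ((k%:R - l%:R) * pi * x)) = (k == l)%:R.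
Proof.
have [->|kl] := eqVneq k l.
  rewrite subrr mul0r -[RHS](@int01_cst R); apply: eq_int01 => x _.
  by rewrite mul0r cos0.
rewrite int01_cosZ ?sin_natpiB ?mul0r//.
by rewrite mulf_neq0// ?subr_eq0 ?eqr_nat// gt_eqF// pi_gt0.
Qed.

Lemma int01_cos_nat (k : nat) :
  int01 (fun x : R => cos (k%:R * pi * x)) = (k == 0)%:R.
Proof.
rewrite -(int01_cos_natB k 0); apply: eq_int01 => x _.
by rewrite subr0.
Qed.

Lemma cosMcos (a b : R) : cos a * cos b = (cos (a - b) + cos (a + b)) / 2.
Proof. by rewrite cosB cosD; field. Qed.

Lemma sinMsin (a b : R) : sin a * sin b = (cos (a - b) - cos (a + b)) / 2.
Proof. by rewrite cosB cosD; field. Qed.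

Lemma integrable01_cosZ (c : R) : integrable01 (fun x => cos (c * x)).
Proof. exact/continuous_integrable01/continuous_subspaceT/continuous_cosZ. Qed.

Lemma int01_coscos (k l : nat) :
  int01 (fun x : R => cos (k%:R * pi * x) * cos (l%:R * pi * x)) =
  ((k == l)%:R + (k + l == 0)%N%:R) / 2.
Proof.
rewrite -int01_cos_natB -int01_cos_nat -int01D; try exact: integrable01_cosZ.
rewrite [RHS]mulrC -int01Z; last by apply: integrable01D; exact: integrable01_cosZ.
apply: eq_int01 => x _; rewrite cosMcos mulrC; congr (_ * (cos _ + cos _)).
  by rewrite !mulrBl.
by rewrite natrD !mulrDl.
Qed.

Lemma int01_sinsin (k l : nat) :
  int01 (fun x : R => sin (k%:R * pi * x) * sin (l%:R * pi * x)) =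
  ((k == l)%:R - (k + l == 0)%N%:R) / 2.
Proof.
rewrite -int01_cos_natB -int01_cos_nat -int01B; try exact: integrable01_cosZ.
rewrite [RHS]mulrC -int01Z; last first.
  apply: integrable01D; first exact: integrable01_cosZ.
  apply/continuous_integrable01/continuous_subspaceT => x.
  by apply: cvgN; exact: continuous_cosZ.
apply: eq_int01 => x _; rewrite sinMsin mulrC; congr (_ * (cos _ - cos _)).
  by rewrite !mulrBl.
by rewrite natrD !mulrDl.
Qed.

Definition cos_scale (k : nat) : R := if k == 0%N then 1 else Num.sqrt 2.

Lemma cos_basisE (k : nat) (x : R) : cos_basis k x = cos_scale k * cos (k%:R * pi * x).
Proof.
rewrite /cos_basis /cos_scale; case: eqP => // ->.
by rewrite !mul0r cos0 mulr1.
Qed.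

Lemma cos_scale_sqr k : cos_scale k ^+ 2 = if k == 0%N then 1 else 2.
Proof. by rewrite /cos_scale; case: eqP => _; rewrite ?expr1n// sqr_sqrtr. Qed.

Lemma cos_scale_ge0 k : 0 <= cos_scale k.
Proof. by rewrite /cos_scale; case: eqP. Qed.

Lemma cos_basis_bound (k : nat) (x : R) : `|cos_basis k x| <= 2.
Proof.
rewrite cos_basisE normrM ger0_norm ?cos_scale_ge0//.
rewrite (@le_trans _ _ (cos_scale k))//.
  by rewrite ler_piMr ?cos_scale_ge0 ?cos_max.
rewrite /cos_scale; case: eqP => _; first by rewrite ler1n.
by rewrite -(@ler_pXn2r _ 2) ?nnegrE// sqr_sqrtr// -natrX ler_nat.
Qed.

Lemma cos_basis0 : cos_basis 0 = (fun=> 1) :> (R -> R).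
Proof. by []. Qed.

Lemma buc01_cosZ (c : R) : buc01 (fun x => cos (c * x)).
Proof.
apply: (@lipschitz_buc01 _ _ `|c|) => x y _ _.
apply: (is_derive_lipschitz (fun x => is_derive_cosZ c x)) => z.
by rewrite normrN normrM ler_piMr// sin_max.
Qed.

Lemma buc01_sinZ (c : R) : buc01 (fun x => sin (c * x)).
Proof.
apply: (@lipschitz_buc01 _ _ `|c|) => x y _ _.
apply: (is_derive_lipschitz (fun x => is_derive_sinZ c x)) => z.
by rewrite normrM ler_piMr// cos_max.
Qed.

Lemma buc01_cos_basis k : buc01 (@cos_basis R k).
Proof.
apply: (@eq_buc _ _ _ _ (fun x => cos_scale k * cos (k%:R * pi * x))).
  by move=> x _; rewrite cos_basisE.
by apply: bucZ; [exact: ltr_norm_mono | exact: buc01_cosZ].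
Qed.

Lemma int01_cos_basis2 k l :
  int01 (fun x : R => cos_basis k x * cos_basis l x) = (k == l)%:R.
Proof.
under eq_fun do rewrite !cos_basisE mulrACA.
rewrite int01Z; last first.
  apply/buc01_integrable/bucM; try exact: buc01_cosZ; exact: ltr_norm_mono.
rewrite int01_coscos; have [->|kl] := eqVneq k l.
  rewrite -expr2 cos_scale_sqr addnn double_eq0; case: eqP => _.
    by rewrite mul1r -[1 + 1]/(2%:R) divff.
  by rewrite addr0 mul1r divff.
rewrite add0r addn_eq0; case: eqP => [k0|_]; last by rewrite mul0r mulr0.
by case: eqP => [l0|_]; [rewrite k0 l0 eqxx in kl | rewrite mul0r mulr0].
Qed.

End TrigonometricIntegrals.

Section IntegralOverCube.
Context {R : realType}.

Definition buc_cube (d : nat) : (d.-tuple R -> R) -> Prop :=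
  buc (cube d) (fun dl x y => forall j, `|tnth x j - tnth y j| < dl).

Lemma cube_close_mono d (a b : R) (x y : d.-tuple R) : a <= b ->
  (forall j, `|tnth x j - tnth y j| < a) -> forall j, `|tnth x j - tnth y j| < b.
Proof. by move=> ab H j; apply: lt_le_trans ab. Qed.

Lemma cube_cons d (t : R) (x : d.-tuple R) : 0 <= t <= 1 -> cube d x ->
  cube d.+1 [tuple of t :: x].
Proof.
move=> t01 cx j; case: (unliftP ord0 j) => [i|] ->; last by rewrite tnth0.
by rewrite tnthS; exact: cx.
Qed.

Lemma buc_cube_section d (F : d.+1.-tuple R -> R) (t : R) : 0 <= t <= 1 ->
  buc_cube F -> buc_cube (fun x : d.-tuple R => F [tuple of t :: x]).
Proof.
move=> t01 [[M HM] HF]; split.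
  by exists M => x cx; apply: HM; exact: cube_cons.
move=> e /HF[dl dl0 H]; exists dl => // x y cx cy cl.
apply: H; [exact: cube_cons | exact: cube_cons |].
move=> j; case: (unliftP ord0 j) => [i|] ->; last by rewrite !tnth0 subrr normr0.
by rewrite !tnthS; exact: cl.
Qed.

Lemma buc_coord d (f : R -> R) (j : 'I_d) :
  buc01 f -> buc_cube (fun x => f (tnth x j)).
Proof.
move=> [[M HM] Hf]; split.
  by exists M => x cx; apply: HM; exact/unit_interval_01/cx.
move=> e /Hf[dl dl0 H]; exists dl => // x y cx cy cl.
by apply: H; [exact/unit_interval_01/cx | exact/unit_interval_01/cy | exact: cl].
Qed.

Lemma buc_tensor d (f : 'I_d -> R -> R) :
  (forall j, buc01 (f j)) -> buc_cube (fun x => \prod_(j < d) f j (tnth x j)).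
Proof.
by move=> bf; apply: buc_prod => [|j]; [exact: cube_close_mono | exact: buc_coord].
Qed.

Lemma eq_cube_int d (F G : d.-tuple R -> R) :
  (forall x, cube d x -> F x = G x) -> cube_int F = cube_int G.
Proof.
elim: d F G => [|d IH] F G FG /=; first by apply: FG => -[].
by apply: eq_int01 => t t01; apply: IH => x cx; apply: FG; exact: cube_cons.
Qed.

Lemma cube_int_ge0 d (F : d.-tuple R -> R) :
  (forall x, cube d x -> 0 <= F x) -> 0 <= cube_int F.
Proof.
elim: d F => [|d IH] F F0 /=; first by apply: F0 => -[].
by apply: int01_ge0 => t t01; apply: IH => x cx; apply: F0; exact: cube_cons.
Qed.

(** Linearity and the sup bound share one induction because each step needs both: the inner integral
    must be uniformly continuous in the outer variable ([sec]), and for that the difference of two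
    inner integrals is rewritten as one integral and then bounded. *)
Lemma cube_int_linear_bound d :
  (forall (F G : d.-tuple R -> R) a, buc_cube F -> buc_cube G ->
    cube_int (fun x => a * F x + G x) = a * cube_int F + cube_int G) /\
  (forall (F : d.-tuple R -> R) e, buc_cube F ->
    (forall x, cube d x -> `|F x| <= e) -> `|cube_int F| <= e).
Proof.
elim: d => [|d [IHl IHb]]; first by split => [//|F e _]; apply => -[].
have sec (F : d.+1.-tuple R -> R) : buc_cube F ->
    buc01 (fun t => cube_int (fun x : d.-tuple R => F [tuple of t :: x])).
  move=> bF; have [M M0 HM] := buc_bound bF; case: (bF) => _ HF; split.
    exists M => t /unit_interval_le t01; apply: IHb => [|x cx].
      exact: buc_cube_section.
    by apply: HM; exact: cube_cons.
  move=> e /HF[dl dl0 H]; exists dl => // s t /unit_interval_le s01 /unit_interval_le t01 st.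
  rewrite -mulN1r addrC -IHl; try exact: buc_cube_section.
  apply: IHb => [|x cx].
    apply: bucD; [exact: cube_close_mono | | exact: buc_cube_section].
    by apply: bucZ; [exact: cube_close_mono | exact: buc_cube_section].
  rewrite mulN1r addrC; apply: H; [exact: cube_cons | exact: cube_cons |].
  move=> j; case: (unliftP ord0 j) => [i|] ->; last by rewrite !tnth0.
  by rewrite !tnthS subrr normr0.
split=> [F G a bF bG|F e bF He] /=.
  rewrite -int01Z; last exact/buc01_integrable/sec.
  rewrite -int01D; [|apply: integrable01Z|]; try exact/buc01_integrable/sec.
  by apply: eq_int01 => t t01; rewrite IHl//; exact: buc_cube_section.
apply: norm_int01_le => [|t t01]; first exact/buc01_integrable/sec.
apply: IHb => [|x cx]; first exact: buc_cube_section.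
by apply: He; exact: cube_cons.
Qed.

Lemma norm_cube_int_le d (F : d.-tuple R -> R) e : buc_cube F ->
  (forall x, cube d x -> `|F x| <= e) -> `|cube_int F| <= e.
Proof. by case: (cube_int_linear_bound d) => _; apply. Qed.

Lemma cube_intZ d (F : d.-tuple R -> R) a : buc_cube F ->
  cube_int (fun x => a * F x) = a * cube_int F.
Proof.
case: (cube_int_linear_bound d) => H _ bF.
have b0 : buc_cube (fun _ : d.-tuple R => 0) by exact: buc_cst.
transitivity (cube_int (fun x => a * F x + 0)).
  by apply: eq_cube_int => x _; rewrite addr0.
rewrite H// (_ : cube_int (fun=> 0) = 0) ?addr0//.
by apply/normr0_eq0/le_anti; rewrite normr_ge0 norm_cube_int_le// => x _; rewrite normr0.
Qed.

Lemma cube_intD d (F G : d.-tuple R -> R) : buc_cube F -> buc_cube G ->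
  cube_int (fun x => F x + G x) = cube_int F + cube_int G.
Proof.
case: (cube_int_linear_bound d) => H _ bF bG.
by rewrite -[X in X + _]mul1r -H//; apply: eq_cube_int => x _; rewrite mul1r.
Qed.

Lemma cube_intB d (F G : d.-tuple R -> R) : buc_cube F -> buc_cube G ->
  cube_int (fun x => F x - G x) = cube_int F - cube_int G.
Proof.
move=> bF bG; rewrite cube_intD//; last by apply: bucN => //; exact: cube_close_mono.
by congr (_ + _); rewrite -mulN1r -cube_intZ//; apply: eq_cube_int => x _; rewrite mulN1r.
Qed.

Lemma le_cube_int d (F G : d.-tuple R -> R) : buc_cube F -> buc_cube G ->
  (forall x, cube d x -> F x <= G x) -> cube_int F <= cube_int G.
Proof.
move=> bF bG FG; rewrite -subr_ge0 -cube_intB//.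
by apply: cube_int_ge0 => x /FG; rewrite subr_ge0.
Qed.

Lemma cube_int_sum d (I : Type) (r : seq I) (F : I -> d.-tuple R -> R) :
  (forall i, buc_cube (F i)) ->
  cube_int (fun x => \sum_(i <- r) F i x) = \sum_(i <- r) cube_int (F i).
Proof.
move=> bF; elim: r => [|i r IH].
  rewrite big_nil; transitivity (cube_int (fun _ : d.-tuple R => 0 * 0 : R)).
    by apply: eq_cube_int => x _; rewrite big_nil mul0r.
  by rewrite (@cube_intZ _ (fun=> 0)) ?mul0r//; exact: buc_cst.
rewrite big_cons -IH -cube_intD//; last by apply: buc_sum => //; exact: cube_close_mono.
by apply: eq_cube_int => x _; rewrite big_cons.
Qed.

Lemma cube_int_tensor d (f : 'I_d -> R -> R) : (forall j, buc01 (f j)) ->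
  cube_int (fun x => \prod_(j < d) f j (tnth x j)) = \prod_(j < d) int01 (f j).
Proof.
elim: d f => [|d IH] f bf; first by rewrite /= !big_ord0.
rewrite big_ord_recl /= mulrC -int01Z; last exact/buc01_integrable.
apply: eq_int01 => t t01; rewrite -IH// mulrC -cube_intZ; last first.
  by apply: (@buc_tensor _ (fun j => f (lift ord0 j))) => j; exact: bf.
apply: eq_cube_int => x _; rewrite big_ord_recl tnth0; congr (_ * _).
by apply: eq_bigr => j _; rewrite tnthS.
Qed.

End IntegralOverCube.

(** * Fejer kernel and uniform approximation by cosine polynomials *)

Section FejerKernel.
Context {R : realType}.

Definition fejer_coef (N k : nat) : R := 1 - k%:R / N%:R.

Definition fejer_kernel (N : nat) (x y : R) : R :=
  \sum_(k < N) fejer_coef N k * (cos_basis k x * cos_basis k y).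

(* N F_N(theta) = |sum_(k < N) exp(i k theta)|^2 is what makes the kernel nonnegative. *)
Lemma fejer_sum_sqr (N : nat) (t : R) :
  \sum_(k < N) (N%:R - k%:R) * (cos_scale k ^+ 2 * cos (k%:R * t)) =
  (\sum_(k < N) cos (k%:R * t)) ^+ 2 + (\sum_(k < N) sin (k%:R * t)) ^+ 2.
Proof.
elim: N => [|N IH]; first by rewrite !big_ord0 expr0n addr0.
have -> : \sum_(k < N.+1) (N.+1%:R - k%:R) * (cos_scale k ^+ 2 * cos (k%:R * t)) =
    \sum_(k < N) (N%:R - k%:R) * (cos_scale k ^+ 2 * cos (k%:R * t)) +
    \sum_(k < N.+1) cos_scale k ^+ 2 * cos (k%:R * t).
  rewrite [X in _ = _ + X]big_ord_recr /= addrA -big_split big_ord_recr /=.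
  congr (_ + _); last by rewrite -natr1 addrAC subrr add0r mul1r.
  by apply: eq_bigr => k _; rewrite -natr1; ring.
rewrite IH !big_ord_recr /=.
(* Passing from [N] to [N.+1] adds to the squares the cross terms with the new index; by the
   addition formula they are [cos ((N - i) t)], and reversing the summation gives the frequencies 1
   to [N]. *)
have e : \sum_(i < N) cos (i%:R * t) * cos (N%:R * t) +
    \sum_(i < N) sin (i%:R * t) * sin (N%:R * t) = \sum_(i < N) cos (i.+1%:R * t).
  rewrite -big_split [RHS](reindex_inj rev_ord_inj) /=; apply: eq_bigr => i _.
  rewrite -cosB -cosN opprB -mulrBl; congr (cos (_ * _)).
  by rewrite -natrB 1?ltnW//; congr (_%:R); have := ltn_ord i; lia.
have -> : \sum_(i < N) cos_scale i ^+ 2 * cos (i%:R * t) +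
   cos_scale N ^+ 2 * cos (N%:R * t) = 1 + 2 * \sum_(i < N) cos (i.+1%:R * t).
  transitivity (\sum_(i < N.+1) cos_scale i ^+ 2 * cos (i%:R * t)).
    by rewrite big_ord_recr.
  rewrite big_ord_recl /= cos_scale_sqr /= mul0r cos0 mulr1 big_distrr /=.
  by congr (_ + _); apply: eq_bigr => i _; rewrite cos_scale_sqr.
rewrite -e -!mulr_suml.
by rewrite !sqrrD (cos2sin2 (N%:R * t)); ring.
Qed.

(** The product formula for cosines splits the kernel into half the sum of two classical Fejer
    kernels, at [x - y] and at [x + y], each a positive multiple of a sum of two squares. *)
Lemma fejer_kernel_ge0 N x y : 0 <= fejer_kernel N x y.
Proof.
case: N => [|N]; first by rewrite /fejer_kernel big_ord0.
have N0 : (N.+1%:R : R) != 0 by rewrite pnatr_eq0.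
have -> : fejer_kernel N.+1 x y = (N.+1%:R * 2)^-1 *
    (\sum_(k < N.+1) (N.+1%:R - k%:R) * (cos_scale k ^+ 2 * cos (k%:R * (pi * (x - y)))) +
     \sum_(k < N.+1) (N.+1%:R - k%:R) * (cos_scale k ^+ 2 * cos (k%:R * (pi * (x + y))))).
  rewrite -big_split big_distrr; apply: eq_bigr => k _ /=.
  rewrite /fejer_coef !cos_basisE (mulrACA (cos_scale k)) cosMcos.
  rewrite -!(mulrA k%:R) -mulrBr -mulrDr -mulrBr -mulrDr.
  by move: N0; move: (N.+1%:R : R) => n n0; field.
by rewrite mulr_ge0 ?invr_ge0 ?mulr_ge0// !fejer_sum_sqr !addr_ge0// sqr_ge0.
Qed.

Lemma buc01_fejer_kernel N x : buc01 (fejer_kernel N x).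
Proof.
apply: buc_sum => [|k]; first exact: ltr_norm_mono.
apply: bucZ; first exact: ltr_norm_mono.
by apply: bucZ; [exact: ltr_norm_mono | exact: buc01_cos_basis].
Qed.

Lemma int01_fejer_cos_basis N j x : (j < N)%N ->
  int01 (fun y => fejer_kernel N x y * cos_basis j y) =
  fejer_coef N j * cos_basis j x.
Proof.
move=> jN.
transitivity (int01 (fun y => \sum_(k < N) (fejer_coef N k * cos_basis k x) *
    (cos_basis k y * cos_basis j y))).
  apply: eq_int01 => y _; rewrite big_distrl; apply: eq_bigr => k _ /=; ring.
have ib k l : integrable01 (fun y : R => cos_basis k y * cos_basis l y).
  by apply/buc01_integrable/bucM; try exact: buc01_cos_basis; exact: ltr_norm_mono.
rewrite int01_sum; last by move=> k; apply: integrable01Z.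
rewrite (bigD1 (Ordinal jN))//= int01Z// int01_cos_basis2 eqxx mulr1 big1 ?addr0//.
move=> k kj; rewrite int01Z// int01_cos_basis2 (_ : (k == j :> nat) = false) ?mulr0//.
by apply/eqP => kj'; move/eqP: kj; apply; exact: val_inj.
Qed.

Lemma int01_fejer N x : (0 < N)%N -> int01 (fejer_kernel N x) = 1.
Proof.
move=> N0; rewrite -[RHS](mulr1 1) -[X in _ = X * _](_ : fejer_coef N 0 = 1).
  rewrite -(int01_fejer_cos_basis x N0).
  by apply: eq_int01 => y _; rewrite mulr1.
by rewrite /fejer_coef mul0r subr0.
Qed.

(** In [y] the squared difference is a cosine polynomial of degree 2, and the kernel only multiplies
    its coefficients of degree 1 and 2 by [1 - 1/N] and [1 - 2/N]; hence [2 < N]. The dependence on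
    [x] cancels. This is the second moment in the Korovkin argument below. *)
Lemma int01_fejer_variance N x : (2 < N)%N ->
  int01 (fun y => fejer_kernel N x y * (cos (pi * x) - cos (pi * y)) ^+ 2) = N%:R^-1.
Proof.
move=> N2; set c := cos (pi * x).
have s2 : Num.sqrt 2 != 0 :> R by rewrite gt_eqF// sqrtr_gt0.
have b1 (y : R) : cos_basis 1 y = Num.sqrt 2 * cos (pi * y) by rewrite cos_basisE mul1r.
have b2 (y : R) : cos_basis 2 y = Num.sqrt 2 * (2 * cos (pi * y) ^+ 2 - 1).
  rewrite cos_basisE -mulrA [2 * _]mulr_natl cos_mulr2n; congr (_ * _).
  by rewrite -mulr_natl.
transitivity (int01 (fun y => (c ^+ 2 + 2^-1) * (fejer_kernel N x y * cos_basis 0 y) +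
   (- (2 * c / Num.sqrt 2) * (fejer_kernel N x y * cos_basis 1 y) +
   (2 * Num.sqrt 2)^-1 * (fejer_kernel N x y * cos_basis 2 y)))).
  apply: eq_int01 => y _; rewrite b1 b2 cos_basis0; by field.
have ib k : integrable01 (fun y : R => fejer_kernel N x y * cos_basis k y).
  apply/buc01_integrable/bucM; [exact: ltr_norm_mono | exact: buc01_fejer_kernel |].
  exact: buc01_cos_basis.
rewrite int01D ?int01D ?int01Z//; try by [apply: integrable01Z | apply: integrable01D; apply:
    integrable01Z].
rewrite !int01_fejer_cos_basis; try lia.
rewrite b1 b2 /fejer_coef cos_basis0 -/c.
field.
by rewrite s2 /= pnatr_eq0; lia.
Qed.

End FejerKernel.

Section FejerApproximation.
Context {R : realType}.

Lemma sin_pi_mono (u s : R) : 0 <= u -> u <= s -> s <= 1 - u ->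
  sin (pi * u) <= sin (pi * s).
Proof.
move=> u0 us su; have p0 := pi_gt0 R.
have mono (a b : R) : 0 <= a -> a <= b -> b <= 1 / 2 -> sin (pi * a) <= sin (pi * b).
  move=> a0 ab b2; move: (ab); rewrite le_eqVlt => /orP[/eqP->//|ab'].
  apply/ltW; rewrite ltr_sin; first by rewrite ltr_pM2l.
    by rewrite in_itv /=; apply/andP; split; nra.
  by rewrite in_itv /=; apply/andP; split; nra.
case: (leP s (1 / 2)) => s2; first exact: mono.
have -> : sin (pi * s) = sin (pi * (1 - s)).
  by rewrite mulrBr mulr1 sinB sinpi cospi; ring.
by apply: mono => //; lra.
Qed.

Lemma cosBcos (a b : R) : cos a - cos b = 2 * sin ((b + a) / 2) * sin ((b - a) / 2).
Proof.
have -> : cos a = cos ((b + a) / 2 - (b - a) / 2) by congr cos; field.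
have -> : cos b = cos ((b + a) / 2 + (b - a) / 2) by congr cos; field.
by rewrite cosB cosD; ring.
Qed.

(** The difference is [2 sin (pi (y + x) / 2) sin (pi (y - x) / 2)]. When [y - x] is at least [dl],
    both [(y + x) / 2] and [(y - x) / 2] lie in [[u, 1 - u]] with [u = min dl 1 / 2], where the sine
    is at least [sin (pi u)]. *)
Lemma cos_pi_separated (dl : R) : 0 < dl -> exists2 eta, 0 < eta &
  forall x y : R, 0 <= x <= 1 -> 0 <= y <= 1 -> dl <= `|x - y| ->
    eta <= (cos (pi * x) - cos (pi * y)) ^+ 2.
Proof.
move=> dl0; have p0 := pi_gt0 R.
pose u := Num.min dl 1 / 2.
have u0 : 0 < u by rewrite divr_gt0// lt_min dl0 ltr01.
have u2 : u <= 1 / 2 by rewrite ler_wpM2r// ge_min lexx orbT.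
have udl : u <= dl / 2 by rewrite ler_wpM2r// ge_min lexx.
have s0 : 0 < sin (pi * u) by apply: sin_gt0_pi; apply/andP; split; nra.
exists ((2 * sin (pi * u) * sin (pi * u)) ^+ 2).
  by rewrite exprn_gt0 ?mulr_gt0.
have H x y : 0 <= x <= 1 -> 0 <= y <= 1 -> dl <= y - x ->
    (2 * sin (pi * u) * sin (pi * u)) ^+ 2 <= (cos (pi * x) - cos (pi * y)) ^+ 2.
  move=> /andP[x0 x1] /andP[y0 y1] xy.
  have -> : cos (pi * x) - cos (pi * y) =
      2 * sin (pi * ((y + x) / 2)) * sin (pi * ((y - x) / 2)).
    by rewrite cosBcos; congr (_ * sin _ * sin _); field.
  apply: lerXn2r; rewrite ?nnegrE.
  - by rewrite !mulr_ge0// ltW.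
  - have h1 : sin (pi * u) <= sin (pi * ((y + x) / 2)) by apply: sin_pi_mono; lra.
    have h2 : sin (pi * u) <= sin (pi * ((y - x) / 2)) by apply: sin_pi_mono; lra.
    have h3 := le_trans (ltW s0) h1; have h4 := le_trans (ltW s0) h2.
    by rewrite mulr_ge0// mulr_ge0.
  - apply: ler_pM; rewrite ?mulr_ge0 ?(ltW s0)//.
      by rewrite ler_pM2l//; apply: sin_pi_mono; lra.
    by apply: sin_pi_mono; lra.
move=> x y hx hy; case: (leP x y) => xy.
  by rewrite distrC ger0_norm ?subr_ge0//; exact: H.
by rewrite gtr0_norm ?subr_gt0// -[(cos _ - cos _) ^+ 2]sqrrN opprB; exact: H.
Qed.

Definition cos_tensor d (k : 'I_d -> nat) (x : d.-tuple R) : R :=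
  \prod_(j < d) cos_basis (k j) (tnth x j).

Definition cos_coef d (k : 'I_d -> nat) (F : d.-tuple R -> R) : R :=
  cube_int (fun y => F y * cos_tensor k y).

Lemma buc_cos_tensor d (k : 'I_d -> nat) : buc_cube (cos_tensor k).
Proof.
by apply: (@buc_tensor _ _ (fun j => cos_basis (k j))) => j; exact: buc01_cos_basis.
Qed.

Definition fejer_tensor_coef d N (k : {ffun 'I_d -> 'I_N}) : R :=
  \prod_(j < d) fejer_coef N (k j).

Definition fejer_mean d N (F : d.-tuple R -> R) (x : d.-tuple R) : R :=
  \sum_(k : {ffun 'I_d -> 'I_N})
    fejer_tensor_coef k * cos_coef (fun j => k j) F * cos_tensor (fun j => k j) x.

Lemma fejer_meanE d N (F : d.-tuple R -> R) (x : d.-tuple R) : buc_cube F ->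
  fejer_mean N F x =
  cube_int (fun y => F y * \prod_(j < d) fejer_kernel N (tnth x j) (tnth y j)).
Proof.
move=> bF; symmetry.
transitivity (cube_int (fun y => \sum_(k : {ffun 'I_d -> 'I_N})
   (fejer_tensor_coef k * cos_tensor (fun j => k j) x) *
   (F y * cos_tensor (fun j => k j) y))).
  apply: eq_cube_int => y _; rewrite /fejer_kernel bigA_distr_bigA /= big_distrr /=.
  apply: eq_bigr => k _; rewrite /fejer_tensor_coef /cos_tensor.
  rewrite big_split /= big_split /=; ring.
have bFk (k : 'I_d -> nat) : buc_cube (fun y => F y * cos_tensor k y).
  by apply: bucM => //; [exact: cube_close_mono | exact: buc_cos_tensor].
rewrite cube_int_sum; last by move=> k; apply: bucZ; [exact: cube_close_mono | exact: bFk].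
apply: eq_bigr => k _; rewrite (cube_intZ _ (bFk _)) /cos_coef; ring.
Qed.

(** Korovkin's argument with the test functions [cos (pi x_j)]: the oscillation of [F] is at most
    [e / 2] plus a multiple of the squared distances [q], and integrating one [q] against the
    product kernel costs the inverse of the kernel's degree parameter, since the other factors have
    mass one. *)
Lemma fejer_mean_cvg d (F : d.-tuple R -> R) (e : R) : buc_cube F -> 0 < e ->
  exists N, forall x, cube d x -> `|fejer_mean N.+1 F x - F x| <= e.
Proof.
move=> bF e0; have [M M0 HM] := buc_bound bF.
case: (bF) => _ HF; have e2 : 0 < e / 2 by rewrite divr_gt0.
have [dl dl0 Hd] := HF _ e2; have [eta eta0 Heta] := cos_pi_separated dl0.
(* If some coordinate is at least [dl] away, the sum of the [q] is at least [eta], so that [C] times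
   it reaches the trivial bound [2 M]. *)
pose C := 2 * M / eta; have C0 : 0 < C by rewrite divr_gt0// mulr_gt0.
pose q (s t : R) := (cos (pi * s) - cos (pi * t)) ^+ 2.
have key (x y : d.-tuple R) : cube d x -> cube d y ->
    `|F y - F x| <= e / 2 + C * \sum_(j < d) q (tnth x j) (tnth y j).
  move=> cx cy; have q0 j : 0 <= q (tnth x j) (tnth y j) by exact: sqr_ge0.
  have [/forallP near|/forallPn[j far]] := boolP [forall j, `|tnth y j - tnth x j| < dl].
    by rewrite (le_trans (Hd _ _ cy cx near))// lerDl mulr_ge0 ?sumr_ge0// ltW.
  have {}far : dl <= `|tnth x j - tnth y j| by rewrite distrC leNgt.
  apply: (@le_trans _ _ (C * eta)).
    rewrite divfK ?gt_eqF// mulr_natl mulr2n.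
    by rewrite (le_trans (ler_normB _ _))// lerD ?HM.
  rewrite (@le_trans _ _ (C * \sum_(j < d) q (tnth x j) (tnth y j)))//; last first.
    by rewrite lerDr ltW.
  rewrite ler_pM2l// (bigD1 j)//= (le_trans (Heta _ _ (cx j) (cy j) far))//.
  by rewrite lerDl sumr_ge0.
have [N [N2 HN]] : exists N : nat, (2 < N.+1)%N /\ C * d%:R / N.+1%:R <= e / 2.
  exists (2 + Num.truncn (2 * C * d%:R / e))%N; split => //.
  rewrite ler_pdivrMr// (_ : C * d%:R = e / 2 * (2 * C * d%:R / e)); last first.
    by field; rewrite gt_eqF.
  by rewrite ler_pM2l// (le_trans (ltW (truncnS_gt _)))// ler_nat ltnS leq_addl.
exists N => x cx; rewrite fejer_meanE//.
pose K (y : d.-tuple R) := \prod_(j < d) fejer_kernel N.+1 (tnth x j) (tnth y j).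
have bK : buc_cube K.
  apply: (@buc_tensor _ _ (fun j => fejer_kernel N.+1 (tnth x j))) => j.
  exact: buc01_fejer_kernel.
have K0 y : 0 <= K y by apply: prodr_ge0 => j _; exact: fejer_kernel_ge0.
have intK : cube_int K = 1.
  rewrite (@cube_int_tensor _ _ (fun j => fejer_kernel N.+1 (tnth x j))); last first.
    by move=> j; exact: buc01_fejer_kernel.
  by rewrite big1// => j _; exact: int01_fejer.
have mono := @cube_close_mono R d.
have bq (s : R) : buc01 (q s).
  apply: bucM; try exact: ltr_norm_mono; apply: bucB; try exact: ltr_norm_mono;
  by [exact: buc_cst | exact: buc01_cosZ].
pose g (j i : 'I_d) (t : R) : R :=
  fejer_kernel N.+1 (tnth x i) t * (if i == j then q (tnth x i) t else 1).
have bg j i : buc01 (g j i).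
  apply: bucM; [exact: ltr_norm_mono | exact: buc01_fejer_kernel |].
  by case: eqP => _; [exact: bq | exact: buc_cst].
have gE j y : q (tnth x j) (tnth y j) * K y = \prod_(i < d) g j i (tnth y i).
  rewrite big_split /= mulrC; congr (_ * _); symmetry.
  by rewrite (bigD1 j)//= eqxx big1 ?mulr1// => i /negPf ->.
have intg j : cube_int (fun y => q (tnth x j) (tnth y j) * K y) = N.+1%:R^-1.
  transitivity (cube_int (fun y => \prod_(i < d) g j i (tnth y i))).
    by apply: eq_cube_int => y _; exact: gE.
  rewrite (cube_int_tensor (bg j)) (bigD1 j)//= big1 ?mulr1; last first.
    move=> i /negPf ij; rewrite -[RHS](@int01_fejer R N.+1 (tnth x i))//.
    by apply: eq_int01 => t _; rewrite /g ij mulr1.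
  rewrite -(@int01_fejer_variance R N.+1 (tnth x j))//.
  by apply: eq_int01 => t _; rewrite /g eqxx.
have bqK j : buc_cube (fun y => q (tnth x j) (tnth y j) * K y).
  apply: (eq_buc (F := fun y => \prod_(i < d) g j i (tnth y i))).
    by move=> y _; rewrite gE.
  by apply: (@buc_tensor _ _ (g j)) => i; exact: bg.
have bFK : buc_cube (fun y => F y * K y) by exact: bucM.
have -> : cube_int (fun y => F y * K y) - F x = cube_int (fun y => (F y - F x) * K y).
  rewrite -[X in _ - X]mulr1 -intK -cube_intZ// -cube_intB//; last exact: bucZ.
  by apply: eq_cube_int => y _; rewrite mulrBl.
have bL : buc_cube (fun y => (F y - F x) * K y).
  by apply: bucM => //; apply: bucB => //; exact: buc_cst.
pose U y := (e / 2) * K y + C * \sum_(j < d) (q (tnth x j) (tnth y j) * K y).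
have bU : buc_cube U.
  by apply: bucD => //; apply: bucZ => //; exact: buc_sum.
have intU : cube_int U = e / 2 + C * d%:R / N.+1%:R.
  rewrite cube_intD; [|exact: bucZ|by apply: bucZ => //; exact: buc_sum].
  rewrite !cube_intZ//; last exact: buc_sum.
  rewrite intK mulr1 cube_int_sum//; congr (_ + _).
  rewrite (eq_bigr (fun=> N.+1%:R^-1)) => [|j _]; last exact: intg.
  by rewrite sumr_const card_ord -[_^-1 *+ d]mulr_natl; ring.
have LU y : cube d y -> `|(F y - F x) * K y| <= U y.
  move=> cy; rewrite normrM (ger0_norm (K0 y)).
  rewrite (le_trans (ler_wpM2r (K0 y) (key _ _ cx cy)))//.
  by rewrite /U mulrDl -(mulrA C) mulr_suml.
have H1 : cube_int (fun y => (F y - F x) * K y) <= cube_int U.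
  by apply: le_cube_int => // y cy; rewrite (le_trans (ler_norm _))// LU.
have H2 : - cube_int U <= cube_int (fun y => (F y - F x) * K y).
  rewrite -mulN1r -cube_intZ//; apply: le_cube_int => //; first exact: bucZ.
  by move=> y cy; rewrite mulN1r lerNl (le_trans (ler_norm _))// normrN LU.
rewrite ler_norml; apply/andP; split.
  by apply: le_trans H2; rewrite lerN2 intU [leRHS]splitr lerD2l.
by apply: le_trans H1 _; rewrite intU [leRHS]splitr lerD2l.
Qed.

Lemma buc01_cos_approx (f : R -> R) (e : R) : buc01 f -> 0 < e ->
  exists (I : finType) (k : I -> nat) (c : I -> R),
    forall x, 0 <= x <= 1 -> `|\sum_i c i * cos ((k i)%:R * pi * x) - f x| <= e.
Proof.
move=> bf e0.
have [N HN] := fejer_mean_cvg (buc_coord (ord0 : 'I_1) bf) e0.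
exists {ffun 'I_1 -> 'I_N.+1}, (fun k : {ffun 'I_1 -> 'I_N.+1} => k ord0 : nat),
  (fun k : {ffun 'I_1 -> 'I_N.+1} => fejer_tensor_coef k *
    cos_coef (fun j => k j) (fun x => f (tnth x ord0)) * cos_scale (k ord0)).
move=> x x01; have /HN : cube 1 [tuple x] by move=> j; rewrite ord1.
rewrite (tnth_nth 0) /= => H; apply: le_trans H; rewrite le_eqVlt; apply/orP; left.
apply/eqP; congr (`|_ - _|); apply: eq_bigr => k _.
by rewrite /cos_tensor big_ord1 cos_basisE (tnth_nth 0)/= !mulrA.
Qed.

End FejerApproximation.

Section RealSequences.
Context {R : realType}.
Implicit Types (u v : nat -> R) (l : R).

Lemma seq_cvgP u l : u @ \oo --> l <->
  forall e, 0 < e -> exists N, forall n, (N <= n)%N -> `|u n - l| <= e.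
Proof.
rewrite cvgrPdist_le; split => H e /H.
  by move=> [N _ HN]; exists N => n Nn; rewrite distrC; exact: HN.
by move=> [N HN]; exists N => // n /= Nn; rewrite distrC; exact: HN.
Qed.

Lemma seq_cauchy_cvg u :
  (forall e, 0 < e -> exists N, forall m n, (N <= m)%N -> (N <= n)%N ->
    `|u m - u n| <= e) -> exists l, u @ \oo --> l.
Proof.
move=> H; exists (lim (u @ \oo)); apply: cauchy_cvg; apply: cauchy_exP => e e0.
have e2 : 0 < e / 2 by rewrite divr_gt0.
have [N HN] := H _ e2; exists (u N); exists N => // n /= Nn.
rewrite /ball /= (le_lt_trans (HN N n _ _))//.
by rewrite ltr_pdivrMr// ltr_pMr// ltr1n.
Qed.

Lemma cvg_le_cst u l b : u @ \oo --> l -> (forall n, u n <= b) -> l <= b.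
Proof.
move=> ul ub; rewrite -(cvg_lim _ ul)//; apply: limr_le.
  by apply/cvg_ex; exists l.
by apply: nearW.
Qed.

Lemma cvg_le_eventually u l b N : u @ \oo --> l ->
  (forall n, (N <= n)%N -> u n <= b) -> l <= b.
Proof.
move=> ul ub; rewrite -(cvg_lim _ ul)//; apply: limr_le.
  by apply/cvg_ex; exists l.
by exists N.
Qed.

Lemma cvg_le_limit u v l b : u @ \oo --> l -> v @ \oo --> b ->
  (forall n, u n <= v n) -> l <= b.
Proof. by move=> ul vb uv; apply: ler_cvg_to ul vb _; apply: nearW. Qed.

Lemma cvg_uniq u l l' : u @ \oo --> l -> u @ \oo --> l' -> l = l'.
Proof. by move=> ul ul'; apply: cvg_unique ul ul'. Qed.

Lemma cvg_sum_seq (I : Type) (r : seq I) (u : I -> nat -> R) (l : I -> R) :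
  (forall i, u i @ \oo --> l i) ->
  (fun n => \sum_(i <- r) u i n) @ \oo --> \sum_(i <- r) l i.
Proof.
move=> H; elim: r => [|i r IH].
  rewrite big_nil (_ : (fun n => _) = fun=> 0); first exact: cvg_cst.
  by apply/funext => n; rewrite big_nil.
rewrite big_cons (_ : (fun n => _) = fun n => u i n + \sum_(i <- r) u i n).
  exact: cvgD.
by apply/funext => n; rewrite big_cons.
Qed.

Lemma cvg_prod_seq (I : Type) (r : seq I) (u : I -> nat -> R) (l : I -> R) :
  (forall i, u i @ \oo --> l i) ->
  (fun n => \prod_(i <- r) u i n) @ \oo --> \prod_(i <- r) l i.
Proof.
move=> H; elim: r => [|i r IH].
  rewrite big_nil (_ : (fun n => _) = fun=> 1); first exact: cvg_cst.
  by apply/funext => n; rewrite big_nil.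
rewrite big_cons (_ : (fun n => _) = fun n => u i n * \prod_(i <- r) u i n).
  exact: cvgM.
by apply/funext => n; rewrite big_cons.
Qed.

Lemma uniform_cvgP (T : choiceType) (D : set T) (p : nat -> T -> R) (f : T -> R) :
  {uniform D, p @ \oo --> f} <->
  forall e, 0 < e -> exists N, forall n, (N <= n)%N ->
    forall x, D x -> `|p n x - f x| <= e.
Proof.
split.
  move=> H e e0.
  have : nbhs (f : {uniform` D -> R}) [set h | forall y, D y -> `|h y - f y| <= e].
    apply/uniform_nbhs; exists [set xy | ball xy.1 e xy.2]; split.
      by rewrite -entourage_ballE; exists e.
    by move=> h Hh y Dy; rewrite distrC ltW//; exact: Hh.
  by move=> /H[N _ HN]; exists N => n Nn; exact: HN.
move=> H P /uniform_nbhs[E [entE EP]].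
move: entE; rewrite -entourage_ballE => -[e /= e0 eE].
have e2 : 0 < e / 2 by rewrite divr_gt0.
have [N HN] := H _ e2; exists N => // n /= Nn; apply: EP => y Dy; apply: eE.
rewrite /ball /= distrC (le_lt_trans (HN _ Nn _ Dy))//.
by rewrite ltr_pdivrMr// ltr_pMr// ltr1n.
Qed.

End RealSequences.

Section WeightedSums.
Context {R : realType} {I : finType}.
Implicit Types (w a b : I -> R).

(** Expanding [\sum w (A b - S a)^2] gives [A (A B - S^2)], which settles [A > 0]; if [A = 0] then
    every [w a^2] vanishes and so does [S]. *)
Lemma cauchy_schwarz_weighted w a b : (forall i, 0 <= w i) ->
  (\sum_i w i * (a i * b i)) ^+ 2 <=
  (\sum_i w i * a i ^+ 2) * (\sum_i w i * b i ^+ 2).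
Proof.
move=> w0; set A := \sum_i _ * a i ^+ 2; set B := \sum_i _ * b i ^+ 2; set S := \sum_i _.
have A0 : 0 <= A by apply: sumr_ge0 => i _; rewrite mulr_ge0// sqr_ge0.
have : 0 <= A * (A * B - S ^+ 2).
  have -> : A * (A * B - S ^+ 2) = \sum_i w i * (A * b i - S * a i) ^+ 2.
    rewrite (eq_bigr (fun i => A ^+ 2 * (w i * b i ^+ 2) - 2 * A * S * (w i * (a i * b i)) +
      S ^+ 2 * (w i * a i ^+ 2))); last by move=> i _; ring.
    by rewrite big_split /= sumrB -!mulr_sumr -/A -/B -/S; ring.
  by apply: sumr_ge0 => i _; rewrite mulr_ge0// sqr_ge0.
move: A0; rewrite le_eqVlt => /orP[/eqP A0 _|A0]; last by rewrite pmulr_rge0// subr_ge0.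
suff -> : S = 0 by rewrite expr0n/= -A0 mul0r.
rewrite /S big1// => i _.
have /eqP : w i * a i ^+ 2 = 0.
  apply/le_anti; rewrite mulr_ge0 ?sqr_ge0// andbT A0 /A (bigD1 i)//= lerDl.
  by apply: sumr_ge0 => j _; rewrite mulr_ge0// sqr_ge0.
rewrite mulf_eq0 sqrf_eq0 => /orP[] /eqP ->; first by rewrite mul0r.
by rewrite mul0r mulr0.
Qed.

Lemma norm_le_cauchy_schwarz w a b (A B e : R) : (forall i, 0 <= w i) ->
  \sum_i w i * a i ^+ 2 <= A -> \sum_i w i * b i ^+ 2 <= B ->
  A * B <= e ^+ 2 -> 0 <= e -> `|\sum_i w i * (a i * b i)| <= e.
Proof.
move=> w0 hA hB hAB e0; rewrite -(@ler_pXn2r _ 2) ?nnegrE//.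
rewrite -normrX ger0_norm ?sqr_ge0//.
apply: le_trans (cauchy_schwarz_weighted _ _ w0) _; apply: le_trans hAB.
by apply: ler_pM => //; apply: sumr_ge0 => i _; rewrite mulr_ge0// sqr_ge0.
Qed.

Lemma sum_sqrB_le w a b : (forall i, 0 <= w i) ->
  \sum_i w i * (a i - b i) ^+ 2 <=
  2 * \sum_i w i * a i ^+ 2 + 2 * \sum_i w i * b i ^+ 2.
Proof.
move=> w0; rewrite !mulr_sumr -big_split /=; apply: ler_sum => i _.
rewrite -subr_ge0 (_ : _ - _ = w i * (a i + b i) ^+ 2); last by ring.
by rewrite mulr_ge0// sqr_ge0.
Qed.

End WeightedSums.

(** * Parseval's identity under completion and tensor products *)

Section SpectralSpaces.
Context {R : realType} {T : choiceType} (D : set T) (C : set (T -> R)).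
Context {I : nat -> finType}.
Variables (w : forall K, I K -> R) (c : forall K, I K -> (T -> R) -> R).
Implicit Types (H : ip_space R T) (f g : T -> R) (p q : nat -> T -> R).

Definition spectral_form (K : nat) (f g : T -> R) : R :=
  \sum_i w i * (@c K i f * @c K i g).

Definition spectral_norm2 (K : nat) (f : T -> R) : R :=
  \sum_i w i * @c K i f ^+ 2.

(* The inner product of H is the limit of increasing finite sums of products of
   coefficients that depend continuously on the values; this form of Parseval's
   identity survives completion and tensor products. *)
Definition spectral (H : ip_space R T) : Prop :=
  [/\ carrier H `<=` C,
      forall f g, carrier H f -> carrier H g -> carrier H (f \- g),
      forall K f, carrier H f -> spectral_norm2 K f <= ip H f f
    & forall f g, carrier H f -> carrier H g ->
        (fun K => spectral_form K f g) @ \oo --> ip H f g].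

Hypothesis w_ge0 : forall K (i : I K), 0 <= w i.
Hypothesis coefB : forall K (i : I K) f g, C f -> C g -> c i (f \- g) = c i f - c i g.
Hypothesis coef_continuous : forall K (i : I K) e, 0 < e -> exists2 dl, 0 < dl &
  forall f g, C f -> C g -> (forall x, D x -> `|f x - g x| <= dl) ->
    `|c i f - c i g| <= e.
Hypothesis C_uniform : forall f,
  (forall e, 0 < e -> exists2 g, C g & forall x, D x -> `|f x - g x| <= e) -> C f.

Lemma coef_cvg K (i : I K) p f : (forall n, C (p n)) -> C f ->
  {uniform D, p @ \oo --> f} -> (fun n => c i (p n)) @ \oo --> c i f.
Proof.
move=> Cp Cf /uniform_cvgP pf; apply/seq_cvgP => e e0.
have [dl dl0 Hd] := coef_continuous i e0.
by have [N HN] := pf _ dl0; exists N => n Nn; apply: Hd => // x Dx; exact: HN.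
Qed.

Section Completion.
Variable H : ip_space R T.
Hypothesis spH : spectral H.

Lemma represents_C p f : represents D H p f -> C f.
Proof.
move=> [[cp _] /uniform_cvgP pf]; case: spH => HC _ _ _; apply: C_uniform => e e0.
have [N HN] := pf _ e0; exists (p N); first exact: HC.
by move=> x Dx; rewrite distrC; exact: HN.
Qed.

(** Bessel's inequality bounds the finite norms of [p m - p n] by the Cauchy estimate, for all [K]
    at once; letting [m] grow with [K] fixed, the finitely many coefficients converge because [p]
    converges uniformly. The point is that the rank [N] does not depend on [K]. *)
Lemma represents_norm2 p f e : represents D H p f -> 0 < e ->
  exists N, forall n, (N <= n)%N -> forall K, spectral_norm2 K (f \- p n) <= e.
Proof.
move=> pf e0; have Cf := represents_C pf; case: pf => -[cp cauchyp] pf.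
case: spH => HC HB Hbes _.
pose e' := Num.min 1 e; have e'0 : 0 < e' by rewrite lt_min ltr01.
have e'e : e' ^+ 2 <= e.
  rewrite expr2 -[leRHS]mul1r.
  by apply: ler_pM; rewrite ?(ltW e'0)// ge_min lexx ?orbT.
have [N HN] := cauchyp _ e'0; exists N => n Nn K.
have lim : (fun m => spectral_norm2 K (p m \- p n)) @ \oo --> spectral_norm2 K (f \- p n).
  apply: cvg_sum_seq => i; apply: cvgM; first exact: cvg_cst.
  rewrite (coefB _ Cf (HC _ (cp n))).
  rewrite (_ : (fun m => _) = (fun m => (c i (p m) - c i (p n)) ^+ 2)); last first.
    by apply/funext => m; rewrite (coefB _ (HC _ (cp m)) (HC _ (cp n))).
  apply: cvgM; apply: cvgB; try exact: cvg_cst;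
  by apply: coef_cvg => // m; exact/HC.
apply: (cvg_le_eventually (N := N) lim) => m Nm.
apply: le_trans (Hbes _ _ (HB _ _ (cp m) (cp n))) _; apply: le_trans e'e.
have := HN m n Nm Nn; rewrite /ip_norm => h.
(* [Num.sqrt] is 0 on negative numbers, so a small norm bounds the square only when the latter is
   nonnegative; otherwise its sign gives the bound. *)
case: (leP 0 (ip H (p m \- p n) (p m \- p n))) => [i0|/ltW i0].
  rewrite -[leLHS](sqr_sqrtr i0); apply: lerXn2r; rewrite ?nnegrE ?sqrtr_ge0//.
    by rewrite ltW.
  by rewrite ltW.
by apply: le_trans i0 _; exact: sqr_ge0.
Qed.

Lemma coefBK K (i : I K) f g : C f -> C g -> c i f = c i (f \- g) + c i g.
Proof. by move=> Cf Cg; rewrite coefB// subrK. Qed.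

Lemma spectral_norm2_le K f g : C f -> C g ->
  spectral_norm2 K f <= 2 * spectral_norm2 K (f \- g) + 2 * spectral_norm2 K g.
Proof.
move=> Cf Cg; rewrite /spectral_norm2.
apply: le_trans (_ : \sum_i w i * (c i (f \- g) - (- c i g)) ^+ 2 <= _).
  by apply: ler_sum => i _; rewrite opprK -coefBK.
apply: le_trans (sum_sqrB_le _ _ (@w_ge0 K)) _.
by under [X in _ + 2 * X]eq_bigr do rewrite sqrrN.
Qed.

Lemma represents_bound p f : represents D H p f ->
  exists2 B, 0 < B & exists N, forall n, (N <= n)%N ->
    forall K, spectral_norm2 K f <= B /\ spectral_norm2 K (p n) <= B.
Proof.
move=> pf; have Cf := represents_C pf; have [N HN] := represents_norm2 pf ltr01.
case: (pf) => -[cp _] _; case: spH => HC _ Hbes _.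
have n0 K g : 0 <= spectral_norm2 K g.
  by apply: sumr_ge0 => i _; rewrite mulr_ge0// sqr_ge0.
pose A := ip H (p N) (p N); have A0 : 0 <= A := le_trans (n0 0%N (p N)) (Hbes _ _ (cp N)).
have nf K : spectral_norm2 K f <= 2 + 2 * A.
  apply: le_trans (spectral_norm2_le _ Cf (HC _ (cp N))) _; rewrite lerD//.
    by rewrite -[leRHS]mulr1 ler_pM2l// HN.
  by rewrite ler_pM2l// Hbes.
exists (2 + 2 * (2 + 2 * A)); first by lra.
exists N => n Nn K; split; first by apply: le_trans (nf K) _; lra.
have e : spectral_norm2 K (p n \- f) = spectral_norm2 K (f \- p n).
  apply: eq_bigr => i _; rewrite !coefB//; try exact/HC; by rewrite -sqrrN opprB.
apply: le_trans (spectral_norm2_le _ (HC _ (cp n)) Cf) _; rewrite e.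
by rewrite lerD// ?ler_pM2l// -[leRHS]mulr1 ler_pM2l// HN.
Qed.

(** Bilinear telescoping and Cauchy-Schwarz: one factor is small by [represents_norm2], the other
    bounded by [represents_bound], both uniformly in [K]. The choice of [e1] makes the product of
    the two bounds equal to [(e / 2) ^+ 2]. *)
Lemma represents_form p q f g e : represents D H p f -> represents D H q g -> 0 < e ->
  exists N, forall n, (N <= n)%N -> forall K,
    `|spectral_form K f g - spectral_form K (p n) (q n)| <= e.
Proof.
move=> pf qg e0; have Cf := represents_C pf; have Cg := represents_C qg.
have [B1 B10 [N1 H1]] := represents_bound pf.
have [B2 B20 [N2 H2]] := represents_bound qg.
pose B := B1 + B2; have B0 : 0 < B by rewrite addr_gt0.
pose e1 := (e / 2) ^+ 2 / B; have e10 : 0 < e1 by rewrite divr_gt0 ?exprn_gt0 ?divr_gt0.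
have [N3 H3] := represents_norm2 pf e10; have [N4 H4] := represents_norm2 qg e10.
exists (N1 + N2 + N3 + N4)%N => n Nn K.
case: (pf) => -[cp _] _; case: (qg) => -[cq _] _; case: spH => HC _ _ _.
have Cp := HC _ (cp n); have Cq := HC _ (cq n).
have -> : spectral_form K f g - spectral_form K (p n) (q n) =
    spectral_form K (f \- p n) g + spectral_form K (p n) (g \- q n).
  rewrite /spectral_form -sumrB -big_split /=; apply: eq_bigr => i _.
  by rewrite !coefB//; ring.
have eB : e1 * B <= (e / 2) ^+ 2 by rewrite divfK// gt_eqF.
rewrite [leRHS]splitr (le_trans (ler_normD _ _))// lerD//.
  apply: (norm_le_cauchy_schwarz (@w_ge0 K) _ _ eB); last by rewrite ltW// divr_gt0.
    by apply: H3; lia.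
  by rewrite (le_trans (H2 n _ K).1)//; [lia | rewrite lerDr ltW].
rewrite mulrC in eB.
apply: (norm_le_cauchy_schwarz (@w_ge0 K) _ _ eB); last by rewrite ltW// divr_gt0.
  by rewrite (le_trans (H1 n _ K).2)//; [lia | rewrite lerDl ltW].
by apply: H4; lia.
Qed.

(** The uniformity in [K] of [represents_form] allows the limits in [K] and [m] to be exchanged: the
    spectral forms of [f] and [g] are Cauchy in [K], and their limit is also that of the inner
    products along the sequences. *)
Lemma represents_ip p q f g : represents D H p f -> represents D H q g ->
  exists v : R, (fun K => spectral_form K f g) @ \oo --> v /\
            (fun m => ip H (p m) (q m)) @ \oo --> v.
Proof.
move=> pf qg; case: (pf) => -[cp _] _; case: (qg) => -[cq _] _.
case: spH => _ _ _ Hlim.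
have [v Hv] : exists v : R, (fun K => spectral_form K f g) @ \oo --> v.
  apply: seq_cauchy_cvg => e e0; have e4 : 0 < e / 4 by rewrite divr_gt0.
  have [N /(_ N (leqnn N)) HN] := represents_form pf qg e4.
  have /seq_cvgP/(_ _ e4)[M HM] := Hlim _ _ (cp N) (cq N).
  exists M => m n Mm Mn; have h1 := HN m; have h2 := HN n.
  have h3 := HM m Mm; have h4 := HM n Mn.
  move: h1 h2 h3 h4; rewrite !ler_norml => /andP[? ?] /andP[? ?] /andP[? ?] /andP[? ?].
  by apply/andP; split; lra.
exists v; split=> //; apply/seq_cvgP => e e0.
have [N HN] := represents_form pf qg e0; exists N => n Nn.
have lim : (fun K => `|spectral_form K f g - spectral_form K (p n) (q n)|) @ \oo -->
    `|v - ip H (p n) (q n)|.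
  by apply: cvg_norm; apply: cvgB => //; exact: Hlim.
by rewrite distrC; apply: cvg_le_cst lim _ => K; exact: HN.
Qed.

(** Any two pairs of representing sequences give the same limit, since it is the limit of a spectral
    form that mentions only [f] and [g]; so the value selected by [xget] is this one. *)
Lemma completion_ip p q f g : represents D H p f -> represents D H q g ->
  (fun K => spectral_form K f g) @ \oo --> ip (completion D H) f g /\
  (fun m => ip H (p m) (q m)) @ \oo --> ip (completion D H) f g.
Proof.
move=> pf qg; have [v [sv vv]] := represents_ip pf qg.
suff -> : ip (completion D H) f g = v by [].
rewrite /=; set A := [set v | _].
have /xgetPex -/(_ 0)[p' [q' [pf' qg' lim']]] : exists x, A x by exists v, p, q.
have [v' [sv' vv']] := represents_ip pf' qg'.
by rewrite -/A (cvg_uniq lim' vv') (cvg_uniq sv sv').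
Qed.

Lemma spectral_completion : spectral (completion D H).
Proof.
case: (spH) => HC HB Hbes Hlim; split.
- by move=> f [p pf]; exact: represents_C pf.
- move=> f g [p pf] [q qg]; exists (fun n => p n \- q n).
  case: (pf) => -[cp cauchyp] /uniform_cvgP up; case: (qg) => -[cq cauchyq] /uniform_cvgP uq.
  split; last first.
    apply/uniform_cvgP => e e0; have e2 : 0 < e / 2 by rewrite divr_gt0.
    have [N1 H1] := up _ e2; have [N2 H2] := uq _ e2.
    exists (N1 + N2)%N => n Nn x Dx /=.
    have -> : (p n \- q n) x - (f \- g) x = (p n x - f x) - (q n x - g x) by rewrite /=; ring.
    rewrite [leRHS]splitr (le_trans (ler_normB _ _))// lerD//.
      by apply: H1 => //; lia.
    by apply: H2 => //; lia.
  split=> [m|e e0]; first exact: HB.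
  have e2 : 0 < e / 2 by rewrite divr_gt0.
  have [N1 H1] := cauchyp _ e2; have [N2 H2] := cauchyq _ e2.
  exists (N1 + N2)%N => m n Nm Nn.
  have -> : (p m \- q m) \- (p n \- q n) = (p m \- p n) \- (q m \- q n).
    by apply/funext => x /=; ring.
  set a := p m \- p n; set b := q m \- q n.
  have ca : carrier H a by exact: HB.
  have cb : carrier H b by exact: HB.
  have sq (F : T -> R) : ip_norm H F < e / 2 -> ip H F F < (e / 2) ^+ 2.
    rewrite /ip_norm; case: (ltP 0 (ip H F F)) => [i0 h|i0 _].
      rewrite -[ltLHS](sqr_sqrtr (ltW i0)); apply: ltrXn2r => //.
    by apply: le_lt_trans i0 _; rewrite exprn_gt0.
  (* An [ip_space] has no bilinearity axiom; the inequality is proved for the finite spectral sums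
     and carried to the limit. *)
  have iab : ip H (a \- b) (a \- b) <= 2 * ip H a a + 2 * ip H b b.
    have E F : carrier H F -> (fun K => spectral_norm2 K F) @ \oo --> ip H F F.
      by move=> cF; have := Hlim _ _ cF cF; apply: cvg_trans; apply: near_eq_cvg;
         apply: nearW => K; apply: eq_bigr => i _; rewrite expr2.
    apply: cvg_le_limit (E _ (HB _ _ ca cb)) (_ : (fun K => 2 * spectral_norm2 K a +
        2 * spectral_norm2 K b) @ \oo --> _) _.
      by apply: cvgD; apply: cvgM; try exact: cvg_cst; exact: E.
    move=> K; apply: le_trans (sum_sqrB_le _ _ (@w_ge0 K)).
    by apply: ler_sum => i _; rewrite coefB//; exact: HC.
  rewrite /ip_norm -(@gtr0_norm _ e)// -sqrtr_sqr ltr_sqrt ?exprn_gt0//.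
  apply: le_lt_trans iab _.
  have := sq _ (H1 m n _ _); have := sq _ (H2 m n _ _).
  have e22 : e ^+ 2 = 2 * (e / 2) ^+ 2 + 2 * (e / 2) ^+ 2 by field.
  rewrite e22 => hb ha; apply: ltrD; rewrite ltr_pM2l//.
    by apply: ha; lia.
  by apply: hb; lia.
- move=> K f [p pf]; have [_ lim] := completion_ip pf pf.
  have Cf := represents_C pf; case: (pf) => -[cp _] up.
  have lim2 : (fun m => spectral_norm2 K (p m)) @ \oo --> spectral_norm2 K f.
    apply: cvg_sum_seq => i; apply: cvgM; first exact: cvg_cst.
    by apply: cvgM; apply: coef_cvg => // m; exact: HC.
  by apply: cvg_le_limit lim2 lim _ => m; exact: Hbes.
- by move=> f g [p pf] [q qg]; have [] := completion_ip pf qg.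
Qed.

End Completion.
End SpectralSpaces.

Section TensorSpectral.
Context {R : realType}.

Definition cos_coef1 (k : nat) (f : R -> R) : R := int01 (fun x => f x * cos_basis k x).

Definition spectral1 (wt : nat -> R) (H : ip_space R R) : Prop :=
  spectral buc01 (fun K (i : 'I_K) => wt i) (fun K (i : 'I_K) => cos_coef1 i) H.

Definition spectral_cube d (wt : 'I_d -> nat -> R) (H : ip_space R (d.-tuple R)) : Prop :=
  spectral (@buc_cube R d) (I := fun K => {ffun 'I_d -> 'I_K})
    (fun K k => \prod_(j < d) wt j (k j)) (fun K k => cos_coef (fun j => k j)) H.

Lemma sum_injective_le (A B : finType) (h : A -> B) (F : B -> R) :
  injective h -> (forall b, 0 <= F b) -> \sum_a F (h a) <= \sum_b F b.
Proof.
move=> hi F0; have -> : \sum_a F (h a) = \sum_(b in [set h a | a in [set: A]]%SET) F b.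
  rewrite big_imset /=; last by move=> x y _ _; exact: hi.
  by apply: eq_bigl => a; rewrite inE.
by rewrite [leRHS](bigID (mem [set h a | a in [set: A]]%SET)) /= lerDl sumr_ge0.
Qed.

Lemma nondecreasing_le_limit (u : nat -> R) (l : R) : (forall n, u n <= u n.+1) ->
  u @ \oo --> l -> forall n, u n <= l.
Proof.
move=> nd ul n; have mono m : (n <= m)%N -> u n <= u m.
  elim: m => [|m IH]; first by rewrite leqn0 => /eqP ->.
  by rewrite leq_eqVlt ltnS => /orP[/eqP ->//|/IH/le_trans]; apply.
apply: ler_cvg_to (_ : (fun=> u n) @ \oo --> u n) ul _; first exact: cvg_cst.
by exists n.
Qed.

Section Algebraic.
Variables (d : nat) (wt : 'I_d -> nat -> R) (H : 'I_d -> ip_space R R).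
Hypothesis d_gt0 : (0 < d)%N.
Hypothesis wt_ge0 : forall j k, 0 <= wt j k.
Hypothesis spH : forall j, spectral1 (wt j) (H j).

Lemma carrier_buc j f : carrier (H j) f -> buc01 f.
Proof. by case: (spH j) => h _ _ _; exact: h. Qed.

Lemma tensor_rep_buc F n (f : 'I_n -> 'I_d -> R -> R) : tensor_rep H F f -> buc_cube F.
Proof.
move=> [cf HF]; apply: (eq_buc (F := fun x => \sum_(i < n) \prod_(j < d) f i j (tnth x j))).
  by move=> x cx; rewrite HF.
apply: buc_sum => [|i]; first exact: cube_close_mono.
by apply: (@buc_tensor _ _ (f i)) => j; exact: carrier_buc (cf i j).
Qed.

Lemma tensor_rep_coef F n (f : 'I_n -> 'I_d -> R -> R) (k : 'I_d -> nat) :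
  tensor_rep H F f -> cos_coef k F = \sum_(i < n) \prod_(j < d) cos_coef1 (k j) (f i j).
Proof.
move=> [cf HF].
have bf i j : buc01 (fun x => f i j x * cos_basis (k j) x).
  apply: bucM; [exact: ltr_norm_mono | exact: carrier_buc (cf i j) |].
  exact: buc01_cos_basis.
transitivity (cube_int (fun y => \sum_(i < n) \prod_(j < d)
    (f i j (tnth y j) * cos_basis (k j) (tnth y j)))).
  apply: eq_cube_int => y cy; rewrite HF// mulr_suml; apply: eq_bigr => i _.
  by rewrite /cos_tensor -big_split.
rewrite cube_int_sum; last first.
  by move=> i; apply: (@buc_tensor _ _ (fun j x => f i j x * cos_basis (k j) x)).
apply: eq_bigr => i _.
exact: (@cube_int_tensor _ _ (fun j x => f i j x * cos_basis (k j) x)).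
Qed.

(** The index set [{ffun 'I_d -> 'I_K}] is a product and the coefficients of elementary tensors are
    products, so the spectral form distributes into products of one-variable spectral forms, each of
    which converges. *)
Lemma tensor_rep_ip F G n m (f : 'I_n -> 'I_d -> R -> R) (g : 'I_m -> 'I_d -> R -> R) :
  tensor_rep H F f -> tensor_rep H G g ->
  (fun K => spectral_form (I := fun K => {ffun 'I_d -> 'I_K})
    (fun K k => \prod_(j < d) wt j (k j)) (fun K k => cos_coef (fun j => k j)) K F G)
  @ \oo --> \sum_(i < n) \sum_(k < m) \prod_(j < d) ip (H j) (f i j) (g k j).
Proof.
move=> rF rG.
rewrite (_ : (fun K => _) = fun K => \sum_(i < n) \sum_(l < m) \prod_(j < d)
   spectral_form (I := fun K => 'I_K) (fun K i => wt j i) (fun K i => cos_coef1 i) K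
     (f i j) (g l j)); last first.
  apply/funext => K; rewrite /spectral_form.
  transitivity (\sum_(k : {ffun 'I_d -> 'I_K}) \sum_(i < n) \sum_(l < m) \prod_(j < d)
      (wt j (k j) * (cos_coef1 (k j) (f i j) * cos_coef1 (k j) (g l j)))).
    apply: eq_bigr => k _; rewrite (tensor_rep_coef _ rF) (tensor_rep_coef _ rG).
    rewrite big_distrlr /= mulr_sumr; apply: eq_bigr => i _.
    rewrite mulr_sumr; apply: eq_bigr => l _.
    by rewrite -big_split -big_split.
  rewrite exchange_big; apply: eq_bigr => i _.
  rewrite exchange_big; apply: eq_bigr => l _.
  by rewrite -(bigA_distr_bigA (fun j (m : 'I_K) =>
      wt j m * (cos_coef1 m (f i j) * cos_coef1 m (g l j)))).
apply: cvg_sum_seq => i; apply: cvg_sum_seq => l; apply: cvg_prod_seq => j.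
case: (spH j) => _ _ _; apply; [exact: rF.1 | exact: rG.1].
Qed.

(** By [tensor_rep_ip] all representations lead to the limit of the same spectral form, so the one
    behind [xget] is as good as any. *)
Lemma algebraic_tensor_ip F G :
  carrier (algebraic_tensor H) F -> carrier (algebraic_tensor H) G ->
  (fun K => spectral_form (I := fun K => {ffun 'I_d -> 'I_K})
    (fun K k => \prod_(j < d) wt j (k j)) (fun K k => cos_coef (fun j => k j)) K F G)
  @ \oo --> ip (algebraic_tensor H) F G.
Proof.
move=> [n [f rF]] [m [g rG]]; rewrite /=; set A := [set v | _].
have /xgetPex -/(_ 0)[n' [m' [f' [g' [rF' rG' ->]]]]] : exists x, A x.
  by eexists; exists n, m, f, g; split.
exact: tensor_rep_ip.
Qed.

Lemma spectral_algebraic_tensor : spectral_cube wt (algebraic_tensor H).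
Proof.
have carN j f : carrier (H j) f -> carrier (H j) (fun x => - f x).
  case: (spH j) => _ HB _ _ cf; have := HB _ _ (HB _ _ cf cf) cf.
  by rewrite (_ : (f \- f) \- f = fun x => - f x)//; apply/funext => x /=; rewrite subrr sub0r.
split.
- by move=> F [n [f rF]]; exact: tensor_rep_buc rF.
- move=> F G [n [f [cf HF]]] [m [g [cg HG]]].
  (* A difference of sums of tensors is again a sum of tensors: the sign is carried by the single
     factor [j0], for which some coordinate has to exist. *)
  pose j0 := Ordinal d_gt0.
  exists (n + m)%N, (fun i : 'I_(n + m) => match fintype.split i with
    | inl a => f a
    | inr b => fun j => if j == j0 then (fun x => - g b j x) else g b j end).
  split.
    move=> i j; case: (fintype.split i) => [a|b]; first exact: cf.
    by case: eqP => _; [apply: carN; exact: cg | exact: cg].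
  move=> x cx; rewrite /= HF// HG// big_split_ord /= -sumrN; congr (_ + _).
    by apply: eq_bigr => i _; rewrite (unsplitK (inl _ i)).
  apply: eq_bigr => i _; rewrite (unsplitK (inr _ i)).
  rewrite (bigD1 j0)//= [in RHS](bigD1 j0)//= ?eqxx mulNr; congr (- (_ * _)).
  by apply: eq_bigr => j /negPf ->.
- move=> K F cF; have lim := algebraic_tensor_ip cF cF.
  have E K' : spectral_form (I := fun K => {ffun 'I_d -> 'I_K})
    (fun K k => \prod_(j < d) wt j (k j)) (fun K k => cos_coef (fun j => k j)) K' F F =
    spectral_norm2 (I := fun K => {ffun 'I_d -> 'I_K})
    (fun K k => \prod_(j < d) wt j (k j)) (fun K k => cos_coef (fun j => k j)) K' F.
    by apply: eq_bigr => k _; rewrite expr2.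
  (* Bessel's inequality comes from the limit: the finite sums grow with [K'], as the box of size
     [K'] embeds into that of size [K'.+1]. *)
  rewrite -E; apply: nondecreasing_le_limit lim _ => K'; rewrite !E /spectral_norm2.
  pose h (k : {ffun 'I_d -> 'I_K'}) : {ffun 'I_d -> 'I_K'.+1} :=
    [ffun j => widen_ord (leqnSn K') (k j)].
  have hi : injective h.
    move=> k l /ffunP kl; apply/ffunP => j; have := kl j.
    by rewrite !ffunE => /(congr1 val) /= /val_inj.
  pose F' (k : {ffun 'I_d -> 'I_K'.+1}) : R :=
    (\prod_(j < d) wt j (k j)) * cos_coef (fun j => k j) F ^+ 2.
  have -> : \sum_(i : {ffun 'I_d -> 'I_K'}) (\prod_(j < d) wt j (i j)) *
      cos_coef (fun j => i j) F ^+ 2 = \sum_i F' (h i).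
    apply: eq_bigr => k _; rewrite /F'; congr (_ * _ ^+ 2).
      by apply: eq_bigr => j _; rewrite ffunE.
    congr cos_coef; apply/funext => j; by rewrite ffunE.
  apply: sum_injective_le => // k.
  by rewrite mulr_ge0 ?sqr_ge0// prodr_ge0.
- exact: algebraic_tensor_ip.
Qed.

End Algebraic.

Lemma cos_coefB d (k : 'I_d -> nat) (F G : d.-tuple R -> R) :
  buc_cube F -> buc_cube G -> cos_coef k (F \- G) = cos_coef k F - cos_coef k G.
Proof.
have b (F' : d.-tuple R -> R) : buc_cube F' -> buc_cube (fun y => F' y * cos_tensor k y).
  by move=> bF; apply: bucM => //; [exact: cube_close_mono | exact: buc_cos_tensor].
move=> bF bG; rewrite /cos_coef -cube_intB; [|exact: b|exact: b].
by apply: eq_cube_int => y _; rewrite mulrBl.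
Qed.

Lemma cos_tensor_bound d (k : 'I_d -> nat) (x : d.-tuple R) :
  `|cos_tensor k x| <= 2 ^+ d.
Proof.
rewrite normr_prod; apply: (@le_trans _ _ (\prod_(j < d) 2)).
  by apply: ler_prod => j _; rewrite normr_ge0 cos_basis_bound.
by rewrite prodr_const card_ord.
Qed.

Lemma cos_coef_continuous d (k : 'I_d -> nat) (e : R) : 0 < e -> exists2 dl, 0 < dl &
  forall F G : d.-tuple R -> R, buc_cube F -> buc_cube G ->
   (forall x, cube d x -> `|F x - G x| <= dl) -> `|cos_coef k F - cos_coef k G| <= e.
Proof.
move=> e0; have p0 : 0 < 2 ^+ d :> R by rewrite exprn_gt0.
exists (e / 2 ^+ d); first by rewrite divr_gt0.
move=> F G bF bG FG; rewrite -cos_coefB//; apply: norm_cube_int_le.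
  apply: bucM; [exact: cube_close_mono | | exact: buc_cos_tensor].
  by apply: bucB => //; exact: cube_close_mono.
move=> x cx; rewrite normrM -[leRHS](@divfK _ (2 ^+ d)) ?gt_eqF//.
by apply: ler_pM => //; [exact: FG | exact: cos_tensor_bound].
Qed.

Lemma spectral_hilbert_tensor d (wt : 'I_d -> nat -> R) (H : 'I_d -> ip_space R R) :
  (0 < d)%N -> (forall j k, 0 <= wt j k) -> (forall j, spectral1 (wt j) (H j)) ->
  spectral_cube wt (hilbert_tensor H).
Proof.
move=> d0 wt0 spH; apply: spectral_completion.
- by move=> K k; apply: prodr_ge0.
- by move=> K k F G; exact: cos_coefB.
- by move=> K k e; exact: cos_coef_continuous.
- by move=> F h; apply: buc_uniform h.
- exact: spectral_algebraic_tensor.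
Qed.

Lemma cos_coef1B k (f g : R -> R) : buc01 f -> buc01 g ->
  cos_coef1 k (f \- g) = cos_coef1 k f - cos_coef1 k g.
Proof.
have b (f' : R -> R) : buc01 f' -> integrable01 (fun y => f' y * cos_basis k y).
  move=> bf; apply/buc01_integrable/bucM => //; first exact: ltr_norm_mono.
  exact: buc01_cos_basis.
move=> bf bg; rewrite /cos_coef1 -int01B; [|exact: b|exact: b].
by apply: eq_int01 => y _; rewrite mulrBl.
Qed.

Lemma cos_coef1_continuous k (e : R) : 0 < e -> exists2 dl, 0 < dl &
  forall f g : R -> R, buc01 f -> buc01 g ->
   (forall x, unit_interval x -> `|f x - g x| <= dl) -> `|cos_coef1 k f - cos_coef1 k g| <= e.
Proof.
move=> e0; exists (e / 2); first by rewrite divr_gt0.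
move=> f g bf bg fg; rewrite -cos_coef1B//; apply: norm_int01_le.
  apply/buc01_integrable/bucM; [exact: ltr_norm_mono | | exact: buc01_cos_basis].
  by apply: bucB => //; exact: ltr_norm_mono.
move=> x x01; rewrite normrM -[leRHS](@divfK _ 2)//.
apply: ler_pM => //; last exact: cos_basis_bound.
exact/fg/unit_interval_01.
Qed.

Lemma spectral1_completion (wt : nat -> R) (H : ip_space R R) :
  (forall k, 0 <= wt k) -> spectral1 wt H -> spectral1 wt (completion unit_interval H).
Proof.
move=> wt0 spH; apply: spectral_completion => //.
- by move=> K k F G; exact: cos_coef1B.
- by move=> K k e; exact: cos_coef1_continuous.
- by move=> F h; apply: buc_uniform h.
Qed.

End TensorSpectral.

(** * Affine substitutions, periodic functions and Fubini *)

Section AffineChangeOfVariables.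
Context {R : realType}.
Local Notation mu := (@lebesgue_measure R).
Variables (s c : R).
Hypothesis s_neq0 : s != 0.

Definition affine (x : measurableTypeR R) : measurableTypeR R := s * x + c.

Lemma measurable_affine : measurable_fun [set: measurableTypeR R] affine.
Proof.
apply: (@measurable_funD _ _ _ _ (fun x => s * x) (fun=> c)) => //.
by apply: measurable_funM => //; exact: measurable_id.
Qed.

HB.instance Definition _ := isMeasurableFun.Build _ _ _ _ affine measurable_affine.

Let abs_s : {nonneg R} := NngNum (normr_ge0 s).

(** By uniqueness of Lebesgue measure it is enough to compare on half-open intervals; for negative
    [s] the preimage of []a, b]] is half-open on the other side, which does not change its
    length. *)
Lemma lebesgue_affine (A : set R) : measurable (A : set (measurableTypeR R)) ->
  (mu A = (`|s|)%:E * mu (affine @^-1` A))%E.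
Proof.
move=> mA; rewrite (@lebesgue_measure_unique R (mscale abs_s (pushforward mu affine)))//.
move=> X /ocitvP[->|[[a b] /= ab ->]]; first by rewrite !measure0.
rewrite /mscale /pushforward /= lebesgue_measure_itv /= lte_fin ab.
rewrite -[pushforward _ _ _]/(mu (affine @^-1` `]a, b])).
have [s0|s0|/esym/eqP] := ltgtP 0 s; last by rewrite (negPf s_neq0).
  rewrite (_ : _ @^-1` _ = `](a - c) / s, (b - c) / s]%classic); last first.
    apply/seteqP; split => x; rewrite /= !in_itv /= /affine ltr_pdivrMr// ler_pdivlMr//;
    by rewrite (mulrC x) ltrBlDr lerBrDr.
  rewrite lebesgue_measure_itv /= lte_fin ltr_pM2r ?invr_gt0// ltrD2r ab.
  rewrite gtr0_norm// -!EFinD -EFinM; congr (_%:E).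
  by rewrite -mulrBl mulrC divfK ?gt_eqF//; ring.
rewrite (_ : _ @^-1` _ = `[(b - c) / s, (a - c) / s[%classic); last first.
  apply/seteqP; split => x; rewrite /= !in_itv /= /affine ltr_ndivlMr// ler_ndivrMr//;
  by rewrite (mulrC x) ltrBlDr lerBrDr andbC.
rewrite lebesgue_measure_itv /= lte_fin ltr_nM2r ?invr_lt0// ltrD2r ab.
rewrite ltr0_norm// -!EFinD -EFinM; congr (_%:E).
by rewrite -mulrBl mulrC mulrN divfK ?lt_eqF//; ring.
Qed.

Lemma ge0_integral_affine (D : set R) (f : R -> \bar R) :
  measurable (D : set (measurableTypeR R)) -> measurable_fun (D : set (measurableTypeR R)) f ->
  (forall x, D x -> 0 <= f x)%E ->
  (\int[mu]_(x in D) f x = (`|s|)%:E * \int[mu]_(x in affine @^-1` D) f (affine x))%E.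
Proof.
move=> mD mf f0.
have f0' : {in D, forall x, 0 <= f x}%E by move=> x; rewrite inE; exact: f0.
have E := ge0_integral_pushforward measurable_affine mu mD mf f0'.
transitivity (abs_s%:num%:E * \int[mu]_(x in affine @^-1` D) (f \o affine) x)%E => //.
rewrite -E -(ge0_integral_mscale _ mD abs_s mf f0).
by apply: eq_measure_integral => A mA _; exact: lebesgue_affine.
Qed.

Lemma measurable_affine_preimage (D : set R) : measurable (D : set (measurableTypeR R)) ->
  measurable (affine @^-1` D : set (measurableTypeR R)).
Proof. by move=> mD; rewrite -[X in measurable X]setTI; exact: measurable_affine. Qed.

Lemma integrable_affine (D : set R) (f : R -> R) :
  measurable (D : set (measurableTypeR R)) ->
  measurable_fun [set: measurableTypeR R] f ->
  mu.-integrable D (EFin \o f) <-> mu.-integrable (affine @^-1` D) (EFin \o (f \o affine)).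
Proof.
move=> mD mf.
have s0 : 0 < `|s| by rewrite normr_gt0.
have e : (\int[mu]_(x in D) `|(EFin \o f) x| =
    (`|s|)%:E * \int[mu]_(x in affine @^-1` D) `|(EFin \o (f \o affine)) x|)%E.
  by rewrite ge0_integral_affine//; apply: measurableT_comp => //;
      exact/measurable_EFinP/measurable_funTS.
have mfD : measurable_fun (D : set (measurableTypeR R)) (EFin \o f).
  exact/measurable_EFinP/measurable_funTS.
have mfD' : measurable_fun (affine @^-1` D : set (measurableTypeR R)) (EFin \o (f \o affine)).
  apply/measurable_EFinP/measurable_funTS; apply: measurableT_comp => //.
  exact: measurable_affine.
split=> /integrableP[_ h]; apply/integrableP; split=> //.
  have := h; rewrite e; case: (X in (_ * X)%E) (integral_ge0 (D := affine @^-1` D) mu (fun x _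
      => abse_ge0 ((EFin \o (f \o affine)) x))) => [r _ _| |//]; first by rewrite ltry.
  by rewrite gt0_muley ?lte_fin.
by rewrite e lte_mul_pinfty// ?lee_fin ltW.
Qed.

Lemma Rintegral_affine (D : set R) (f : R -> R) :
  measurable (D : set (measurableTypeR R)) ->
  measurable_fun [set: measurableTypeR R] f ->
  mu.-integrable D (EFin \o f) ->
  \int[mu]_(x in D) f x = `|s| * \int[mu]_(x in affine @^-1` D) f (affine x).
Proof.
move=> mD mf fi.
have fi' := (integrable_affine mD mf).1 fi.
have mD' := measurable_affine_preimage mD.
rewrite /Rintegral -[`|s|]/(fine (`|s|)%:E) -fineM//; last exact: integrable_fin_num.
congr fine; rewrite integralE [in RHS]integralE.
rewrite ge0_integral_affine//; last first.
  by apply: measurable_funepos; exact/measurable_EFinP/measurable_funTS.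
rewrite (ge0_integral_affine (f := ((EFin \o f)^\-)%E))//; last first.
  by apply: measurable_funeneg; exact/measurable_EFinP/measurable_funTS.
rewrite [RHS]muleBr; [|by []|].
  by congr (_ * _ - _ * _)%E; apply: eq_integral => x _; rewrite ?funeposE ?funenegE.
by apply: fin_num_adde_defr; exact: (integrable_pos_fin_num mD' fi').
Qed.

End AffineChangeOfVariables.

Section IntegralsOfPeriodicFunctions.
Context {R : realType}.
Local Notation mu := (@lebesgue_measure R).
Implicit Types (h : R -> R) (a b c : R).

Definition rmeasurable h := measurable_fun [set: measurableTypeR R] (h : _ -> measurableTypeR R).
Definition integrable_on a b h := mu.-integrable `[a, b]%classic (EFin \o h).
Definition int_on a b h := \int[mu]_(x in `[a, b]) h x.

Lemma integrable_onW a b c d h : a <= c -> d <= b -> integrable_on a b h -> integrable_on c d h.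
Proof.
move=> ac db; apply: integrableS; try exact: measurable_itv.
by apply: subset_itv; rewrite bnd_simp.
Qed.

Lemma itv_cat a b c : a <= b -> b <= c ->
  `[a, c]%classic = `[a, b]%classic `|` `]b, c]%classic.
Proof. by move=> ab bc; rewrite -itv_bndbnd_setU// bnd_simp. Qed.

Lemma disjoint_itv_cat a b c : [disjoint `[a, b]%classic & `]b, c]%classic].
Proof.
apply/disj_setPS => x [] /=; rewrite !in_itv /= => /andP[_ xb] /andP[bx _].
by move: (lt_le_trans bx xb); rewrite ltxx.
Qed.

Lemma integrable_on_cat a b c h : rmeasurable h -> a <= b -> b <= c ->
  integrable_on a b h -> integrable_on b c h -> integrable_on a c h.
Proof.
move=> mh ab bc /integrableP[_ i1] /integrableP[_ i2].
have m (A : set (measurableTypeR R)) : measurable_fun A (EFin \o h).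
  exact/measurable_EFinP/measurable_funTS.
apply/integrableP; split; first exact: m.
rewrite (itv_cat ab bc) ge0_integral_setU//; last exact: disjoint_itv_cat.
  apply: lte_add_pinfty => //; apply: le_lt_trans i2.
  apply: ge0_subset_integral => //.
    by apply: measurableT_comp => //; exact: m.
  by apply: subset_itv; rewrite bnd_simp.
by apply: measurableT_comp => //; exact: m.
Qed.

Lemma int_on_cat a b c h : a <= b -> b <= c -> integrable_on a c h ->
  int_on a c h = int_on a b h + int_on b c h.
Proof.
move=> ab bc hi; rewrite /int_on -(@Rintegral_itv_obnd_cbnd _ b (BRight c)); last first.
  apply: integrableS hi; try exact: measurable_itv.
  by apply: subset_itv; rewrite bnd_simp.
rewrite -(@Rintegral_itvB _ h (BLeft a) (BRight c) b) ?bnd_simp//.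
by rewrite addrC subrK.
Qed.

Lemma affine_shift_preimage a b c : affine 1 c @^-1` `[a, b] = `[a - c, b - c]%classic.
Proof.
by apply/seteqP; split => x; rewrite /= !in_itv /= /affine mul1r lerBrDr lerBlDr.
Qed.

Lemma affine_opp_preimage a b : affine (-1) 0 @^-1` `[a, b] = `[- b, - a]%classic.
Proof.
apply/seteqP; split => x; rewrite /= !in_itv /= /affine mulN1r addr0;
by rewrite (lerNl b) (lerNr _ a) andbC.
Qed.

Lemma integrable_on_shift a b c h : rmeasurable h ->
  integrable_on a b h -> integrable_on (a - c) (b - c) (fun x => h (x + c)).
Proof.
move=> mh hi; have := (integrable_affine c (oner_neq0 _) (measurable_itv _) mh).1 hi.
rewrite affine_shift_preimage; congr (_.-integrable _ _).
by apply/funext => x /=; rewrite /affine mul1r.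
Qed.

Lemma int_on_shift a b c h : rmeasurable h -> integrable_on a b h ->
  int_on a b h = int_on (a - c) (b - c) (fun x => h (x + c)).
Proof.
move=> mh hi; rewrite /int_on (Rintegral_affine c (oner_neq0 _) (measurable_itv _) mh hi).
rewrite affine_shift_preimage normr1 mul1r; apply: eq_Rintegral => x _.
by rewrite /affine mul1r.
Qed.

Lemma integrable_on_opp a b h : rmeasurable h ->
  integrable_on a b h -> integrable_on (- b) (- a) (fun x => h (- x)).
Proof.
move=> mh hi; have n1 : (-1 : R) != 0 by rewrite oppr_eq0 oner_neq0.
have := (integrable_affine 0 n1 (measurable_itv _) mh).1 hi.
rewrite affine_opp_preimage; congr (_.-integrable _ _).
by apply/funext => x /=; rewrite /affine mulN1r addr0.
Qed.

Lemma int_on_opp a b h : rmeasurable h -> integrable_on a b h ->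
  int_on a b h = int_on (- b) (- a) (fun x => h (- x)).
Proof.
move=> mh hi; have n1 : (-1 : R) != 0 by rewrite oppr_eq0 oner_neq0.
rewrite /int_on (Rintegral_affine 0 n1 (measurable_itv _) mh hi).
rewrite affine_opp_preimage normrN normr1 mul1r; apply: eq_Rintegral => x _.
by rewrite /affine mulN1r addr0.
Qed.

Lemma rmeasurable_shift h c : rmeasurable h -> rmeasurable (fun x => h (x + c)).
Proof.
move=> mh; have := measurableT_comp mh (measurable_affine 1 c).
by congr (measurable_fun _ _); apply/funext => x; rewrite /= /affine mul1r.
Qed.

(** Integrability on one period is pushed one period further on each side by translation, and every
    interval lies in some [[-1 - 2 n, 1 + 2 n]]. *)
Lemma periodic_integrable_on h : rmeasurable h -> (forall x, h (x + 2) = h x) ->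
  integrable_on (-1) 1 h -> forall a b, integrable_on a b h.
Proof.
move=> mh per hi a b.
have pern (n : nat) x : h (x + 2 *+ n) = h x.
  by elim: n => [|n IH]; [rewrite addr0 | rewrite mulrSr addrA per].
have pern' (n : nat) x : h (x - 2 *+ n) = h x by rewrite -(pern n) subrK.
have H (n : nat) : integrable_on (- 1 - 2 *+ n) (1 + 2 *+ n) h.
  elim: n => [|n IH]; first by rewrite subr0 addr0.
  have n0 : 0 <= 2 *+ n :> R by rewrite mulrn_wge0.
  have p1 : integrable_on (1 + 2 *+ n) (1 + 2 *+ n.+1) h.
    have := integrable_on_shift (- (2 *+ n.+1)) mh hi.
    rewrite opprK (_ : -1 + 2 *+ n.+1 = 1 + 2 *+ n); last by rewrite mulrS; ring.
    by congr integrable_on; apply/funext => x; rewrite pern'.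
  have p2 : integrable_on (- 1 - 2 *+ n.+1) (- 1 - 2 *+ n) h.
    have := integrable_on_shift (2 *+ n.+1) mh hi.
    rewrite (_ : 1 - 2 *+ n.+1 = - 1 - 2 *+ n); last by rewrite mulrS; ring.
    by congr integrable_on; apply/funext => x; rewrite pern.
  have e : (2 : R) *+ n.+1 = 2 + 2 *+ n by rewrite mulrS.
  apply: (integrable_on_cat mh _ _ p2).
  - by rewrite e; lra.
  - by rewrite e; lra.
  apply: (integrable_on_cat mh _ _ IH p1).
  - by lra.
  - by rewrite e; lra.
have [n nb] : exists n : nat, `|a| + `|b| < n%:R.
  by exists (Num.bound (`|a| + `|b|)); apply: archi_boundP; rewrite addr_ge0.
have e : 2 *+ n = n%:R *+ 2 :> R by rewrite -[LHS]mulr_natl mulr2n; ring.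
have := ler_norm b; have := ler_norm (- a); rewrite normrN => ha hb.
have a0 := normr_ge0 a; have b0 := normr_ge0 b.
by apply: integrable_onW (H n); rewrite e mulr2n; lra.
Qed.

(* Integrating a 2-periodic function over a period, folded at the midpoint y. *)
Lemma int01_periodic h (y : R) : rmeasurable h -> (forall x, h (x + 2) = h x) ->
  (forall a b, integrable_on a b h) -> 0 <= y <= 1 ->
  int01 (fun x => h x + h (- x)) = int01 (fun t => h (y + t) + h (y - t)).
Proof.
move=> mh per hi /andP[y0 y1].
have fold z : int01 (fun t => h (z + t) + h (z - t)) = int_on (z - 1) (z + 1) h.
  have i1 : integrable01 (fun t => h (z + t)).
    have := integrable_on_shift z mh (hi z (1 + z)).
    rewrite subrr addrK; congr (_.-integrable _ _).
    by apply/funext => x /=; rewrite addrC.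
  have mz := rmeasurable_shift z mh.
  have iz : integrable_on (- 1) 0 (fun t => h (t + z)).
    have := integrable_on_shift z mh (hi (z - 1) z).
    by rewrite subrr addrAC subrr add0r.
  have i2 : integrable01 (fun t => h (z - t)).
    have := integrable_on_opp mz iz; rewrite oppr0 opprK; congr (_.-integrable _ _).
    by apply/funext => x /=; rewrite addrC.
  rewrite int01D// (@int_on_cat (z - 1) z (z + 1)) ?lerBlDr ?lerDl//.
  rewrite addrC; congr (_ + _).
    rewrite (int_on_shift z mh (hi _ _)) subrr addrAC subrr add0r.
    rewrite (int_on_opp mz iz) oppr0 opprK; apply: eq_Rintegral => t _ /=.
    by rewrite addrC.
  rewrite (int_on_shift z mh (hi _ _)) subrr addrAC subrr add0r.
  by apply: eq_Rintegral => t _ /=; rewrite addrC.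
rewrite (_ : (fun x => h x + h (- x)) = fun t => h (0 + t) + h (0 - t)); last first.
  by apply/funext => x; rewrite add0r sub0r.
rewrite !fold !add0r.
rewrite (@int_on_cat (-1) (y - 1) 1)//; [|lra|lra].
rewrite (@int_on_cat (y - 1) 1 (y + 1))//; [|lra|lra].
rewrite addrC; congr (_ + _).
(* What remains are the end pieces of the two periods, [[-1, y - 1]] and [[1, y + 1]], which differ
   by the period 2. *)
rewrite [RHS](int_on_shift 2 mh (hi _ _)).
rewrite (_ : 1 - 2 = -1); last by ring.
rewrite (_ : y + 1 - 2 = y - 1); last by ring.
by apply: eq_Rintegral => x _ /=; rewrite per.
Qed.

End IntegralsOfPeriodicFunctions.

Section FubiniOnUnitSquare.
Context {R : realType}.
Local Notation mu := (@lebesgue_measure R).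
Local Notation RR := (measurableTypeR R).
Let I01 : RR -> RR := \1_(unit_interval : set R).

Let I01E (x : R) : I01 x = if 0 <= x <= 1 then 1 else 0.
Proof.
rewrite /I01 indicE; case: ifP => h.
  by rewrite mem_set//; exact: unit_interval_01.
by rewrite memNset// => /unit_interval_le; rewrite h.
Qed.

Let mI : measurable_fun [set: RR] I01.
Proof. exact: measurable_indic measurable_unit_interval. Qed.

Let int01E (g : R -> R) : int01 g = fine (\int[mu]_x (g x * I01 x)%:E).
Proof.
rewrite /int01 /Rintegral integral_mkcond; congr fine.
apply: eq_integral => x _; rewrite patchE /I01 indicE.
by case: ifPn => _; rewrite ?mulr1 ?mulr0.
Qed.

Let integrable01E (g : R -> R) : integrable01 g ->
  mu.-integrable [set: RR] (fun x => (g x * I01 x)%:E).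
Proof.
move=> /(integrable_mkcond _ measurable_unit_interval).
apply: eq_integrable => // x _; rewrite patchE /I01 indicE.
by case: ifPn => _; rewrite ?mulr1 ?mulr0.
Qed.

(** Fubini for [f] extended by zero off the square. The dominating function depends on [t] alone,
    which fits kernels with a singularity in [t]; it makes the double integral and every section
    integrable. *)
Lemma int01_swap (f : R -> R -> R) (g : R -> R) :
  measurable_fun [set: (RR * RR)%type] (fun z => f z.1 z.2 : RR) -> integrable01 g ->
  (forall t y, 0 <= t <= 1 -> 0 <= y <= 1 -> `|f t y| <= g t) ->
  int01 (fun t => int01 (fun y => f t y)) = int01 (fun y => int01 (fun t => f t y)).
Proof.
move=> mf gi fg.
pose F (z : RR * RR) : \bar R := (f z.1 z.2 * I01 z.1 * I01 z.2)%:E.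
have mF : measurable_fun setT F.
  apply/measurable_EFinP; apply: measurable_funM.
    apply: measurable_funM => //; apply: measurableT_comp mI measurable_fst.
  exact: measurableT_comp mI measurable_snd.
have I0 x : 0 <= I01 x by rewrite I01E; case: ifP.
have FG t y : `|f t y * I01 t * I01 y| <= g t * I01 t * I01 y.
  rewrite !I01E; case: ifP => ht; last by rewrite !(mulr0, mul0r) normr0.
  by case: ifP => hy; rewrite ?mulr1 ?mulr0 ?normr0// fg.
have g0 t : 0 <= g t * I01 t.
  rewrite I01E; case: ifP => ht; last by rewrite mulr0.
  by rewrite mulr1; apply: le_trans (fg t 0 ht _); rewrite ?normr_ge0// lexx ler01.
have intI : (\int[mu]_y (I01 y)%:E = 1)%E.
  rewrite /I01 integral_indic//; last exact: measurable_unit_interval.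
  rewrite setIT; have : mu unit_interval = 1%E by rewrite lebesgue_measure_itv/= lte01 oppr0 adde0.
  by [].
have measF1 t : measurable_fun [set: RR] (fun y => F (t, y)).
  apply: measurableT_comp mF _; exact: measurable_pair1.
have measF2 y : measurable_fun [set: RR] (fun t => F (t, y)).
  apply: measurableT_comp mF _; exact: measurable_pair2.
have inner t : (\int[mu]_y `|F (t, y)| <= (g t * I01 t)%:E)%E.
  rewrite -[leRHS]mule1 -intI -ge0_integralZl//; first last.
  - by rewrite lee_fin.
  - by move=> y _; rewrite lee_fin.
  - exact/measurable_EFinP.
  apply: ge0_le_integral; [exact: measurableT | by [] | | | ].
  - by apply: measurableT_comp => //; exact: measF1.
  - by apply/measurable_EFinP/measurable_funM.
  - by move=> y _; rewrite -EFinM lee_fin /F /=; exact: FG.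
have mabsF : measurable_fun setT (abse \o F) by exact: measurableT_comp.
have mFF : measurable_fun [set: RR] (fun t => \int[mu]_y `|F (t, y)|)%E.
  have aF0 z : (0 <= (abse \o F) z)%E by exact: abse_ge0.
  exact: (measurable_fun_fubini_tonelli_F _ mabsF aF0).
have Fi : (mu \x mu)%E.-integrable setT F.
  apply/integrable12ltyP => //; apply: (@le_lt_trans _ _ (\int[mu]_t (g t * I01 t)%:E)%E).
    apply: ge0_le_integral; [exact: measurableT | | exact: mFF | | ].
    - by move=> s _; exact: integral_ge0.
    - exact: measurable_int (integrable01E gi).
    - by move=> s _; exact: inner.
  by apply: integrable_lty => //; exact: integrable01E.
have int1 t : mu.-integrable setT (fun y => F (t, y)).
  apply/integrableP; split => //; apply: le_lt_trans (inner t) _; exact: ltry.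
have int2 y : mu.-integrable setT (fun t => F (t, y)).
  apply: le_integrable (integrable01E gi) => //.
  move=> t _; rewrite /F /= lee_fin (le_trans (FG t y))// ger0_norm//.
  by rewrite ler_piMr// I01E; case: ifP.
have E1 t : (int01 (fun y => f t y) * I01 t)%:E = (\int[mu]_y F (t, y))%E.
  rewrite int01E I01E; case: ifP => ht.
    rewrite mulr1 (_ : (fun x => _) = fun y => F (t, y)); last first.
      by apply/funext => y; rewrite /F /= [I01 t]I01E ht mulr1.
    by rewrite fineK//; exact: integrable_fin_num.
  rewrite mulr0 (_ : (fun y => F _) = fun=> 0%E) ?integral0//.
  by apply/funext => y; rewrite /F /= [I01 t]I01E ht mulr0 mul0r.
have E2 y : (int01 (fun t => f t y) * I01 y)%:E = (\int[mu]_t F (t, y))%E.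
  rewrite int01E I01E; case: ifP => hy.
    rewrite mulr1 (_ : (fun x => _) = fun t => F (t, y)); last first.
      by apply/funext => t; rewrite /F /= [I01 y]I01E hy mulr1.
    by rewrite fineK//; exact: integrable_fin_num.
  rewrite mulr0 (_ : (fun t => F _) = fun=> 0%E) ?integral0//.
  by apply/funext => t; rewrite /F /= [I01 y]I01E hy mulr0.
rewrite [LHS]int01E [RHS]int01E; congr fine.
under eq_integral do rewrite E1.
under [RHS]eq_integral do rewrite E2.
exact: Fubini.
Qed.

End FubiniOnUnitSquare.

(** * Singular double integrals over the square *)

Section SingularDoubleIntegral.
Context {R : realType}.
Local Notation mu := (@lebesgue_measure R).
Local Notation RR := (measurableTypeR R).
Variable K : R -> R.
Hypothesis K_meas : rmeasurable K.
Hypothesis K_ge0 : forall t, 0 <= K t.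
Hypothesis K_periodic : forall t, K (t + 2) = K t.
Hypothesis K_even : forall t, K (- t) = K t.

Definition sin_half (t : R) : R := sin (pi * t / 2).

Hypothesis K_integrable : integrable_on 0 1 (fun t => K t * sin_half t ^+ 2).

(** Lipschitz for the distance [|sin (pi (x - y) / 2)|], natural for functions of period 2: two such
    differences produce the factor [sin_half ^+ 2] against which the singular kernel is assumed
    integrable. *)
Definition sin_lipschitz (C : R) (u : R -> R) : Prop :=
  [/\ 0 <= C, continuous u, forall x, u (x + 2) = u x &
      forall x y, `|u x - u y| <= C * `|sin_half (x - y)|].

(** The numerator of the double integral after the substitutions [x = y + t] and [x = y - t]. *)
Definition sym_diff2 (u v : R -> R) (t y : R) : R :=
  (u (y + t) - u y) * (v (y + t) - v y) + (u (y - t) - u y) * (v (y - t) - v y).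

Let L t := K t * sin_half t ^+ 2.

Let L_ge0 t : 0 <= L t. Proof. by rewrite mulr_ge0// sqr_ge0. Qed.

Lemma sin_halfN t : sin_half (- t) = - sin_half t.
Proof. by rewrite /sin_half mulrN mulNr sinN. Qed.

Lemma sin_half_periodic t : sin_half (t + 2) = - sin_half t.
Proof.
rewrite /sin_half (_ : pi * (t + 2) / 2 = pi * t / 2 + pi); last by field.
by rewrite sinDpi.
Qed.

Lemma continuous_sin_half : continuous sin_half.
Proof.
rewrite (_ : sin_half = fun t => sin (pi / 2 * t)); first exact: continuous_sinZ.
by apply/funext => t; rewrite /sin_half mulrAC.
Qed.

Let L_meas : rmeasurable L.
Proof.
apply: measurable_funM => //; apply: measurable_funM; exact: continuous_measurable_fun
    continuous_sin_half.
Qed.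

Let L_loc a b : integrable_on a b L.
Proof.
apply: periodic_integrable_on => //.
  by move=> x; rewrite /L K_periodic sin_half_periodic sqrrN.
apply: (integrable_on_cat L_meas (lerN10 _) ler01 _ K_integrable).
have := integrable_on_opp L_meas K_integrable; rewrite oppr0.
by congr integrable_on; apply/funext => x; rewrite /L K_even sin_halfN sqrrN.
Qed.

Section Form.
Variables (Cu Cv : R) (u v : R -> R).
Hypotheses (lu : sin_lipschitz Cu u) (lv : sin_lipschitz Cv v).

Let u_meas : rmeasurable u. Proof. by case: lu => _ cu _ _; exact: continuous_measurable_fun. Qed.
Let v_meas : rmeasurable v. Proof. by case: lv => _ cv _ _; exact: continuous_measurable_fun. Qed.

Let prod_bound a x y b z : `|a - x| <= Cu * `|sin_half z| -> `|b - y| <= Cv * `|sin_half z| ->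
  `|(a - x) * (b - y) * K z| <= Cu * Cv * L z.
Proof.
move=> h1 h2; rewrite !normrM (ger0_norm (K_ge0 z)) /L.
have -> : Cu * Cv * (K z * sin_half z ^+ 2) =
    (Cu * `|sin_half z|) * (Cv * `|sin_half z|) * K z.
  by rewrite -[sin_half z ^+ 2]real_normK ?num_real//; ring.
by rewrite ler_wpM2r// ler_pM.
Qed.

(** As [K] is even, the [x + y] term is the [x - y] term [h] taken at [- x]. So the inner integral
    is that of the periodic [h] over a whole period, which may be centred at [y] instead of 0. *)
Let inner_fold y : 0 <= y <= 1 ->
  int01 (fun x => (u x - u y) * (v x - v y) * K (x - y) +
    (u (- x) - u y) * (v (- x) - v y) * K (x + y)) =
  int01 (fun t => K t * sym_diff2 u v t y).
Proof.
move=> y01; pose h x := (u x - u y) * (v x - v y) * K (x - y).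
case: lu => Cu0 cu pu bu; case: lv => Cv0 cv pv bv.
have mh : rmeasurable h.
  apply: measurable_funM; last exact: rmeasurable_shift.
  by apply: measurable_funM; apply: measurable_funB => //; exact: measurable_cst.
have ph x : h (x + 2) = h x.
  by rewrite /h pu pv (_ : x + 2 - y = x - y + 2) ?K_periodic//; ring.
have ih a b : integrable_on a b h.
  have mi : measurable (`[a, b]%classic : set RR) by exact: measurable_itv.
  have mL : rmeasurable (fun x => Cu * Cv * L (x - y)).
    by apply: measurable_funM; [exact: measurable_cst | exact: rmeasurable_shift].
  have iL : integrable_on a b (fun x => Cu * Cv * L (x - y)).
    have := integrable_on_shift (- y) L_meas (L_loc (a - y) (b - y)).
    rewrite !opprK !subrK => i.
    exact: (integrableZl mi (Cu * Cv) i).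
  apply: (le_integrable mi _ _ iL); first exact/measurable_EFinP/measurable_funTS.
  move=> x _ /=; rewrite lee_fin [leRHS]ger0_norm; last exact: mulr_ge0 (mulr_ge0 Cu0 Cv0) _.
  by apply: prod_bound; [exact: bu | exact: bv].
transitivity (int01 (fun x => h x + h (- x))).
  apply: eq_int01 => x _; rewrite /h; congr (_ + _ * _).
  by rewrite -K_even; congr K; ring.
rewrite (int01_periodic mh ph ih y01); apply: eq_int01 => t _.
rewrite /h /sym_diff2 (_ : y + t - y = t); last by ring.
by rewrite (_ : y - t - y = - t) ?K_even; ring.
Qed.

(** After folding, the order of integration is exchanged so that the [y] integral, elementary for
    trigonometric functions, is taken first. Domination is by [2 Cu Cv L]. *)
Lemma double_int_fold :
  int01 (fun y => int01 (fun x => (u x - u y) * (v x - v y) * K (x - y) +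
    (u (- x) - u y) * (v (- x) - v y) * K (x + y))) =
  int01 (fun t => K t * int01 (sym_diff2 u v t)).
Proof.
transitivity (int01 (fun y => int01 (fun t => K t * sym_diff2 u v t y))).
  by apply: eq_int01 => y y01; exact: inner_fold.
case: lu => Cu0 cu pu bu; case: lv => Cv0 cv pv bv.
rewrite -(@int01_swap _ (fun t y => K t * sym_diff2 u v t y) (fun t => 2 * (Cu * Cv) * L t)).
- apply: eq_int01 => t _; rewrite int01Z//.
  apply/continuous_integrable01/continuous_subspaceT => y.
  have cs (w : R -> R) z : continuous w -> {for y, continuous (fun y => w (y + z))}.
    by move=> cw; apply: continuous_comp; [apply: cvgD; [exact: cvg_id | exact: cvg_cst] |
        exact: cw].
  apply: cvgD; apply: cvgM; apply: cvgB; try exact: cs; try exact: cu; exact: cv.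
- apply: measurable_funM; first exact: measurableT_comp K_meas measurable_fst.
  have m (w : R -> R) : rmeasurable w -> measurable_fun [set: (RR * RR)%type] (fun z => w z.2 : RR).
    by move=> mw; exact: measurableT_comp mw measurable_snd.
  have mD (w : R -> R) : rmeasurable w ->
      measurable_fun [set: (RR * RR)%type] (fun z => w (z.2 + z.1) : RR).
    move=> mw; apply: (measurableT_comp mw (g := fun z : RR * RR => z.2 + z.1 : RR)).
    by apply: measurable_funD; [exact: measurable_snd | exact: measurable_fst].
  have mB (w : R -> R) : rmeasurable w ->
      measurable_fun [set: (RR * RR)%type] (fun z => w (z.2 - z.1) : RR).
    move=> mw; apply: (measurableT_comp mw (g := fun z : RR * RR => z.2 - z.1 : RR)).
    by apply: measurable_funB; [exact: measurable_snd | exact: measurable_fst].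
  by apply: measurable_funD; apply: measurable_funM; apply: measurable_funB;
    [exact: mD | exact: m | exact: mD | exact: m | exact: mB | exact: m | exact: mB | exact: m].
- exact/integrable01Z/L_loc.
- move=> t y _ _; rewrite /sym_diff2 mulrDr.
  rewrite (_ : 2 * (Cu * Cv) * L t = Cu * Cv * L t + Cu * Cv * L t); last by ring.
  rewrite (le_trans (ler_normD _ _))// lerD// mulrC; apply: prod_bound.
  + by have := bu (y + t) y; rewrite (_ : y + t - y = t)//; ring.
  + by have := bv (y + t) y; rewrite (_ : y + t - y = t)//; ring.
  + by have := bu (y - t) y; rewrite (_ : y - t - y = - t) ?sin_halfN ?normrN//; ring.
  + by have := bv (y - t) y; rewrite (_ : y - t - y = - t) ?sin_halfN ?normrN//; ring.
Qed.

End Form.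

Lemma sin_nat_le (k : nat) (x : R) : `|sin (k%:R * x)| <= k%:R * `|sin x|.
Proof.
elim: k => [|k IH]; first by rewrite !mul0r sin0 normr0.
rewrite -natr1 !mulrDl !mul1r sinD (le_trans (ler_normD _ _))// !normrM lerD//.
  by apply: le_trans IH; rewrite ler_piMr// cos_max.
by rewrite ler_piMl// cos_max.
Qed.

Lemma kernel_sin_integrable (k : nat) :
  integrable01 (fun t => K t * sin_half (k%:R * t) ^+ 2).
Proof.
apply: (le_integrable measurable_unit_interval _ _ (integrable01Z (k%:R ^+ 2) K_integrable)).
  apply/measurable_EFinP/measurable_funTS; apply: measurable_funM => //.
  have cs : continuous (fun t : R => sin_half (k%:R * t)).
    move=> t; apply: continuous_comp; last exact: continuous_sin_half.
    by apply: cvgM; [exact: cvg_cst | exact: cvg_id].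
  by apply: measurable_funM; exact: continuous_measurable_fun.
move=> t _ /=; rewrite lee_fin (ger0_norm (mulr_ge0 (K_ge0 t) (sqr_ge0 _))).
rewrite (ger0_norm (mulr_ge0 (sqr_ge0 _) (mulr_ge0 (K_ge0 t) (sqr_ge0 _)))).
rewrite [leRHS]mulrCA ler_wpM2l// -exprMn -[leLHS]real_normK ?num_real//.
rewrite -[leRHS]real_normK ?num_real//; apply: lerXn2r; rewrite ?nnegrE//.
rewrite normrM [`|k%:R|]ger0_norm// /sin_half (_ : pi * (k%:R * t) / 2 = k%:R * (pi * t / 2)).
  exact: sin_nat_le.
by field.
Qed.

End SingularDoubleIntegral.

Section CosPiQuarter.
Variable R : realType.

Lemma cos_pi4_sqr : cos (pi / 4) ^+ 2 = 1 / 2 :> R.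
Proof.
have := cos_mulr2n (pi / 4 : R).
rewrite (_ : (pi / 4) *+ 2 = pi / 2); last by rewrite -mulr_natr; field.
by rewrite cos_pihalf mulr2n; lra.
Qed.

Lemma cos_pi4_ge : 1 / 2 <= cos (pi / 4) :> R.
Proof.
have c0 : 0 < cos (pi / 4) :> R.
  by apply: cos_gt0_pihalf; apply/andP; split; have := pi_gt0 R; lra.
rewrite leNgt; apply/negP => h; have := cos_pi4_sqr; nra.
Qed.

End CosPiQuarter.

(** * Eigenvalues of the power-of-sine kernel and their link with [kappa] *)

Section SineKernel.
Context {R : realType}.
Local Notation mu := (@lebesgue_measure R).
Variable p : R.
Hypothesis p_gt0 : 0 < p.

Definition sin_kernel (t : R) : R := (`|sin_half t| `^ p)^-1.

(** Up to constants, the eigenvalue of the singular double integral at the frequency [k]. *)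
Definition sin_eigenvalue (k : nat) : R :=
  int01 (fun t => sin_kernel t * sin_half (k%:R * t) ^+ 2).

Definition sin_ratio (t : R) : R := sin (pi * t) ^+ 2 / (t `^ p).

Definition sin_ratio_int : R := \int[mu]_(t in `[0, 2^-1]) sin_ratio t.

Lemma sin_kernel_ge0 t : 0 <= sin_kernel t.
Proof. by rewrite invr_ge0 powR_ge0. Qed.

Lemma sin_kernel_periodic t : sin_kernel (t + 2) = sin_kernel t.
Proof. by rewrite /sin_kernel sin_half_periodic normrN. Qed.

Lemma sin_kernel_even t : sin_kernel (- t) = sin_kernel t.
Proof. by rewrite /sin_kernel sin_halfN normrN. Qed.

Lemma sin_kernel_measurable : rmeasurable sin_kernel.
Proof.
rewrite (_ : sin_kernel = fun t => `|sin_half t| `^ (- p)); last first.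
  by apply/funext => t; rewrite powRN.
apply: (measurableT_comp (measurable_powR (- p)) (g := fun t => `|sin_half t|)).
apply: measurableT_comp; first exact: normr_measurable.
exact: continuous_measurable_fun continuous_sin_half.
Qed.

Lemma sin_ratio_measurable : rmeasurable sin_ratio.
Proof.
rewrite (_ : sin_ratio = fun t => sin (pi * t) ^+ 2 * t `^ (- p)); last first.
  by apply/funext => t; rewrite powRN.
apply: measurable_funM; last exact: measurable_powR.
by apply: measurable_funM; exact: continuous_measurable_fun (@continuous_sinZ _ pi).
Qed.

Lemma sin_ratio_ge0 t : 0 <= sin_ratio t.
Proof. by rewrite divr_ge0 ?sqr_ge0 ?powR_ge0. Qed.

(** A weak form of Jordan's inequality. Up to 1/2 the derivative is at least
    [(pi / 2) cos (pi / 4)], hence at least 1/2; beyond, the sine is at least [sin (pi / 4)], again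
    at least 1/2. *)
Lemma sin_half_ge (t : R) : 0 <= t <= 1 -> t / 2 <= sin_half t.
Proof.
move=> /andP[t0 t1]; have pi2 := pi_ge2 R.
have c4 := cos_pi4_ge R; have c4s := cos_pi4_sqr R.
case: (leP t (1 / 2)) => t2; last first.
  have s4 : 1 / 2 <= sin (pi * (1 / 4)) :> R.
    have s0 : 0 < sin (pi * (1 / 4)) :> R by apply: sin_gt0_pi; apply/andP; split; lra.
    have : sin (pi * (1 / 4)) ^+ 2 = 1 / 2 :> R.
      by rewrite sin2cos2 (_ : pi * (1 / 4) = pi / 4) ?c4s; field.
    rewrite leNgt => hs; apply/negP => h; nra.
  have := @sin_pi_mono R (1 / 4) (t / 2).
  rewrite /sin_half mulrA => h; have := h _ _ _; lra.
move: t0; rewrite le_eqVlt => /orP[/eqP <-|t0].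
  by rewrite /sin_half mulr0 mul0r sin0.
have h1 : forall z, z \in `]0, t[ ->
    is_derive z 1 (fun t => sin (pi / 2 * t)) (pi / 2 * cos (pi / 2 * z)).
  by move=> z _; exact: is_derive_sinZ.
have h2 : {within `[0, t], continuous (fun t : R => sin (pi / 2 * t))}.
  by apply: continuous_subspaceT; exact: continuous_sinZ.
have [z] := MVT t0 h1 h2; rewrite in_itv /= => /andP[z0 zt].
rewrite mulr0 sin0 !subr0 => E; rewrite /sin_half (_ : pi * t / 2 = pi / 2 * t) ?E; last by ring.
have c : cos (pi / 4) <= cos (pi / 2 * z).
  have z2 : pi * z < pi * (1 / 2) by rewrite ltr_pM2l; lra.
  have z3 : 0 < pi * z by rewrite mulr_gt0; lra.
  by apply/ltW; rewrite ltr_cos ?in_itv /=; [|apply/andP; split|apply/andP; split]; lra.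
by rewrite mulrC ler_pM2r//; nra.
Qed.

Lemma sin_half_le (t : R) : 0 <= t -> sin_half t <= pi / 2 * t.
Proof.
move=> t0; have := is_derive_lipschitz (fun x : R => is_derive_sinZ 1 x).
move=> /(_ 1) H; have /H/(_ (pi / 2 * t) 0) : forall x : R, `|1 * cos (1 * x)| <= 1.
  by move=> x; rewrite mul1r cos_max.
rewrite !mul1r sin0 !subr0 [leRHS]ger0_norm; last by rewrite !mulr_ge0// pi_ge0.
by move=> /(le_trans (ler_norm _)); rewrite /sin_half mulrAC.
Qed.

Hypothesis ratio_neq0 : sin_ratio_int != 0.

(** The real integral of a nonnegative function is [fine] of an extended real, which is 0 if that is
    infinite. A nonzero value therefore already proves integrability. *)
Lemma sin_ratio_integrable : integrable_on 0 2^-1 sin_ratio.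
Proof.
apply/integrableP; split; first by apply/measurable_EFinP/measurable_funTS; exact:
    sin_ratio_measurable.
have -> : (\int[mu]_(x in `[0%R, 2^-1%R]) `|(EFin \o sin_ratio) x| =
    \int[mu]_(x in `[0%R, 2^-1%R]) (sin_ratio x)%:E)%E.
  by apply: eq_integral => x _; rewrite /= ger0_norm// sin_ratio_ge0.
move: ratio_neq0; rewrite /sin_ratio_int /Rintegral.
have : (0 <= \int[mu]_(x in `[0%R, 2^-1%R]) (sin_ratio x)%:E)%E.
  by apply: integral_ge0 => x _; rewrite lee_fin sin_ratio_ge0.
by case: (integral _ _ _) => [r| |] _ //=; rewrite ?ltry// eqxx.
Qed.

Lemma affine_scale_preimage (c b : R) : 0 < c ->
  affine c 0 @^-1` `[0, b] = `[0, b / c]%classic.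
Proof.
move=> c0; apply/seteqP; split => x; rewrite /= !in_itv /= /affine addr0;
by rewrite ler_pdivlMr// pmulr_rge0// mulrC.
Qed.

(** Since [t / 2 <= sin_half t], the integrand is dominated by [sin_ratio (t / 2)], whose
    integrability over [[0, 1]] is that of [sin_ratio] over [[0, 1/2]]. *)
Lemma sin_kernel_integrable : integrable_on 0 1 (fun t => sin_kernel t * sin_half t ^+ 2).
Proof.
have h0 : (2^-1 : R) != 0 by rewrite invr_eq0.
have := (integrable_affine 0 h0 (measurable_itv _) sin_ratio_measurable).1 sin_ratio_integrable.
rewrite affine_scale_preimage ?invr_gt0// divff// => i.
apply: (le_integrable measurable_unit_interval _ _ i).
  apply/measurable_EFinP/measurable_funTS.
  apply: measurable_funM; first exact: sin_kernel_measurable.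
  by apply: measurable_funM; exact: continuous_measurable_fun continuous_sin_half.
move=> t /unit_interval_le t01 /=; rewrite lee_fin !ger0_norm; last 2 first.
- exact: sin_ratio_ge0.
- by rewrite mulr_ge0 ?sqr_ge0 ?sin_kernel_ge0.
have -> : affine 2^-1 0 t = t / 2 by rewrite /affine addr0 mulrC.
rewrite /sin_ratio mulrC mulrA -/(sin_half t).
apply: ler_wpM2l; first exact: sqr_ge0.
have [t0|t0] := eqVneq t 0.
  rewrite t0 /sin_kernel /sin_half mulr0 mul0r sin0 normr0.
  by rewrite powR0 ?gt_eqF// invr0.
have tp : 0 < t / 2 by rewrite divr_gt0// lt_neqAle eq_sym t0; case/andP: t01.
have sp := sin_half_ge t01.
rewrite /sin_kernel lef_pV2 ?posrE ?powR_gt0//; last by rewrite normr_gt0 gt_eqF// (lt_le_trans tp).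
apply: ge0_ler_powR; rewrite ?nnegrE ?normr_ge0//; try exact: ltW.
by rewrite ger0_norm// (le_trans (ltW tp)).
Qed.

Lemma sin_eigenvalue_integrable k :
  integrable01 (fun t => sin_kernel t * sin_half (k%:R * t) ^+ 2).
Proof.
apply: kernel_sin_integrable => //.
- exact: sin_kernel_measurable.
- exact: sin_kernel_ge0.
- exact: sin_kernel_integrable.
Qed.

Lemma sin_eigenvalue_ge0 k : 0 <= sin_eigenvalue k.
Proof. by apply: int01_ge0 => t _; rewrite mulr_ge0 ?sqr_ge0 ?sin_kernel_ge0. Qed.

Lemma sin_eigenvalue0 : sin_eigenvalue 0 = 0.
Proof.
rewrite -(@int01_cst R 0); apply: eq_int01 => t _.
by rewrite mul0r /sin_half mulr0 mul0r sin0 expr0n /= mulr0.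
Qed.

(** Substituting [k t / 2] turns the integral of [kappa] into one over [[0, 1/k]]. There
    [sin_half t <= pi t / 2] bounds the kernel below by [(pi t / 2)^(-p)], and comparing with
    [(k t / 2)^(-p)] produces [C = (pi / k)^p]; the rest of [[0, 1]] is dropped. *)
Lemma sin_eigenvalue_ge (k : nat) : (0 < k)%N ->
  2 * k%:R `^ (p - 1) * pi `^ (- p) * sin_ratio_int <= sin_eigenvalue k.
Proof.
move=> k0; have kp : 0 < k%:R :> R by rewrite ltr0n.
have pip := pi_gt0 R.
have c0 : 0 < k%:R / 2 :> R by rewrite divr_gt0.
have cn : k%:R / 2 != 0 :> R by rewrite gt_eqF.
have E := Rintegral_affine 0 cn (measurable_itv _) sin_ratio_measurable sin_ratio_integrable.
have I := (integrable_affine 0 cn (measurable_itv _) sin_ratio_measurable).1 sin_ratio_integrable.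
rewrite affine_scale_preimage// in E I.
have d : 2^-1 / (k%:R / 2) = k%:R^-1 :> R by field; rewrite gt_eqF.
rewrite d in E I.
have kV1 : k%:R^-1 <= 1 :> R by rewrite invf_le1// ler1n.
pose C := (pi / k%:R) `^ p : R; have C0 : 0 < C by rewrite powR_gt0// divr_gt0.
have step : \int[mu]_(t in `[0, k%:R^-1]) sin_ratio (affine (k%:R / 2) 0 t) <=
    C * sin_eigenvalue k.
  have iE := integrable01Z C (sin_eigenvalue_integrable k).
  have iE' := integrable_onW (lexx 0) kV1 iE.
  apply: (@le_trans _ _ (int_on 0 k%:R^-1 (fun t => C * (sin_kernel t * sin_half (k%:R * t) ^+
      2)))).
    have mi : measurable (`[0, k%:R^-1]%classic : set (measurableTypeR R)) by exact: measurable_itv.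
    apply: (le_Rintegral mi I iE').
    move=> t; rewrite /= in_itv /= => /andP[t0 tk].
    have -> : affine (k%:R / 2) 0 t = k%:R * t / 2 by rewrite /affine addr0 mulrAC.
    rewrite /sin_ratio mulrA -/(sin_half (k%:R * t)) mulrA mulrC ler_wpM2r ?sqr_ge0//.
    move: t0; rewrite le_eqVlt => /orP[/eqP <-|t0].
      rewrite mulr0 mul0r powR0 ?gt_eqF// invr0.
      by rewrite mulr_ge0 ?(ltW C0) ?sin_kernel_ge0.
    have t1 : 0 <= t <= 1 by rewrite (ltW t0) (le_trans tk).
    have sp := sin_half_ge t1; have sl := sin_half_le (ltW t0).
    have s0 : 0 < sin_half t by apply: lt_le_trans sp; rewrite divr_gt0.
    rewrite /sin_kernel gtr0_norm//.
    apply: (@le_trans _ _ (C * ((pi / 2 * t) `^ p)^-1)); last first.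
      rewrite ler_pM2l// lef_pV2 ?posrE ?powR_gt0 ?mulr_gt0 ?divr_gt0//.
      by apply: ge0_ler_powR; rewrite ?nnegrE ?(ltW p_gt0) ?(ltW s0)// (le_trans (ltW s0)).
    rewrite le_eqVlt; apply/orP; left; apply/eqP.
    rewrite /C (_ : pi / 2 * t = (pi / k%:R) * (k%:R * t / 2)); last by field; rewrite gt_eqF.
    rewrite [(pi / k%:R * (k%:R * t / 2)) `^ p]powRM; last 2 first.
    - by rewrite divr_ge0 ?ltW.
    - by rewrite divr_ge0 ?mulr_ge0 ?ltW.
    by rewrite invfM mulrA divff ?mul1r// gt_eqF.
  rewrite /sin_eigenvalue -int01Z; last exact: sin_eigenvalue_integrable.
  have kV0 : 0 <= k%:R^-1 :> R by rewrite invr_ge0 ltW.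
  rewrite -[leRHS]/(int_on 0 1 _) (int_on_cat kV0 kV1 iE).
  rewrite lerDl; apply: Rintegral_ge0 => t _.
  by apply: mulr_ge0; [exact: ltW | rewrite mulr_ge0 ?sqr_ge0 ?sin_kernel_ge0].
have {}E : sin_ratio_int = k%:R / 2 * \int[mu]_(t in `[0, k%:R^-1]) sin_ratio (affine (k%:R /
    2) 0 t).
  by rewrite /sin_ratio_int E gtr0_norm.
have S : sin_ratio_int <= k%:R / 2 * (C * sin_eigenvalue k) by rewrite E ler_pM2l.
apply: (@le_trans _ _ (2 * k%:R `^ (p - 1) * pi `^ (- p) * (k%:R / 2 * (C * sin_eigenvalue k)))).
  by rewrite ler_wpM2l// !mulr_ge0// powR_ge0.
rewrite le_eqVlt; apply/orP; left; apply/eqP.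
have -> : C = pi `^ p * (k%:R `^ p)^-1.
  rewrite /C powRM; [|exact: ltW|by rewrite invr_ge0 ltW].
  by rewrite -powR_inv1 ?ltW// -powRrM mulN1r powRN.
have -> : k%:R `^ (p - 1) = k%:R `^ p / k%:R :> R.
  by rewrite powRD ?(gt_eqF kp) ?implybT// powR_inv1// ltW.
rewrite powRN; field.
by rewrite !gt_eqF// ?powR_gt0.
Qed.

End SineKernel.

(** * Cosines and sines diagonalise the Sobolev forms *)

Section Diagonalisation.
Context {R : realType}.

Lemma cos_shift (A B : R) : cos (A + 2 * B) - cos A = - (2 * sin B * sin (A + B)).
Proof.
rewrite cosBcos (_ : (A + (A + 2 * B)) / 2 = A + B); last by field.
rewrite (_ : (A - (A + 2 * B)) / 2 = - B); last by field.
by rewrite sinN; ring.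
Qed.

Lemma sin_shift (A B : R) : sin (A + 2 * B) - sin A = 2 * sin B * cos (A + B).
Proof.
rewrite mulr_natl sinD cos_mulr2n sin_mulr2n cosD (cos2sin2 B) !mulr2n; ring.
Qed.

Let half_shift (k : nat) (y t : R) :
  k%:R * pi * (y + t) = k%:R * pi * y + 2 * (pi * (k%:R * t) / 2).
Proof. by field. Qed.

Let half_shiftN (k : nat) (y t : R) :
  k%:R * pi * (y - t) = k%:R * pi * y + 2 * (- (pi * (k%:R * t) / 2)).
Proof. by field. Qed.

(** Each difference carries the half-angle sine of its own frequency. Adding the contributions of
    [t] and [-t] leaves only the frequencies [k - l] and [k + l] in [y], with coefficients that
    depend on [t]. *)
Lemma sym_diff2_cos (k l : nat) (t y : R) :
  sym_diff2 (fun x => cos (k%:R * pi * x)) (fun x => cos (l%:R * pi * x)) t y =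
  4 * sin_half (k%:R * t) * sin_half (l%:R * t) *
   (cos ((k%:R - l%:R) * pi * y) * cos ((k%:R - l%:R) * (pi * t / 2)) -
    cos ((k + l)%:R * pi * y) * cos ((k + l)%:R * (pi * t / 2))).
Proof.
rewrite /sym_diff2 !half_shiftN !half_shift !cos_shift -!/(sin_half _) !sinN.
rewrite -!/(sin_half _) natrD.
rewrite (_ : (k%:R - l%:R) * pi * y = k%:R * pi * y - l%:R * pi * y); last by ring.
rewrite (_ : (k%:R + l%:R) * pi * y = k%:R * pi * y + l%:R * pi * y); last by ring.
rewrite (_ : (k%:R - l%:R) * (pi * t / 2) = pi * (k%:R * t) / 2 - pi * (l%:R * t) / 2); last by
    ring.
rewrite (_ : (k%:R + l%:R) * (pi * t / 2) = pi * (k%:R * t) / 2 + pi * (l%:R * t) / 2); last by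
    ring.
by rewrite !cosD !sinD !sinN !cosN /sin_half; ring.
Qed.

Lemma sym_diff2_sin (k l : nat) (t y : R) :
  sym_diff2 (fun x => sin (k%:R * pi * x)) (fun x => sin (l%:R * pi * x)) t y =
  4 * sin_half (k%:R * t) * sin_half (l%:R * t) *
   (cos ((k%:R - l%:R) * pi * y) * cos ((k%:R - l%:R) * (pi * t / 2)) +
    cos ((k + l)%:R * pi * y) * cos ((k + l)%:R * (pi * t / 2))).
Proof.
rewrite /sym_diff2 !half_shiftN !half_shift !sin_shift !sinN natrD.
rewrite (_ : (k%:R - l%:R) * pi * y = k%:R * pi * y - l%:R * pi * y); last by ring.
rewrite (_ : (k%:R + l%:R) * pi * y = k%:R * pi * y + l%:R * pi * y); last by ring.
rewrite (_ : (k%:R - l%:R) * (pi * t / 2) = pi * (k%:R * t) / 2 - pi * (l%:R * t) / 2); last by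
    ring.
rewrite (_ : (k%:R + l%:R) * (pi * t / 2) = pi * (k%:R * t) / 2 + pi * (l%:R * t) / 2); last by
    ring.
by rewrite !cosD !sinN !cosN /sin_half; ring.
Qed.

(** [e] is -1 for cosines and 1 for sines. Integration over [y] keeps the frequency [k - l] only if
    [k = l]; the frequency [k + l] could survive only for [k = l = 0], where the half-angle sines
    vanish. *)
Lemma int01_sym_diff2_lincomb (k l : nat) (t e : R) :
  int01 (fun y => 4 * sin_half (k%:R * t) * sin_half (l%:R * t) *
   (cos ((k%:R - l%:R) * pi * y) * cos ((k%:R - l%:R) * (pi * t / 2)) +
    e * (cos ((k + l)%:R * pi * y) * cos ((k + l)%:R * (pi * t / 2))))) =
  4 * sin_half (k%:R * t) ^+ 2 * (k == l)%:R.
Proof.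
pose S := 4 * sin_half (k%:R * t) * sin_half (l%:R * t).
pose C1 := cos ((k%:R - l%:R) * (pi * t / 2)).
pose C2 := cos ((k + l)%:R * (pi * t / 2)) : R.
transitivity (int01 (fun y => S * C1 * cos ((k%:R - l%:R) * pi * y) +
    S * (e * C2) * cos ((k + l)%:R * pi * y))).
  by apply: eq_int01 => y _; rewrite -/S -/C1 -/C2; ring.
rewrite int01D; try by apply: integrable01Z; exact: integrable01_cosZ.
rewrite !int01Z; try exact: integrable01_cosZ.
rewrite int01_cos_natB int01_cos_nat.
have -> : S * (e * C2) * (k + l == 0)%N%:R = 0.
  rewrite addn_eq0; case: eqP => [k0|_]; last by rewrite mulr0.
  by rewrite /S k0 mul0r /sin_half mulr0 mul0r sin0 !(mulr0, mul0r).
rewrite addr0 /S /C1; have [->|_] := eqVneq k l; last by rewrite !mulr0.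
by rewrite subrr mul0r cos0 !mulr1 expr2 mulrA.
Qed.

Lemma int01_sym_diff2_cos (k l : nat) (t : R) :
  int01 (sym_diff2 (fun x => cos (k%:R * pi * x)) (fun x => cos (l%:R * pi * x)) t) =
  4 * sin_half (k%:R * t) ^+ 2 * (k == l)%:R.
Proof.
rewrite -(int01_sym_diff2_lincomb k l t (-1)); apply: eq_int01 => y _.
by rewrite sym_diff2_cos mulN1r.
Qed.

Lemma int01_sym_diff2_sin (k l : nat) (t : R) :
  int01 (sym_diff2 (fun x => sin (k%:R * pi * x)) (fun x => sin (l%:R * pi * x)) t) =
  4 * sin_half (k%:R * t) ^+ 2 * (k == l)%:R.
Proof.
rewrite -(int01_sym_diff2_lincomb k l t 1); apply: eq_int01 => y _.
by rewrite sym_diff2_sin mul1r.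
Qed.

Let sin_half_nat_le (k : nat) (x y : R) :
  `|sin (k%:R * (pi * (x - y) / 2))| <= k%:R * `|sin_half (x - y)|.
Proof. exact: sin_nat_le. Qed.

Lemma natpi_shift2 (k : nat) (x : R) : k%:R * pi * (x + 2) = k%:R * pi * x + pi *+ 2 *+ k.
Proof. by rewrite -(mulr_natl (pi *+ 2) k) mulr2n; ring. Qed.

Lemma sin_lipschitz_cos (k : nat) : sin_lipschitz (2 * k%:R) (fun x : R => cos (k%:R * pi * x)).
Proof.
split; first by rewrite mulr_ge0.
- exact: continuous_cosZ.
- by move=> x; rewrite natpi_shift2; exact: (periodicn (@cosD2pi R)).
- move=> x y; rewrite (_ : k%:R * pi * x = k%:R * pi * y + 2 * (k%:R * (pi * (x - y) / 2)));
    last by field.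
  rewrite cos_shift normrN !normrM [`|2|]ger0_norm// -[leRHS](mulrA 2) -[leRHS]mulr1.
  apply: ler_pM; rewrite ?mulr_ge0 ?sin_max//.
  by rewrite ler_pM2l//; exact: sin_half_nat_le.
Qed.

Lemma sin_lipschitz_sin (k : nat) : sin_lipschitz (2 * k%:R) (fun x : R => sin (k%:R * pi * x)).
Proof.
split; first by rewrite mulr_ge0.
- exact: continuous_sinZ.
- by move=> x; rewrite natpi_shift2; exact: (periodicn (@sinD2pi R)).
- move=> x y; rewrite (_ : k%:R * pi * x = k%:R * pi * y + 2 * (k%:R * (pi * (x - y) / 2)));
    last by field.
  rewrite sin_shift !normrM [`|2|]ger0_norm// -[leRHS](mulrA 2) -[leRHS]mulr1.
  apply: ler_pM; rewrite ?mulr_ge0 ?cos_max//.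
  by rewrite ler_pM2l//; exact: sin_half_nat_le.
Qed.

Lemma sin_lipschitz_sum (n : nat) (a : nat -> R) (e : nat -> R -> R) (C : nat -> R) :
  (forall k, sin_lipschitz (C k) (e k)) ->
  sin_lipschitz (\sum_(k < n) `|a k| * C k) (fun x => \sum_(k < n) a k * e k x).
Proof.
move=> H; elim: n => [|n [IH1 IH2 IH3 IH4]].
  rewrite big_ord0 (_ : (fun x => _) = fun=> 0); last by apply/funext => x; rewrite big_ord0.
  split=> //; first by move=> x; exact: cvg_cst.
  by move=> x y; rewrite subrr normr0 mul0r.
case: (H n) => h1 h2 h3 h4.
rewrite big_ord_recr (_ : (fun x => _) = fun x => (\sum_(k < n) a k * e k x) + a n * e n x);
    last first.
  by apply/funext => x; rewrite big_ord_recr.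
split.
- by rewrite addr_ge0 ?mulr_ge0.
- by move=> x; apply: cvgD; [exact: IH2 | apply: cvgM; [exact: cvg_cst | exact: h2]].
- by move=> x; rewrite IH3 h3.
- move=> x y; rewrite (_ : _ - _ = (\sum_(k < n) a k * e k x - \sum_(k < n) a k * e k y) +
    a n * (e n x - e n y)); last by ring.
  by rewrite (le_trans (ler_normD _ _))// mulrDl lerD// normrM -mulrA ler_wpM2l.
Qed.

Variable p : R.
Hypothesis p_gt0 : 0 < p.
Hypothesis ratio_neq0 : sin_ratio_int p != 0.

(** Stated for a family [e] so that it serves cosines, when [alpha < 1], and sines, which are the
    derivatives when [1 < alpha]. Writing [u (- x)] covers both parities: for odd functions the
    product of the reflected differences becomes the product of sums in [sob_B]. *)
Lemma double_int_diagonal (n : nat) (a b : nat -> R) (e : nat -> R -> R) (C : nat -> R) :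
  (forall k, sin_lipschitz (C k) (e k)) ->
  (forall k l t, int01 (sym_diff2 (e k) (e l) t) = 4 * sin_half (k%:R * t) ^+ 2 * (k == l)%:R) ->
  let u x := \sum_(k < n) a k * e k x in
  let v x := \sum_(k < n) b k * e k x in
  int01 (fun y => int01 (fun x =>
    (u x - u y) * (v x - v y) * sin_kernel p (x - y) +
    (u (- x) - u y) * (v (- x) - v y) * sin_kernel p (x + y))) =
  \sum_(k < n) 4 * (a k * b k) * sin_eigenvalue p k.
Proof.
move=> He Ie u v.
have lu := sin_lipschitz_sum n a He; have lv := sin_lipschitz_sum n b He.
rewrite (double_int_fold (sin_kernel_measurable p) (sin_kernel_ge0 p)
  (sin_kernel_periodic p) (sin_kernel_even p) (sin_kernel_integrable p_gt0 ratio_neq0) lu lv).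
have ic k l t : integrable01 (sym_diff2 (e k) (e l) t).
  apply/continuous_integrable01/continuous_subspaceT => y.
  have ce m : continuous (e m) by case: (He m).
  have cs m z : {for y, continuous (fun y => e m (y + z))}.
    by apply: continuous_comp; [apply: cvgD; [exact: cvg_id | exact: cvg_cst] | exact: ce].
  by apply: cvgD; apply: cvgM; apply: cvgB; try exact: cs; exact: ce.
have inner t : int01 (sym_diff2 u v t) = \sum_(k < n) 4 * (a k * b k) * sin_half (k%:R * t) ^+ 2.
  transitivity (int01 (fun y => \sum_(k < n) \sum_(l < n) (a k * b l) * sym_diff2 (e k) (e l) t y)).
    apply: eq_int01 => y _; rewrite /sym_diff2 /u /v -!sumrB.
    rewrite !big_distrlr /= -big_split /=; apply: eq_bigr => k _.
    by rewrite -big_split /=; apply: eq_bigr => l _; ring.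
  rewrite int01_sum; last by move=> k; apply: integrable01_sum => l; exact: integrable01Z.
  apply: eq_bigr => k _; rewrite int01_sum; last by move=> l; exact: integrable01Z.
  rewrite (bigD1 k)//= int01Z// Ie eqxx big1; first by rewrite (_ : true%:R = 1 :> R)//; ring.
  move=> l lk; rewrite int01Z// Ie (_ : (k == l :> nat) = false) ?mulr0//.
  by apply/eqP => kl; move/eqP: lk; apply; apply: val_inj.
transitivity (int01 (fun t => \sum_(k < n) 4 * (a k * b k) * (sin_kernel p t * sin_half (k%:R *
    t) ^+ 2))).
  by apply: eq_int01 => t _; rewrite inner mulr_sumr; apply: eq_bigr => k _; ring.
have ie := sin_eigenvalue_integrable p_gt0 ratio_neq0.
rewrite int01_sum; last by move=> k; apply: integrable01Z; exact: ie.
by apply: eq_bigr => k _; rewrite int01Z//; exact: ie.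
Qed.

End Diagonalisation.

Section CosinePolynomials.
Context {R : realType}.

Definition cos_poly (n : nat) (a : nat -> R) (x : R) : R := \sum_(k < n) a k * cos_basis k x.

Lemma buc01_cos_poly n a : buc01 (cos_poly n a).
Proof.
apply: buc_sum => [|k]; first exact: ltr_norm_mono.
by apply: bucZ; [exact: ltr_norm_mono | exact: buc01_cos_basis].
Qed.

Lemma cos_coef1_poly n a k : cos_coef1 k (cos_poly n a) = if (k < n)%N then a k else 0.
Proof.
have ib i j : integrable01 (fun y : R => cos_basis i y * cos_basis j y).
  by apply/buc01_integrable/bucM; try exact: buc01_cos_basis; exact: ltr_norm_mono.
transitivity (\sum_(i < n) a i * (i == k :> nat)%:R).
  transitivity (int01 (fun x => \sum_(i < n) a i * (cos_basis i x * cos_basis k x))).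
    by apply: eq_int01 => x _; rewrite mulr_suml; apply: eq_bigr => i _; rewrite mulrA.
  rewrite int01_sum; last by move=> i; exact: integrable01Z.
  by apply: eq_bigr => i _; rewrite int01Z// int01_cos_basis2.
case: ifP => kn.
  rewrite (bigD1 (Ordinal kn))//= eqxx mulr1 big1 ?addr0// => i ik.
  rewrite (_ : (i == k :> nat) = false) ?mulr0//.
  by apply/eqP => ik'; move/eqP: ik; apply; exact: val_inj.
rewrite big1// => i _; rewrite (_ : (i == k :> nat) = false) ?mulr0//.
by apply/eqP => ik; have := ltn_ord i; rewrite ik kn.
Qed.

Lemma PcosP (f : R -> R) : Pcos f -> exists n, forall N, (n <= N)%N ->
  f = cos_poly N (fun k => cos_coef1 k f).
Proof.
move=> [n [c fE]]; exists n => N nN; apply/funext => x.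
have {fE} -> : f = cos_poly n c by [].
rewrite /cos_poly -[N](subnKC nN) big_split_ord /= [X in _ = _ + X]big1 ?addr0.
  by apply: eq_bigr => i _; rewrite cos_coef1_poly ltn_ord.
by move=> i _; rewrite cos_coef1_poly ltnNge leq_addr mul0r.
Qed.

(** Two cosine polynomials have a common degree, beyond which the spectral sums no longer change; so
    Bessel's inequality and the convergence reduce to finite sums. *)
Lemma spectral1_Pcos (wt : nat -> R) (B : (R -> R) -> (R -> R) -> R) :
  (forall k, 0 <= wt k) ->
  (forall n a b, B (cos_poly n a) (cos_poly n b) = \sum_(k < n) wt k * (a k * b k)) ->
  spectral1 wt (IpSpace (@Pcos R) B).
Proof.
move=> wt0 HB.
have bufP (f : R -> R) : Pcos f -> buc01 f.
  by move=> Pf; case: (PcosP Pf) => n /(_ n (leqnn n)) ->; exact: buc01_cos_poly.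
have E (f g : R -> R) : Pcos f -> Pcos g -> exists n, forall N, (n <= N)%N ->
    B f g = \sum_(k < N) wt k * (cos_coef1 k f * cos_coef1 k g).
  move=> Pf Pg; case: (PcosP Pf) => n Hn; case: (PcosP Pg) => m Hm; exists (n + m)%N => N nN.
  have := HB N (fun k => cos_coef1 k f) (fun k => cos_coef1 k g).
  rewrite -Hn; last exact: leq_trans (leq_addr _ _) nN.
  by rewrite -Hm//; exact: leq_trans (leq_addl _ _) nN.
split.
- exact: bufP.
- move=> f g /= Pf Pg; case: (PcosP Pf) => n Hn; case: (PcosP Pg) => m Hm.
  exists (n + m)%N, (fun k => cos_coef1 k f - cos_coef1 k g).
  rewrite {1}(Hn (n + m)%N) ?leq_addr// {1}(Hm (n + m)%N) ?leq_addl//.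
  by apply/funext => x /=; rewrite /cos_poly -sumrB; apply: eq_bigr => k _; rewrite mulrBl.
- move=> K f /= Pf; have [n Hn] := E f f Pf Pf.
  rewrite (Hn (K + n)%N) ?leq_addl// big_split_ord /=.
  rewrite /spectral_norm2 (eq_bigr (fun i : 'I_K => wt i * (cos_coef1 i f * cos_coef1 i f))).
    by rewrite lerDl sumr_ge0// => i _; rewrite mulr_ge0// -expr2 sqr_ge0.
  by move=> i _; rewrite expr2.
- move=> f g /= Pf Pg; have [n Hn] := E f g Pf Pg.
  apply/seq_cvgP => e e0; exists n => N nN.
  by rewrite (Hn N nN) subrr normr0 ltW.
Qed.

Lemma int01_cos_poly n a : int01 (cos_poly n a) = if (0 < n)%N then a 0%N else 0.
Proof. by rewrite -cos_coef1_poly; apply: eq_int01 => x _; rewrite mulr1. Qed.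

Lemma int01_cos_polyM n a b : int01 (cos_poly n a) * int01 (cos_poly n b) =
  \sum_(k < n) (k == 0 :> nat)%:R * (a k * b k).
Proof.
rewrite !int01_cos_poly; case: n => [|n] /=; first by rewrite mul0r big_ord0.
by rewrite big_ord_recl /= mul1r big1 ?addr0// => k _; rewrite mul0r.
Qed.

Lemma cos_polyE n a : cos_poly n a =
  fun x => \sum_(k < n) (a k * cos_scale k) * cos (k%:R * pi * x).
Proof.
by apply/funext => x; apply: eq_bigr => k _; rewrite cos_basisE mulrA.
Qed.

Lemma derive1_cos_poly n a : derive1 (cos_poly n a) =
  fun x => \sum_(k < n) - (a k * cos_scale k * (k%:R * pi)) * sin (k%:R * pi * x).
Proof.
apply/funext => x; rewrite cos_polyE derive1E.
suff H : is_derive x 1 (fun x => \sum_(k < n) (a k * cos_scale k) * cos (k%:R * pi * x))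
    (\sum_(k < n) - (a k * cos_scale k * (k%:R * pi)) * sin (k%:R * pi * x)).
  exact: derive_val.
elim: n => [|n IH].
  rewrite big_ord0 (_ : (fun x => _) = fun=> 0); first exact: is_derive_cst.
  by apply/funext => y; rewrite big_ord0.
rewrite big_ord_recr (_ : (fun x => _) = (fun x => \sum_(k < n) (a k * cos_scale k) * cos (k%:R
    * pi * x)) +
  (fun x => a n * cos_scale n * cos (n%:R * pi * x))); last first.
  by apply/funext => y; rewrite big_ord_recr.
apply: is_deriveD.
have := is_derive_cosZ (n%:R * pi) x => h.
have -> : - (a n * cos_scale n * (n%:R * pi)) * sin (n%:R * pi * x) =
  (a n * cos_scale n) *: (- (n%:R * pi * sin (n%:R * pi * x))) by rewrite /GRing.scale /=; ring.
exact: is_deriveZ.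
Qed.

(** The lower bound turns the unit ball of the norm into a weighted l2 ball: its left side is the
    square of the weight [freq_weight] at [gamma / sqrt kappa]. *)
Definition spectral_weight (alpha gamma : R) (wt : nat -> R) : Prop :=
  [/\ forall k, 0 <= wt k, wt 0%N = 1 &
      forall k, (0 < k)%N -> kappa alpha * k%:R `^ (2 * alpha) / gamma ^+ 2 <= wt k].

Lemma spectral_sob_lt1 (alpha gamma : R) : 1 / 2 < alpha < 1 -> 0 < gamma -> 0 < kappa alpha ->
  exists2 wt, spectral_weight alpha gamma wt & spectral1 wt (sob1 alpha gamma).
Proof.
move=> /andP[a2 a1] g0 k0; pose p := 2 * alpha + 1.
have kE : kappa alpha = 2 * (1 - alpha) * pi `^ (2 - 2 * alpha) * sin_ratio_int p.
  by rewrite /kappa a1.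
rewrite kE in k0; rewrite /sob1 a1.
have pip := pi_gt0 R; have p0 : 0 < p by rewrite /p; lra.
have rn0 : sin_ratio_int p != 0.
  by apply: contraTneq k0 => ->; rewrite mulr0 ltxx.
pose C := gamma ^- 2 * ((1 - alpha) * pi ^+ 3 / 8).
have C0 : 0 <= C.
  apply: mulr_ge0; first by rewrite invr_ge0 exprn_ge0// ltW.
  by rewrite divr_ge0// mulr_ge0 ?exprn_ge0 ?(ltW pip)// subr_ge0 ltW.
(* The indicator is the product of the means; 4 comes from [double_int_diagonal] and
   [cos_scale k ^+ 2] from the normalisation of the basis. *)
pose wt (k : nat) : R := (k == 0%N)%:R + C * (4 * cos_scale k ^+ 2 * sin_eigenvalue p k).
have wt0 k : 0 <= wt k.
  apply: addr_ge0 => //; apply: mulr_ge0 => //; apply: mulr_ge0; last exact: sin_eigenvalue_ge0.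
  by apply: mulr_ge0 => //; exact: sqr_ge0.
exists wt.
  split=> //; first by rewrite /wt eqxx sin_eigenvalue0 !mulr0 addr0.
  move=> k kp; have kr : 0 < k%:R :> R by rewrite ltr0n.
  rewrite kE /wt eqn0Ngt kp add0r cos_scale_sqr eqn0Ngt kp /=.
  have := sin_eigenvalue_ge p0 rn0 kp; rewrite -/p (_ : p - 1 = 2 * alpha); last by rewrite /p;
      ring.
  move=> H; apply: (@le_trans _ _ (C * (4 * 2 * (2 * k%:R `^ (2 * alpha) * pi `^ (- p) *
      sin_ratio_int p)))).
    rewrite le_eqVlt; apply/orP; left; apply/eqP.
    (* With [p = 2 alpha + 1] the factors [(1 - alpha) pi^3 / 8], 8 and 2 multiply to the prefactor
       of [kappa], which is thus exactly the constant of this lower bound. *)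
    rewrite (_ : pi `^ (2 - 2 * alpha) = pi ^+ 3 * pi `^ (- p)); last first.
      rewrite -(powR_mulrn 3 (ltW pip)) -powRD ?(gt_eqF pip) ?implybT//.
      by congr (_ `^ _); rewrite /p; ring.
    by rewrite /C; field; rewrite gt_eqF.
  by rewrite ler_wpM2l// ler_pM2l.
apply: spectral1_completion => //; apply: spectral1_Pcos => // n a b.
rewrite /sob_ip_lt1 int01_cos_polyM.
have ev m (c : nat -> R) (x : R) : cos_poly m c (- x) = cos_poly m c x.
  by rewrite cos_polyE; apply: eq_bigr => k _; rewrite mulrN cosN.
have -> : int01 (fun y => int01 (fun x =>
    (cos_poly n a x - cos_poly n a y) * (cos_poly n b x - cos_poly n b y) *
    ((sin_minus x y `^ (2 * alpha + 1))^-1 + (sin_plus x y `^ (2 * alpha + 1))^-1))) =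
   \sum_(k < n) 4 * (a k * cos_scale k * (b k * cos_scale k)) * sin_eigenvalue p k.
  have D := double_int_diagonal p0 rn0 n (fun k => a k * cos_scale k)
    (fun k => b k * cos_scale k) sin_lipschitz_cos int01_sym_diff2_cos.
  apply: etrans _ D; apply: eq_int01 => y _; apply: eq_int01 => x _ /=.
  have pE m (c : nat -> R) (z : R) : \sum_(k < m) c k * cos_scale k * cos (k%:R * pi * z) =
      cos_poly m c z.
    by rewrite cos_polyE.
  by rewrite !(pE n a) !(pE n b) !ev -mulrDr.
rewrite mulr_sumr -big_split /=; apply: eq_bigr => k _.
by rewrite /wt /C; ring.
Qed.

Lemma spectral_sob_gt1 (alpha gamma : R) : 1 < alpha < 2 -> 0 < gamma -> 0 < kappa alpha ->
  exists2 wt, spectral_weight alpha gamma wt & spectral1 wt (sob1 alpha gamma).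
Proof.
move=> /andP[a1 a2] g0 k0; pose p := 2 * alpha - 1.
have kE : kappa alpha = 2 * (alpha - 1) * (2 - alpha) * pi `^ (6 - 2 * alpha) * sin_ratio_int p.
  by rewrite /kappa ltNge (ltW a1) (gt_eqF a1).
rewrite kE in k0; rewrite /sob1 ltNge (ltW a1) (gt_eqF a1) /=.
have pip := pi_gt0 R; have p0 : 0 < p by rewrite /p; lra.
have rn0 : sin_ratio_int p != 0.
  by apply: contraTneq k0 => ->; rewrite mulr0 ltxx.
pose C := (alpha - 1) * (2 - alpha) * pi ^+ 3 / 8.
have C0 : 0 <= C.
  by rewrite divr_ge0// !mulr_ge0 ?exprn_ge0 ?(ltW pip)// subr_ge0 ltW.
have g2 : 0 <= gamma ^- 2 by rewrite invr_ge0 exprn_ge0// ltW.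
(* Up to sign, differentiation multiplies the coefficient [k] by [cos_scale k * (k pi)]; [2^-1] is
   the integral of the squared sine, from the [f' g'] term, and is dropped in the lower bound. *)
pose wt (k : nat) : R := (k == 0%N)%:R +
  gamma ^- 2 * ((cos_scale k * (k%:R * pi)) ^+ 2 * (2^-1 + C * (4 * sin_eigenvalue p k))).
have e0 k : 0 <= sin_eigenvalue p k by exact: sin_eigenvalue_ge0.
have wt0 k : 0 <= wt k.
  apply: addr_ge0 => //; apply: mulr_ge0 => //; apply: mulr_ge0; first exact: sqr_ge0.
  by apply: addr_ge0; rewrite ?invr_ge0//; apply: mulr_ge0 => //; exact: mulr_ge0.
exists wt.
  split=> //; first by rewrite /wt eqxx mul0r mulr0 expr0n /= mul0r mulr0 addr0.
  move=> k kp; have kr : 0 < k%:R :> R by rewrite ltr0n.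
  rewrite kE /wt eqn0Ngt kp add0r exprMn cos_scale_sqr eqn0Ngt kp /=.
  have := sin_eigenvalue_ge p0 rn0 kp; rewrite -/p => H.
  apply: (@le_trans _ _ (gamma ^- 2 * (2 * (k%:R * pi) ^+ 2 *
    (C * (4 * (2 * k%:R `^ (p - 1) * pi `^ (- p) * sin_ratio_int p)))))).
    rewrite le_eqVlt; apply/orP; left; apply/eqP.
    rewrite (_ : pi `^ (6 - 2 * alpha) = pi ^+ 5 * pi `^ (- p)); last first.
      rewrite -(powR_mulrn 5 (ltW pip)) -powRD ?(gt_eqF pip) ?implybT//.
      by congr (_ `^ _); rewrite /p; ring.
    rewrite (_ : k%:R `^ (2 * alpha) = k%:R ^+ 2 * k%:R `^ (p - 1)); last first.
      rewrite -(powR_mulrn 2 (ltW kr)) -powRD ?(gt_eqF kr) ?implybT//.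
      by congr (_ `^ _); rewrite /p; ring.
    by rewrite /C -/p; field; rewrite gt_eqF.
  rewrite ler_wpM2l//; apply: ler_wpM2l.
    by apply: mulr_ge0 => //; exact: sqr_ge0.
  apply: (@le_trans _ _ (C * (4 * sin_eigenvalue p k))); last by rewrite lerDr invr_ge0.
  by rewrite ler_wpM2l// ler_pM2l.
apply: spectral1_completion => //; apply: spectral1_Pcos => // n a b.
rewrite /sob_ip_gt1 int01_cos_polyM /sob_B -/C !derive1_cos_poly.
set a' := fun k : nat => - (a k * cos_scale k * (k%:R * pi)).
set b' := fun k : nat => - (b k * cos_scale k * (k%:R * pi)).
set u := fun x : R => \sum_(k < n) a' k * sin (k%:R * pi * x).
set v := fun x : R => \sum_(k < n) b' k * sin (k%:R * pi * x).
(* Derivatives of cosine polynomials are odd, so the reflected differences are minus the sums in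
   [sob_B], and the two signs cancel. *)
have odd (c : nat -> R) (x : R) : \sum_(k < n) c k * sin (k%:R * pi * - x) = - (\sum_(k < n) c
    k * sin (k%:R * pi * x)).
  by rewrite -sumrN; apply: eq_bigr => k _; rewrite mulrN sinN mulrN.
have -> : int01 (fun y => int01 (fun x =>
    (u x - u y) * (v x - v y) / (sin_minus x y `^ (2 * alpha - 1)) +
    (u x + u y) * (v x + v y) / (sin_plus x y `^ (2 * alpha - 1)))) =
   \sum_(k < n) 4 * (a' k * b' k) * sin_eigenvalue p k.
  have D := double_int_diagonal p0 rn0 n a' b' sin_lipschitz_sin int01_sym_diff2_sin.
  apply: etrans _ D; apply: eq_int01 => y _; apply: eq_int01 => x _ /=; rewrite !odd -/(u _)
      -/(v _).
  congr (_ + _ * _); rewrite /u /v; ring.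
have -> : int01 (fun x => u x * v x) = \sum_(k < n) a' k * b' k / 2.
  have ib i j : integrable01 (fun y : R => sin (i%:R * pi * y) * sin (j%:R * pi * y)).
    by apply/buc01_integrable/bucM; try exact: buc01_sinZ; exact: ltr_norm_mono.
  transitivity (int01 (fun x => \sum_(i < n) \sum_(j < n)
      (a' i * b' j) * (sin (i%:R * pi * x) * sin (j%:R * pi * x)))).
    apply: eq_int01 => x _; rewrite big_distrlr; apply: eq_bigr => i _.
    by apply: eq_bigr => j _; rewrite mulrACA.
  rewrite int01_sum; last by move=> i; apply: integrable01_sum => j; exact: integrable01Z.
  apply: eq_bigr => i _; rewrite int01_sum; last by move=> j; exact: integrable01Z.
  rewrite (bigD1 i)//= int01Z// int01_sinsin eqxx big1; last first.
    move=> j ji; rewrite int01Z// int01_sinsin (_ : (i == j :> nat) = false).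
      rewrite addn_eq0; case: eqP => [i0|_]; last by rewrite subr0 mul0r mulr0.
      by rewrite /a' i0 mul0r mulr0 oppr0 !mul0r.
    by apply/eqP => ij; move/eqP: ji; apply; apply: val_inj.
  rewrite addn_eq0 andbb; case: eqP => [i0|_]; last by rewrite subr0 addr0 mulrA mulr1.
  by rewrite /a' i0 mul0r mulr0 oppr0 !mul0r addr0.
rewrite !mulr_sumr -big_split /= mulr_sumr -big_split /=; apply: eq_bigr => k _.
by rewrite /wt /a' /b'; field; rewrite gt_eqF.
Qed.

End CosinePolynomials.

(** * Parseval's identity for sine series of square-integrable functions *)

Section SquareIntegrable.
Context {R : realType}.
Local Notation mu := (@lebesgue_measure R).
Implicit Types f g h : R -> R.

Definition measurable01 f : Prop := measurable_fun unit_interval f.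

Lemma integrable01_meas f : integrable01 f -> measurable01 f.
Proof. by move=> /integrableP[mf _]; exact/measurable_EFinP. Qed.

Lemma measurable01_EFin f : measurable01 f ->
  measurable_fun (unit_interval : set (measurableTypeR R)) (EFin \o f).
Proof.
move=> mf; apply/measurable_EFinP.
exact mf.
Qed.

Lemma le_integrable01 f g : measurable01 f -> integrable01 g ->
  (forall x, 0 <= x <= 1 -> `|f x| <= g x) -> integrable01 f.
Proof.
move=> mf gi fg; apply: (le_integrable measurable_unit_interval _ _ gi).
  exact/measurable_EFinP.
by move=> x /unit_interval_le x01 /=; rewrite lee_fin (le_trans (fg _ x01))// ler_norm.
Qed.

(** Pointwise convergence is asked for only in the open interval: the cut-offs and quotients used
    below may fail to converge at the endpoints, a null set. *)
Lemma int01_dominated (f_ : nat -> R -> R) f g : (forall n, measurable01 (f_ n)) ->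
  measurable01 f -> integrable01 g ->
  (forall n x, 0 <= x <= 1 -> `|f_ n x| <= g x) ->
  (forall x, 0 < x < 1 -> (fun n => f_ n x) @ \oo --> f x) ->
  (fun n => int01 (f_ n)) @ \oo --> int01 f.
Proof.
move=> mf_ mf gi fg cv.
have m_ n : measurable_fun (unit_interval : set (measurableTypeR R)) (fun x => (f_ n x)%:E).
  exact: measurable01_EFin (mf_ n).
have m : measurable_fun (unit_interval : set (measurableTypeR R)) (fun x => (f x)%:E).
  exact: measurable01_EFin mf.
have ae_cvg : {ae mu, forall x, unit_interval x -> (fun n => (f_ n x)%:E) @ \oo --> (f x)%:E}.
  exists [set 0; 1]; split.
  + by apply: measurableU; exact: measurable_set1.
  + by apply: countable_lebesgue_measure0; exact: finite_set_countable.
  + move=> x /= /not_implyP[/unit_interval_le /andP[x0 x1] ncv].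
    move: x0; rewrite le_eqVlt => /orP[/eqP <-|x0]; first by left.
    move: x1; rewrite le_eqVlt => /orP[/eqP ->|x1]; first by right.
    exfalso; apply: ncv; apply: cvg_EFin; first exact: nearW.
    by apply: cv; rewrite x0 x1.
have ae_le : {ae mu, forall x n, unit_interval x -> (`|(f_ n x)%:E| <= (g x)%:E)%E}.
  by apply: aeW => x n /unit_interval_le x01; rewrite lee_fin fg.
have [fi _ lim] := dominated_convergence measurable_unit_interval m_ m ae_cvg gi ae_le.
rewrite /int01 /Rintegral.
have finf := integrable_fin_num measurable_unit_interval fi.
by apply: fine_cvg; rewrite fineK.
Qed.

Lemma sqintM f g : square_integrable01 f -> square_integrable01 g ->
  integrable01 (fun x => f x * g x).
Proof.
move=> [mf fi] [mg gi].
apply: (le_integrable01 (g := fun x => f x ^+ 2 + g x ^+ 2)).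
- exact: measurable_funM.
- exact: integrable01D.
- move=> x _; rewrite normrM -[f x ^+ 2]real_normK ?num_real// -[g x ^+ 2]real_normK ?num_real//.
  have := sqr_ge0 (`|f x| - `|g x|); have := normr_ge0 (f x); have := normr_ge0 (g x); nra.
Qed.

Lemma sqintD f g : square_integrable01 f -> square_integrable01 g ->
  square_integrable01 (fun x => f x + g x).
Proof.
move=> sf sg; have fg := sqintM sf sg; case: sf => mf fi; case: sg => mg gi.
split; first exact: measurable_funD.
rewrite (_ : (fun x => _) = fun x => ((f x ^+ 2 + g x ^+ 2) + 2 * (f x * g x))%:E).
  by apply: integrable01D; [exact: integrable01D | exact: integrable01Z].
by apply/funext => x; congr (_%:E); ring.
Qed.

Lemma sqintZ c f : square_integrable01 f -> square_integrable01 (fun x => c * f x).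
Proof.
move=> [mf fi]; split; first by apply: measurable_funM => //; exact: measurable_cst.
rewrite (_ : (fun x => _) = fun x => (c ^+ 2 * (f x ^+ 2))%:E).
  exact: integrable01Z.
by apply/funext => x; congr (_%:E); ring.
Qed.

Lemma sqintB f g : square_integrable01 f -> square_integrable01 g ->
  square_integrable01 (fun x => f x - g x).
Proof.
move=> sf sg; have := sqintD sf (sqintZ (-1) sg).
by congr square_integrable01; apply/funext => x; rewrite mulN1r.
Qed.

Lemma sqint_continuous f : {within unit_interval, continuous f} -> square_integrable01 f.
Proof.
move=> cf; split; first exact: integrable01_meas (continuous_integrable01 cf).
apply: continuous_integrable01 => x; apply: cvgM; exact: cf.
Qed.

Lemma sqint_buc01 f : buc01 f -> square_integrable01 f.
Proof. by move=> bf; apply: sqint_continuous; exact: buc01_continuous. Qed.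

Lemma sqint_sum (I : Type) (r : seq I) (F : I -> R -> R) :
  (forall i, square_integrable01 (F i)) ->
  square_integrable01 (fun x => \sum_(i <- r) F i x).
Proof.
move=> H; elim: r => [|i r IH].
  rewrite (_ : (fun x => _) = fun=> 0); first exact/sqint_buc01/buc_cst.
  by apply/funext => x; rewrite big_nil.
rewrite (_ : (fun x => _) = fun x => F i x + \sum_(i <- r) F i x).
  exact: sqintD.
by apply/funext => x; rewrite big_cons.
Qed.

Lemma sqint_integrable f : square_integrable01 f -> integrable01 f.
Proof.
move=> sf; have := sqintM sf (sqint_buc01 (buc_cst _ _ 1)).
by congr integrable01; apply/funext => x; rewrite mulr1.
Qed.

Definition norm2 f : R := int01 (fun x => f x ^+ 2).

Lemma norm2_ge0 f : 0 <= norm2 f.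
Proof. by apply: int01_ge0 => x _; exact: sqr_ge0. Qed.

Lemma norm2D_le f g : square_integrable01 f -> square_integrable01 g ->
  norm2 (fun x => f x + g x) <= 2 * norm2 f + 2 * norm2 g.
Proof.
move=> sf sg; have [_ fgi] := sqintD sf sg; have [mf fi] := sf; have [mg gi] := sg.
rewrite /norm2 -!int01Z// -int01D; try exact: integrable01Z.
apply: le_int01 => //; first by apply: integrable01D; exact: integrable01Z.
by move=> x _; have := sqr_ge0 (f x - g x); nra.
Qed.

End SquareIntegrable.

Section SineDensity.
Context {R : realType}.
Local Notation mu := (@lebesgue_measure R).
Implicit Types f g h : R -> R.

Lemma continuous_buc01 f : {within unit_interval, continuous f} -> buc01 f.
Proof.
move=> cf.
have cpt : compact (unit_interval : set R) by exact: segment_compact.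
have loc x e : unit_interval x -> 0 < e -> exists2 dl, 0 < dl &
    forall y, unit_interval y -> `|x - y| < dl -> `|f x - f y| <= e.
  move=> Dx e0.
  have /subspace_continuousP/(_ x Dx)/cvgrPdist_le/(_ e e0) := cf.
  rewrite /= => /nbhs_ballP[dl /= dl0 H]; exists dl => // y Dy xy.
  exact: H.
have unif e : 0 < e -> exists2 dl, 0 < dl & forall x y, unit_interval x ->
    unit_interval y -> `|x - y| < dl -> `|f x - f y| <= e.
  move=> e0; have e2 : 0 < e / 2 by rewrite divr_gt0.
  have /compact_near_coveringP/(_ R (0 : R)^'+ (fun dl x => unit_interval x ->
    forall y, unit_interval y -> `|x - y| < dl -> `|f x - f y| <= e)) := cpt.
  move=> /(_ _)[].
    move=> x Dx; have [dl dl0 Hd] := loc x _ Dx e2.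
    have dl2 : 0 < dl / 2 by rewrite divr_gt0.
    exists (ball x (dl / 2), [set t | t <= dl / 2]).
      split; first exact: nbhsx_ballx.
      exact: nbhs_right_le.
    move=> [x' t] [/= xx' tdl] Dx' y Dy x'y.
    have h1 : `|f x - f x'| <= e / 2.
      by apply: Hd => //; apply: lt_le_trans xx' _; rewrite ler_pdivrMr// ler_pMr// ler1n.
    have h2 : `|f x - f y| <= e / 2.
      apply: Hd => //; rewrite (_ : x - y = (x - x') + (x' - y)); last by ring.
      rewrite [ltRHS]splitr (le_lt_trans (ler_normD _ _))// ltrD//.
      exact: lt_le_trans x'y tdl.
    rewrite (_ : f x' - f y = (f x - f y) - (f x - f x')); last by ring.
    by rewrite [leRHS]splitr (le_trans (ler_normB _ _))// lerD.
  move=> dl /= dl0 H.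
  exists (dl / 2); first by rewrite divr_gt0.
  move=> x y Dx Dy xy; apply: (H (dl / 2)) => //=; last by rewrite divr_gt0.
  rewrite sub0r normrN gtr0_norm ?divr_gt0//.
  by rewrite ltr_pdivrMr// ltr_pMr// ltr1n.
split; last exact: unif.
have [M [_ HM]] := compact_bounded (continuous_compact cf cpt).
exists (M + 1) => x Dx; apply: HM; first by rewrite ltrDl.
by exists x.
Qed.

Definition sin_coef (k : nat) (g : R -> R) : R := int01 (fun x => g x * sin (k%:R * pi * x)).

Definition sin_proj (K : nat) (g : R -> R) (x : R) : R :=
  \sum_(k < K) 2 * sin_coef k g * sin (k%:R * pi * x).

Lemma sqint_sin k : square_integrable01 (fun x : R => sin (k%:R * pi * x)).
Proof. exact/sqint_buc01/buc01_sinZ. Qed.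

Lemma integrable_sin g k : square_integrable01 g ->
  integrable01 (fun x => g x * sin (k%:R * pi * x)).
Proof. by move=> sg; apply: sqintM => //; exact: sqint_sin. Qed.

Lemma sin_coefB k f g : square_integrable01 f -> square_integrable01 g ->
  sin_coef k (fun x => f x - g x) = sin_coef k f - sin_coef k g.
Proof.
move=> sf sg; rewrite /sin_coef -int01B; try exact: integrable_sin.
by apply: eq_int01 => x _; rewrite mulrBl.
Qed.

Lemma sin_coefD k f g : square_integrable01 f -> square_integrable01 g ->
  sin_coef k (fun x => f x + g x) = sin_coef k f + sin_coef k g.
Proof.
move=> sf sg; rewrite /sin_coef -int01D; try exact: integrable_sin.
by apply: eq_int01 => x _; rewrite mulrDl.
Qed.

Lemma sin_coef0 g : sin_coef 0 g = 0.
Proof.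
by rewrite -(@int01_cst R 0); apply: eq_int01 => x _; rewrite !mul0r sin0 mulr0.
Qed.

Lemma sqint_sin_proj K g : square_integrable01 (sin_proj K g).
Proof. by apply: sqint_sum => k; apply: sqintZ; exact: sqint_sin. Qed.

Lemma norm2_sin_projB K g : square_integrable01 g ->
  norm2 (fun x => g x - sin_proj K g x) = norm2 g - \sum_(k < K) 2 * sin_coef k g ^+ 2.
Proof.
move=> sg; have sT := sqint_sin_proj K g; have [mg gi] := sg; have [mT Ti] := sT.
have gT : int01 (fun x => g x * sin_proj K g x) = \sum_(k < K) 2 * sin_coef k g ^+ 2.
  transitivity (int01 (fun x => \sum_(k < K) (2 * sin_coef k g) * (g x * sin (k%:R * pi * x)))).
    by apply: eq_int01 => x _; rewrite mulr_sumr; apply: eq_bigr => k _; ring.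
  rewrite int01_sum; last by move=> k; apply: integrable01Z; exact: integrable_sin.
  by apply: eq_bigr => k _; rewrite int01Z ?expr2 ?mulrA//; exact: integrable_sin.
have TT : norm2 (sin_proj K g) = \sum_(k < K) 2 * sin_coef k g ^+ 2.
  have ib i j : integrable01 (fun y : R => sin (i%:R * pi * y) * sin (j%:R * pi * y)).
    by apply: integrable_sin; exact: sqint_sin.
  transitivity (int01 (fun x => \sum_(i < K) \sum_(j < K)
      (2 * sin_coef i g * (2 * sin_coef j g)) * (sin (i%:R * pi * x) * sin (j%:R * pi * x)))).
    apply: eq_int01 => x _; rewrite expr2 big_distrlr; apply: eq_bigr => i _.
    by apply: eq_bigr => j _; rewrite mulrACA.
  rewrite int01_sum; last by move=> i; apply: integrable01_sum => j; exact: integrable01Z.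
  apply: eq_bigr => i _; rewrite int01_sum; last by move=> j; exact: integrable01Z.
  rewrite (bigD1 i)//= int01Z// int01_sinsin eqxx big1; last first.
    move=> j ji; rewrite int01Z// int01_sinsin (_ : (i == j :> nat) = false).
      rewrite addn_eq0; case: eqP => [i0|_]; last by rewrite subr0 mul0r mulr0.
      by rewrite i0 sin_coef0 !(mulr0, mul0r).
    by apply/eqP => ij; move/eqP: ji; apply; apply: val_inj.
  rewrite addn_eq0 andbb; case: eqP => [i0|_]; last by rewrite subr0 addr0 /= mulr1n; field.
  by rewrite i0 sin_coef0 expr0n /= !(mulr0, mul0r) addr0.
transitivity (int01 (fun x => (g x ^+ 2 - 2 * (g x * sin_proj K g x)) + sin_proj K g x ^+ 2)).
  by apply: eq_int01 => x _; ring.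
have igT := sqintM sg sT.
rewrite int01D//; last first.
  have := integrable01D gi (integrable01Z (-2) igT).
  by congr integrable01; apply/funext => x; rewrite mulNr.
rewrite int01B//; last exact: integrable01Z.
rewrite int01Z// gT -/(norm2 _) -/(norm2 _) TT; ring.
Qed.

Lemma bessel_sin K g : square_integrable01 g -> \sum_(k < K) 2 * sin_coef k g ^+ 2 <= norm2 g.
Proof. by move=> sg; rewrite -subr_ge0 -norm2_sin_projB// norm2_ge0. Qed.

(** The projection reproduces the sine polynomial [S], so [g] and [g - S] have the same distance to
    their projections, and for [g - S] this distance is at most the norm. *)
Lemma sin_proj_le (I : finType) (c : I -> R) (m : I -> nat) K g :
  (forall i, (m i < K)%N) -> square_integrable01 g ->
  norm2 g - \sum_(k < K) 2 * sin_coef k g ^+ 2 <=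
  norm2 (fun x => g x - \sum_i c i * sin ((m i)%:R * pi * x)).
Proof.
move=> mK sg; set S := fun x => \sum_i c i * sin ((m i)%:R * pi * x).
have sS : square_integrable01 S by apply: sqint_sum => i; apply: sqintZ; exact: sqint_sin.
have sgS := sqintB sg sS.
have projS x : sin_proj K S x = S x.
  have coefS k : sin_coef k S = \sum_i c i * (((m i == k)%:R - (m i + k == 0)%N%:R) / 2).
    transitivity (int01 (fun x => \sum_i c i * (sin ((m i)%:R * pi * x) * sin (k%:R * pi * x)))).
      by apply: eq_int01 => y _; rewrite mulr_suml; apply: eq_bigr => i _; rewrite mulrA.
    rewrite int01_sum; last by move=> i; apply: integrable01Z; apply: integrable_sin; exact:
        sqint_sin.
    apply: eq_bigr => i _; rewrite int01Z ?int01_sinsin//.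
    by apply: integrable_sin; exact: sqint_sin.
  rewrite /sin_proj.
  transitivity (\sum_(k < K) \sum_i c i * ((m i == k)%:R - (m i + k == 0)%N%:R) * sin (k%:R *
      pi * x)).
    apply: eq_bigr => k _; rewrite coefS mulr_sumr mulr_suml; apply: eq_bigr => i _.
    by field.
  rewrite exchange_big; apply: eq_bigr => i _ /=.
  rewrite (bigD1 (Ordinal (mK i)))//= eqxx big1 ?addr0.
    rewrite addn_eq0 andbb; case: eqP => [->|_]; last by rewrite subr0 mulr1.
    by rewrite !mul0r sin0 !mulr0.
  move=> k ki; rewrite (_ : (m i == k) = false).
    rewrite addn_eq0; case: eqP => [_|_] /=; last by rewrite subr0 mulr0 mul0r.
    case: eqP => [->|_]; last by rewrite subr0 mulr0 mul0r.
    by rewrite !mul0r sin0 mulr0.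
  by apply/eqP => ik; move/eqP: ki; apply; apply: val_inj.
rewrite -norm2_sin_projB//.
have -> : norm2 (fun x => g x - sin_proj K g x) =
    norm2 (fun x => (g x - S x) - sin_proj K (fun x => g x - S x) x).
  apply: eq_int01 => x _; congr (_ ^+ 2).
  have -> : sin_proj K (fun x => g x - S x) x = sin_proj K g x - sin_proj K S x.
    rewrite /sin_proj -sumrB; apply: eq_bigr => k _; rewrite sin_coefB//; ring.
  by rewrite projS; ring.
rewrite norm2_sin_projB// gerBl; apply: sumr_ge0 => k _.
by apply: mulr_ge0 => //; exact: sqr_ge0.
Qed.

Definition sin_dense g : Prop := forall e, 0 < e ->
  exists (I : finType) (c : I -> R) (m : I -> nat),
    norm2 (fun x => g x - \sum_i c i * sin ((m i)%:R * pi * x)) <= e.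

Lemma sin_dense_closed g : square_integrable01 g ->
  (forall e, 0 < e -> exists h, [/\ square_integrable01 h, sin_dense h &
     norm2 (fun x => g x - h x) <= e]) -> sin_dense g.
Proof.
move=> sg H e e0; have e4 : 0 < e / 4 by rewrite divr_gt0.
have [h [sh dh gh]] := H _ e4; have [I [c [m hS]]] := dh _ e4.
exists I, c, m; pose S x := \sum_i c i * sin ((m i)%:R * pi * x).
have sS : square_integrable01 S by apply: sqint_sum => i; apply: sqintZ; exact: sqint_sin.
have := norm2D_le (sqintB sg sh) (sqintB sh sS).
rewrite (_ : (fun x => _ + _) = fun x => g x - S x); last by apply/funext => x; rewrite addrA subrK.
by move=> h1; apply: le_trans h1 _; lra.
Qed.

Lemma norm2_le f e : square_integrable01 f -> (forall x, 0 <= x <= 1 -> `|f x| <= e) ->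
  norm2 f <= e ^+ 2.
Proof.
move=> [_ fi] fe; rewrite -(@int01_cst R (e ^+ 2)); apply: le_int01 => //.
  exact: integrable01_cst.
move=> x x01; rewrite -[leLHS]real_normK ?num_real//.
by apply: lerXn2r; rewrite ?nnegrE// ?fe// (le_trans _ (fe _ x01)).
Qed.

(** [r] is uniformly close to a cosine polynomial by Fejer, and multiplying a cosine by [sin (pi x)]
    gives sines of the neighbouring frequencies. *)
Lemma sin_dense_mul_sin (r : R -> R) : buc01 r -> sin_dense (fun x => r x * sin (pi * x)).
Proof.
move=> br e e0.
have e1 : 0 < Num.min 1 e by rewrite lt_min ltr01.
have [I [k [c Hc]]] := buc01_cos_approx br e1.
(* For [n = 0] the lower frequency would be -1; it is encoded as the frequency 1 with the sign of
   the coefficient reversed. *)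
have prodE (n : nat) (x : R) : cos (n%:R * pi * x) * sin (pi * x) =
    2^-1 * sin (n.+1%:R * pi * x) + (if (n == 0)%N then 2^-1 else - 2^-1) * sin ((n.-1 + (n ==
        0))%N%:R * pi * x).
  case: n => [|n] /=; first by rewrite !mul0r cos0 !mul1r; field.
  rewrite ?addn0 (_ : n.+2%:R * pi * x = n.+1%:R * pi * x + pi * x); last first.
    by rewrite -[n.+2%:R]natr1; ring.
  rewrite (_ : n%:R * pi * x = n.+1%:R * pi * x - pi * x); last first.
    by rewrite -[n.+1%:R]natr1; ring.
  by rewrite sinD sinB; field.
exists (I * bool)%type,
  (fun ib => c ib.1 * (if ib.2 then 2^-1 else if (k ib.1 == 0)%N then 2^-1 else - 2^-1)),
  (fun ib => if ib.2 then (k ib.1).+1 else ((k ib.1).-1 + (k ib.1 == 0))%N).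
pose ci (ib : I * bool) : R := c ib.1 * (if ib.2 then 2^-1 else if (k ib.1 == 0)%N then 2^-1
    else - 2^-1).
pose mi (ib : I * bool) := if ib.2 then (k ib.1).+1 else ((k ib.1).-1 + (k ib.1 == 0))%N.
pose S x := \sum_i ci i * sin ((mi i)%:R * pi * x).
have SE x : S x = (\sum_i c i * cos ((k i)%:R * pi * x)) * sin (pi * x).
  rewrite mulr_suml /S -(pair_bigA _ (fun i b => c i * (if b then 2^-1 else if (k i == 0)%N
      then 2^-1 else - 2^-1)
     * sin ((if b then (k i).+1 else ((k i).-1 + (k i == 0))%N)%:R * pi * x))) /=.
  by apply: eq_bigr => i _; rewrite big_bool /= -[RHS]mulrA prodE -!(mulrA (c i)) -mulrDr.
have sS : square_integrable01 S by apply: sqint_sum => i; apply: sqintZ; exact: sqint_sin.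
have srs : square_integrable01 (fun x => r x * sin (pi * x)).
  by apply: sqint_buc01; apply: bucM => //; [exact: ltr_norm_mono | exact: buc01_sinZ].
apply: le_trans (norm2_le (e := Num.min 1 e) (sqintB srs sS) _) _.
  move=> x x01; rewrite SE -mulrBl normrM distrC -[leRHS]mulr1.
  by apply: ler_pM => //; [exact: Hc | exact: sin_max].
rewrite expr2 -[leRHS]mul1r.
by apply: ler_pM; rewrite ?(ltW e1)// ge_min lexx ?orbT.
Qed.

End SineDensity.

Section SineParseval.
Context {R : realType}.
Local Notation mu := (@lebesgue_measure R).
Implicit Types f g h : R -> R.

Lemma cvg_harmonic_nat : (fun n : nat => (n.+1%:R : R)^-1) @ \oo --> (0 : R).
Proof. exact: cvg_harmonic. Qed.

Lemma cvg_eventually (u : nat -> R) (e : R) : u @ \oo --> (0 : R) -> 0 < e ->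
  exists n, `|u n| <= e.
Proof.
by move=> /seq_cvgP/[apply] -[N /(_ N (leqnn N))]; rewrite subr0; exists N.
Qed.

(** Division by [s = sin (pi x)] fails at the endpoints, where [v] need not vanish. Instead
    [v s^2 / (s^2 + 1/(n+1))] has the form [r s] with [r] continuous, and tends to [v] inside the
    interval with an error never above [|v|]. *)
Lemma sin_dense_continuous (v : R -> R) : buc01 v -> sin_dense v.
Proof.
move=> bv; have sv := sqint_buc01 bv; have [M M0 HM] := buc_bound bv.
apply: sin_dense_closed => // e e0.
pose D (n : nat) (x : R) := sin (pi * x) ^+ 2 + n.+1%:R^-1.
have D0 n x : 0 < D n x by rewrite ltr_wpDl ?sqr_ge0// invr_gt0.
pose r n x := v x * sin (pi * x) * (D n x)^-1.
have br n : buc01 (r n).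
  apply: bucM; [exact: ltr_norm_mono| |].
    by apply: bucM => //; [exact: ltr_norm_mono | exact: buc01_sinZ].
  apply/continuous_buc01/continuous_subspaceT => x.
  apply: cvgV; first by rewrite gt_eqF.
  apply: cvgD; last exact: cvg_cst.
  by apply: cvgM; exact: continuous_sinZ.
have brs n : buc01 (fun x => r n x * sin (pi * x)).
  by apply: bucM; [exact: ltr_norm_mono | exact: br | exact: buc01_sinZ].
have dE n x : v x - r n x * sin (pi * x) = v x * (n.+1%:R^-1 / D n x).
  have -> : n.+1%:R^-1 = D n x - sin (pi * x) ^+ 2 by rewrite /D; ring.
  by rewrite /r; have := gt_eqF (D0 n x); move: (D n x) => d h; field; rewrite h.
have q1 n x : 0 <= n.+1%:R^-1 / D n x <= 1.
  rewrite divr_ge0 ?invr_ge0 ?(ltW (D0 _ _))//= ler_pdivrMr// mul1r.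
  by rewrite /D lerDr sqr_ge0.
have lim : (fun n => norm2 (fun x => v x - r n x * sin (pi * x))) @ \oo --> int01 (fun=> 0 : R).
  apply: (@int01_dominated _ _ _ (fun=> M ^+ 2)).
  - by move=> n; case: (sqintB sv (sqint_buc01 (brs n))) => _ /integrable01_meas.
  - exact: measurable_cst.
  - exact: integrable01_cst.
  - move=> n x x01; rewrite dE ger0_norm ?sqr_ge0//.
    rewrite -[leLHS]real_normK ?num_real//; apply: lerXn2r; rewrite ?nnegrE// ?(ltW M0)//.
    rewrite normrM -[leRHS]mulr1; apply: ler_pM => //; first exact/HM/unit_interval_01.
    by case/andP: (q1 n x) => h0 h1; rewrite ger0_norm.
  - move=> x /andP[x0 x1].
    have s0 : 0 < sin (pi * x).
      by apply: sin_gt0_pi; rewrite mulr_gt0 ?pi_gt0//= gtr_pMr ?pi_gt0.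
    rewrite (_ : (fun n => _) = fun n => (v x * (n.+1%:R^-1 / D n x)) ^+ 2); last first.
      by apply/funext => n; rewrite dE.
    have c : (fun n => v x * (n.+1%:R^-1 / D n x)) @ \oo --> (0 : R).
      rewrite -(mulr0 (v x)); apply: cvgM; first exact: cvg_cst.
      rewrite -(mul0r (sin (pi * x) ^+ 2 + 0)^-1); apply: cvgM; first exact: cvg_harmonic_nat.
      apply: cvgV; first by rewrite addr0 gt_eqF// exprn_gt0.
      by apply: cvgD; [exact: cvg_cst | exact: cvg_harmonic_nat].
    by rewrite -(mulr0 (0 : R)); apply: cvgM.
rewrite int01_cst in lim; have [n Hn] := cvg_eventually lim e0.
exists (fun x => r n x * sin (pi * x)); split.
- exact: sqint_buc01.
- exact: sin_dense_mul_sin.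
- exact: le_trans (ler_norm _) Hn.
Qed.

Definition clip (M y : R) : R := if y < - M then - M else if M < y then M else y.

Lemma clip_lipschitz M a b : 0 <= M -> `|clip M a - clip M b| <= `|a - b|.
Proof.
move=> M0; have h1 := ler_norm (a - b); have h2 := ler_norm (- (a - b)).
rewrite normrN in h2; rewrite /clip ler_norml.
by case: (ltP a (- M)) => ?; case: (ltP b (- M)) => ?; case: (ltP M a) => ?;
   case: (ltP M b) => ?; apply/andP; split; lra.
Qed.

Lemma clip_le M a : 0 <= M -> `|clip M a| <= M.
Proof.
move=> M0; rewrite /clip ler_norml.
by case: (ltP a (- M)) => ?; case: (ltP M a) => ?; apply/andP; split; lra.
Qed.

Lemma clip_id M a : `|a| <= M -> clip M a = a.
Proof.
rewrite ler_norml => /andP[h1 h2]; rewrite /clip.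
by case: (ltP a (- M)) => ?; case: (ltP M a) => ?; lra.
Qed.

Lemma clip_sub_le M a : 0 <= M -> `|a - clip M a| <= `|a|.
Proof.
move=> M0; have h1 := ler_norm a; have h2 := ler_norm (- a); rewrite normrN in h2.
rewrite /clip ler_norml.
by case: (ltP a (- M)) => ?; case: (ltP M a) => ?; apply/andP; split; lra.
Qed.

Lemma continuous_clip M : 0 <= M -> continuous (clip M).
Proof.
move=> M0 x; apply/cvgrPdist_le => e e0.
have : \forall y \near x, `|x - y| < e by apply: nbhsx_ballx.
by apply: filterS => y xy; rewrite (le_trans (clip_lipschitz _ _ M0))// ltW.
Qed.

(** Truncation at height [n] loses little in mean square by dominated convergence. The truncated
    function is close in L1 to a continuous one, which is truncated as well; both being bounded by
    [n], the squared L2 error is at most [2 n] times the L1 error. *)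
Lemma sin_dense_sqint g : square_integrable01 g -> sin_dense g.
Proof.
move=> sg; apply: sin_dense_closed => // e e0; have [mg gi] := sg.
have mclip (n : nat) f : measurable01 f -> measurable01 (fun x => clip n%:R (f x)).
  move=> mf; apply: (measurableT_comp _ mf).
  exact: continuous_measurable_fun (continuous_clip (ler0n _ n)).
have lim : (fun n : nat => norm2 (fun x => g x - clip n%:R (g x))) @ \oo --> int01 (fun=> 0 : R).
  apply: (@int01_dominated _ _ _ (fun x => g x ^+ 2)) => //.
  - move=> n; apply: measurable_funM; apply: measurable_funB => //; exact: mclip.
  - exact: measurable_cst.
  - move=> n x _; rewrite ger0_norm ?sqr_ge0// -[leLHS]real_normK ?num_real//.
    rewrite -[leRHS]real_normK ?num_real//; apply: lerXn2r; rewrite ?nnegrE//.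
    exact: clip_sub_le.
  - move=> x _; apply/seq_cvgP => e' e'0.
    exists (Num.bound `|g x|) => n hn; rewrite clip_id ?subrr ?expr0n ?subr0 ?normr0 ?(ltW e'0)//.
    by rewrite ltW// (lt_le_trans (archi_boundP _))// ler_nat.
rewrite int01_cst in lim; have [n Hn] := cvg_eventually lim e0.
pose G x := clip n%:R (g x).
have mG : measurable01 G by exact: mclip.
have Gb x : `|G x| <= n%:R by exact: clip_le.
have bounded_int (f : R -> R) (M : R) : measurable01 f -> (forall x, `|f x| <= M) -> integrable01 f.
  by move=> mf fM; apply: le_integrable01 mf (integrable01_cst M) _ => x _; exact: fM.
have Gi : integrable01 G by exact: bounded_int Gb.
have sG : square_integrable01 G.
  split=> //; apply: (bounded_int _ (n%:R ^+ 2)); first exact: measurable_funM.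
  move=> x; rewrite ger0_norm ?sqr_ge0// -[leLHS]real_normK ?num_real//.
  by apply: lerXn2r; rewrite ?nnegrE.
exists G; split=> //; last exact: le_trans (ler_norm _) Hn.
apply: sin_dense_closed => // e1 e10.
have m1 : (mu unit_interval < +oo)%E.
  have -> : mu unit_interval = 1%E by rewrite lebesgue_measure_itv/= lte01 oppr0 adde0.
  by rewrite ltry.
have [u [cu ui lu]] := approximation_continuous_integrable measurable_unit_interval m1 Gi.
pose U k x := clip n%:R (u k x).
have bU k : buc01 (U k).
  apply/continuous_buc01/continuous_subspaceT => x.
  by apply: continuous_comp; [exact: cu | exact: continuous_clip (ler0n _ n) _].
have sGU k := sqintB sG (sqint_buc01 (bU k)).
have lim1 : (fun k => int01 (fun x => `|G x - u k x|)) @ \oo --> (0 : R).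
  exact: (fine_cvg lu).
have e2 : 0 < e1 / (2 * n%:R + 1) by rewrite divr_gt0// ltr_wpDl// mulr_ge0.
have [k Hk] := cvg_eventually lim1 e2.
exists (U k); split.
- exact: sqint_buc01.
- exact: sin_dense_continuous.
have iGu : integrable01 (fun x => `|G x - u k x|).
  have Gu : integrable01 (fun x => G x - u k x).
    have := integrable01D Gi (integrable01Z (-1) (ui k)).
    by congr integrable01; apply/funext => x /=; rewrite mulN1r.
  apply: (le_integrable01 (g := fun x => `|G x| + `|u k x|)).
  - by apply: measurableT_comp (integrable01_meas Gu); exact: normr_measurable.
  - have nrm f : integrable01 f -> integrable01 (fun x => `|f x|).
      move=> fi; exact: (integrable_norm fi).
    by apply: integrable01D; apply: nrm => //; exact: ui.
  - by move=> x _; rewrite normr_id ler_normB.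
apply: (@le_trans _ _ (2 * n%:R * int01 (fun x => `|G x - u k x|))).
  rewrite -int01Z//; apply: le_int01; first by case: (sGU k).
    exact: integrable01Z.
  move=> x _; rewrite -[leLHS]real_normK ?num_real// expr2.
  apply: ler_pM => //; last by rewrite -{1}(clip_id (Gb x)); exact: clip_lipschitz.
  by rewrite mulr_natl mulr2n (le_trans (ler_normB _ _))// lerD// clip_le.
have := le_trans (ler_norm _) Hk => h.
apply: (@le_trans _ _ (2 * n%:R * (e1 / (2 * n%:R + 1)))).
  by rewrite ler_wpM2l// mulr_ge0.
rewrite mulrA ler_pdivrMr ?ltr_wpDl ?mulr_ge0// mulrC ler_pM2l//.
by rewrite lerDl.
Qed.

(** One side is Bessel's inequality; the other compares with a sine polynomial from
    [sin_dense_sqint], all of whose frequencies are below [K] once [K] is large. *)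
Lemma parseval_sin_norm g : square_integrable01 g ->
  (fun K => \sum_(k < K) 2 * sin_coef k g ^+ 2) @ \oo --> norm2 g.
Proof.
move=> sg; apply/seq_cvgP => e e0; have [I [c [m Hm]]] := sin_dense_sqint sg e0.
exists (\max_i m i).+1 => K HK; have mK i : (m i < K)%N.
  by apply: leq_trans HK; rewrite ltnS; exact: leq_bigmax.
rewrite distrC ger0_norm; last by rewrite subr_ge0 bessel_sin.
exact: le_trans (sin_proj_le c mK sg) Hm.
Qed.

Lemma parseval_sin g h : square_integrable01 g -> square_integrable01 h ->
  (fun K => \sum_(k < K) 2 * (sin_coef k g * sin_coef k h)) @ \oo -->
  int01 (fun x => g x * h x).
Proof.
move=> sg sh; have sD := sqintD sg sh; have sB := sqintB sg sh.
have -> : int01 (fun x => g x * h x) =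
    4^-1 * norm2 (fun x => g x + h x) - 4^-1 * norm2 (fun x => g x - h x).
  case: (sD) => _ iD; case: (sB) => _ iB.
  rewrite /norm2 -!int01Z// -int01B; try exact: integrable01Z.
  by apply: eq_int01 => x _; field.
rewrite (_ : (fun K => _) = fun K => 4^-1 * (\sum_(k < K) 2 * sin_coef k (fun x => g x + h x)
    ^+ 2) -
    4^-1 * (\sum_(k < K) 2 * sin_coef k (fun x => g x - h x) ^+ 2)); last first.
  apply/funext => K; rewrite !mulr_sumr -sumrB; apply: eq_bigr => k _.
  by rewrite sin_coefD// sin_coefB//; field.
by apply: cvgB; apply: cvgM; try exact: cvg_cst; exact: parseval_sin_norm.
Qed.

End SineParseval.

(** * Weak derivatives and the case [alpha = 1] *)

Section WeakDerivative.
Context {R : realType}.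
Implicit Types f g : R -> R.

Definition pos2 (u : R) : R := Num.max u 0 ^+ 2.

Lemma max0_cases (u : R) : (u <= 0 /\ Num.max u 0 = 0) \/ (0 <= u /\ Num.max u 0 = u).
Proof. by case: (leP u 0) => h; [left | right; rewrite ltW]. Qed.

Lemma is_derive_quadratic (F : R -> R) (x d : R) :
  (forall y, `|F y - F x - d * (y - x)| <= (y - x) ^+ 2) -> is_derive x 1 F d.
Proof.
move=> H.
have lim : h^-1 *: (F (h *: 1 + x) - F x) @[h --> 0^'] --> d.
  apply/cvgrPdist_le => e e0; near=> h.
  have h0 : h != 0 by near: h; exact: nbhs_dnbhs_neq.
  have he : `|h| <= e by near: h; apply: dnbhs0_le.
  rewrite /GRing.scale /= mulr1.
  have -> : d - h^-1 * (F (h + x) - F x) = - (h^-1 * (F (h + x) - F x - d * (h + x - x))).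
    by field.
  rewrite normrN normrM (le_trans (ler_wpM2l _ (H _)))//.
  rewrite (_ : h + x - x = h); last by ring.
  rewrite normfV -[h ^+ 2]real_normK ?num_real// expr2 mulrA mulVf ?mul1r//.
  by rewrite normr_eq0.
apply: DeriveDef; first by apply/cvg_ex; exists d.
exact: cvg_lim lim.
Unshelve. all: by end_near. Qed.

Lemma is_derive_pos2 (u : R) : is_derive u 1 pos2 (2 * Num.max u 0).
Proof.
apply: is_derive_quadratic => y; rewrite /pos2 ler_norml.
have yu := sqr_ge0 (y - u); have y2 := sqr_ge0 y; have u2 := sqr_ge0 u.
case: (max0_cases u) => -[hu ->]; case: (max0_cases y) => -[hy ->].
- by apply/andP; split; lra.
- have p := mulr_le0_ge0 hu hy; apply/andP; split; lra.
- have p := mulr_ge0_le0 hu hy; apply/andP; split; lra.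
- by apply/andP; split; lra.
Qed.

(** A continuously differentiable switch: 0 for [u <= 0], tending to 1 as [u] grows. *)
Definition cutoff (u : R) : R := 1 - (1 + pos2 u)^-1.

Lemma pos2_ge0 u : 0 <= pos2 u. Proof. exact: sqr_ge0. Qed.

Lemma pos2_D1_gt0 u : 0 < 1 + pos2 u. Proof. by rewrite ltr_pwDl// pos2_ge0. Qed.

Lemma is_derive_cutoff (u : R) :
  is_derive u 1 cutoff (2 * Num.max u 0 * (1 + pos2 u)^-2).
Proof.
have dp := is_derive_pos2 u.
have d1 : is_derive u 1 (fun v => 1 + pos2 v) (2 * Num.max u 0).
  rewrite -[X in is_derive _ _ _ X]add0r; apply: is_deriveD.
have d2 : is_derive u 1 (fun v => (1 + pos2 v)^-1) (- (1 + pos2 u) ^- 2 *: (2 * Num.max u 0)).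
  have nz : 1 + pos2 u != 0 by rewrite gt_eqF// pos2_D1_gt0.
  exact: (@is_deriveV _ (fun v => 1 + pos2 v) u _ 1 nz d1).
have := is_deriveB (is_derive_cst (1 : R) u (1 : R)) d2.
by rewrite sub0r /GRing.scale /= mulNr opprK mulrC.
Qed.

Lemma cutoff_le0 u : u <= 0 -> cutoff u = 0.
Proof.
move=> u0; rewrite /cutoff /pos2 (_ : Num.max u 0 = 0) ?expr0n ?addr0 ?invr1 ?subrr//.
by case: (max0_cases u) => -[h ->]//; apply/le_anti; rewrite u0 h.
Qed.

(** At most 0 within [1/(n+1)] of either endpoint, and unbounded in [n] at each inner point:
    composed with [cutoff] it gives compact support in the open interval and tends to 1 there. *)
Definition bump (n : nat) (x : R) : R := n.+1%:R * (x * (1 - x)) - 1.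

Lemma is_derive_bump n (x : R) : is_derive x 1 (bump n) (n.+1%:R * (1 - 2 * x)).
Proof.
by apply: trigger_derive; rewrite /GRing.scale /=; ring.
Qed.

Definition test_sin (k n : nat) (x : R) : R := sin (k%:R * pi * x) * cutoff (bump n x).

Definition test_sin' (k n : nat) (x : R) : R :=
  k%:R * pi * cos (k%:R * pi * x) * cutoff (bump n x) +
  sin (k%:R * pi * x) * (2 * Num.max (bump n x) 0 * (1 + pos2 (bump n x))^-2 * (n.+1%:R * (1 -
      2 * x))).

Lemma is_derive_test_sin k n (x : R) : is_derive x 1 (test_sin k n) (test_sin' k n x).
Proof.
have d1 := is_derive_sinZ (k%:R * pi) x.
have d2 : is_derive x 1 (cutoff \o bump n)
  ((2 * Num.max (bump n x) 0 * (1 + pos2 (bump n x))^-2) * (n.+1%:R * (1 - 2 * x))).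
  by apply: is_derive1_comp; [exact: is_derive_cutoff | exact: is_derive_bump].
have := is_deriveM d1 d2; rewrite /GRing.scale /= /test_sin' => d3.
by rewrite addrC [X in X + _]mulrC [X in _ + X]mulrC in d3 *.
Qed.

End WeakDerivative.

Section SobolevOne.
Context {R : realType}.
Implicit Types f g : R -> R.

Lemma continuous_pos2 : continuous (@pos2 R).
Proof. exact: is_derive_continuous (@is_derive_pos2 R). Qed.

Lemma continuous_bump n : continuous (@bump R n).
Proof. exact: is_derive_continuous (is_derive_bump n). Qed.

Lemma continuous_cutoff : continuous (@cutoff R).
Proof. exact: is_derive_continuous (@is_derive_cutoff R). Qed.

Lemma continuous_max0 : continuous (fun u : R => Num.max u 0).
Proof.
move=> u; apply/cvgrPdist_le => e e0.
have : \forall y \near u, `|u - y| < e by apply: nbhsx_ballx.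
apply: filterS => y /ltW; rewrite !ler_norml => /andP[h1 h2].
by case: (max0_cases u) => -[hu ->]; case: (max0_cases y) => -[hy ->]; apply/andP; split; lra.
Qed.

Lemma continuous_test_sin' k n : continuous (@test_sin' R k n).
Proof.
move=> x; rewrite /test_sin'.
have cc : {for x, continuous (fun x => cutoff (bump n x))}.
  by apply: continuous_comp; [exact: continuous_bump | exact: continuous_cutoff].
have cm : {for x, continuous (fun x => Num.max (bump n x) 0)}.
  apply: (@continuous_comp _ _ _ (bump n) (fun u => Num.max u 0)).
    exact: continuous_bump.
  exact: continuous_max0.
have cp : {for x, continuous (fun x => pos2 (bump n x))}.
  by apply: continuous_comp; [exact: continuous_bump | exact: continuous_pos2].
apply: cvgD.
  apply: cvgM => //; apply: cvgM; [exact: cvg_cst | exact: continuous_cosZ].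
apply: cvgM; first exact: continuous_sinZ.
apply: cvgM.
  apply: cvgM; first by apply: cvgM => //; exact: cvg_cst.
  apply: cvgV; first by rewrite expf_eq0 /= gt_eqF// pos2_D1_gt0.
  by apply: cvgM; (apply: cvgD; [exact: cvg_cst | exact: cp]).
apply: cvgM; first exact: cvg_cst.
by apply: cvgB; [exact: cvg_cst | apply: cvgM; [exact: cvg_cst | exact: cvg_id]].
Qed.

Lemma derive1_test_sin k n : derive1 (test_sin k n) = @test_sin' R k n.
Proof.
apply/funext => x; rewrite derive1E.
by have := is_derive_test_sin k n x => ?; exact: derive_val.
Qed.

Lemma test_sin_support k n : exists a b : R, [/\ 0 < a, b < 1 &
  forall x, ~~ (a <= x <= b) -> test_sin k n x = 0].
Proof.
have n0 : 0 < n.+1%:R :> R by rewrite ltr0n.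
have nV : 0 < n.+1%:R^-1 :> R by rewrite invr_gt0.
exists n.+1%:R^-1, (1 - n.+1%:R^-1); split; [by [] | by rewrite gtrBl |].
move=> x hx; rewrite /test_sin cutoff_le0 ?mulr0// /bump lerBlDr add0r.
rewrite -ler_pdivlMl// mulr1; move: hx; rewrite negb_and -!ltNge => /orP[h|h].
  have x2 := sqr_ge0 x; apply: ltW; apply: le_lt_trans h.
  by rewrite mulrBr mulr1 -expr2 gerBl.
have x2 := sqr_ge0 (1 - x); apply: ltW; apply: (@le_lt_trans _ _ (1 - x)); last by rewrite
    ltrBlDr addrC -ltrBlDr.
by rewrite -subr_ge0 (_ : _ - _ = (1 - x) ^+ 2)//; ring.
Qed.

Lemma weak_derivative_test_sin f g k n : is_weak_derivative f g ->
  int01 (fun x => f x * test_sin' k n x) = - int01 (fun x => g x * test_sin k n x).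
Proof.
move=> wd; have := wd (test_sin k n); rewrite derive1_test_sin; apply.
- by move=> x; have := is_derive_test_sin k n x => ?; exact: ex_derive.
- exact: continuous_test_sin'.
- exact: test_sin_support.
Qed.

(** The sine vanishes at both endpoints and is Lipschitz with constant [k pi]. This pays for the
    derivative of the cut-off, which is of order [n] near the endpoints. *)
Lemma sin_le_bubble (k : nat) (x : R) : 0 <= x <= 1 ->
  `|sin (k%:R * pi * x)| <= 2 * (k%:R * pi) * (x * (1 - x)).
Proof.
move=> /andP[x0 x1]; pose c : R := k%:R * pi.
have c0 : 0 <= c by rewrite mulr_ge0 ?pi_ge0.
have lip := is_derive_lipschitz (fun x => is_derive_sinZ c x).
have /lip {}lip : forall x : R, `|c * cos (c * x)| <= c.
  by move=> y; rewrite normrM (ger0_norm c0) ler_piMr// cos_max.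
have h0 : `|sin (c * x)| <= c * x.
  by have := lip x 0; rewrite mulr0 sin0 !subr0 (ger0_norm x0).
have h1 : `|sin (c * x)| <= c * (1 - x).
  have := lip x 1; rewrite mulr1 sin_natpi subr0 distrC [`|1 - x|]ger0_norm//.
  by rewrite subr_ge0.
rewrite -/c; case: (leP x (1 / 2)) => x2.
  apply: le_trans h0 _.
  by rewrite (_ : 2 * c * (x * (1 - x)) = c * (x * (2 * (1 - x)))); [rewrite ler_wpM2l//
      ler_peMr//; lra | ring].
apply: le_trans h1 _.
by rewrite (_ : 2 * c * (x * (1 - x)) = c * ((1 - x) * (2 * x))); [rewrite ler_wpM2l//
    ler_peMr//; lra | ring].
Qed.

Let err (n : nat) (x : R) : R := (1 + pos2 (bump n x))^-1.

Let err01 n x : 0 <= err n x <= 1.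
Proof.
rewrite invr_ge0 ltW ?pos2_D1_gt0//= invf_le1 ?pos2_D1_gt0//.
by rewrite lerDl pos2_ge0.
Qed.

Let err_cvg x : 0 < x < 1 -> (fun n => err n x) @ \oo --> (0 : R).
Proof.
move=> /andP[x0 x1]; have s0 : 0 < x * (1 - x) by rewrite mulr_gt0// subr_gt0.
have bnd n : err n x <= 2 / (x * (1 - x)) * n.+1%:R^-1.
  have n0 : 0 < n.+1%:R :> R by rewrite ltr0n.
  have -> : 2 / (x * (1 - x)) * n.+1%:R^-1 = ((n.+1%:R * (x * (1 - x))) / 2)^-1.
    by field; rewrite !gt_eqF// subr_gt0.
  rewrite lef_pV2 ?posrE ?pos2_D1_gt0 ?divr_gt0 ?mulr_gt0//; last by rewrite subr_gt0.
  have -> : n.+1%:R * (x * (1 - x)) = bump n x + 1 by rewrite /bump subrK.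
  by move: (bump n x) => u; rewrite /pos2; case: (max0_cases u) => -[hu ->]; nra.
have lim : (fun n : nat => 2 / (x * (1 - x)) * n.+1%:R^-1) @ \oo --> (0 : R).
  rewrite -(mulr0 (2 / (x * (1 - x)))); apply: cvgM; first exact: cvg_cst.
  exact: cvg_harmonic_nat.
apply/seq_cvgP => e e0; have /seq_cvgP/(_ e e0)[N HN] := lim.
exists N => n Nn; have := HN n Nn; rewrite !subr0 => h.
case/andP: (err01 n x) => h0 _; rewrite ger0_norm//.
by apply: le_trans (bnd n) _; exact: le_trans (ler_norm _) h.
Qed.

(** The 9 is 1 + 8. The undifferentiated cut-off gives 1; in the other term [sin_le_bubble] turns
    [(n+1) x (1-x)] into [u + 1] with [u = bump n x], after which [2 u (u + 1) <= 4 (1 + u^2)] for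
    [u >= 0] gives 8. *)
Let test_sin'_err k n (x : R) : 0 <= x <= 1 ->
  `|test_sin' k n x - k%:R * pi * cos (k%:R * pi * x)| <= 9 * (k%:R * pi) * err n x.
Proof.
move=> x01; have := sin_le_bubble k x01; case/andP: (x01) => x0 x1.
have c0 : 0 <= k%:R * pi :> R by rewrite mulr_ge0 ?pi_ge0.
move: c0 (cos_max (k%:R * pi * x)).
set c := k%:R * pi; set C := cos _; set S := sin _ => c0 C1 HS.
have n0 : 0 < n.+1%:R :> R by rewrite ltr0n.
have -> : test_sin' k n x - c * C = - (c * C * err n x) +
    S * (2 * Num.max (bump n x) 0 * (n.+1%:R * (1 - 2 * x)) * err n x) * err n x.
  rewrite /test_sin' /cutoff -/c -/C -/S -exprVn -!/(err n x); ring.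
rewrite (_ : 9 * c * err n x = c * err n x + 8 * c * err n x); last by ring.
have /andP[e0 e1] := err01 n x.
rewrite (le_trans (ler_normD _ _))// normrN lerD//.
  by rewrite normrM (ger0_norm e0) ler_wpM2r// normrM (ger0_norm c0) ler_piMr.
rewrite normrM (ger0_norm e0) ler_wpM2r//.
have m0 : 0 <= Num.max (bump n x) 0 by rewrite le_max lexx orbT.
have h12 : `|1 - 2 * x| <= 1 by rewrite ler_norml; apply/andP; split; lra.
rewrite !normrM (ger0_norm e0) (ger0_norm m0) (ger0_norm (ltW n0)) [`|2|]ger0_norm//.
apply: (@le_trans _ _ (2 * c * (x * (1 - x)) * (2 * Num.max (bump n x) 0 * (n.+1%:R * 1) * err
    n x))).
  apply: ler_pM => //; first by rewrite !mulr_ge0// ltW.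
  by rewrite ler_wpM2r// ler_wpM2l ?mulr_ge0// ler_pM2l.
have -> : 2 * c * (x * (1 - x)) * (2 * Num.max (bump n x) 0 * (n.+1%:R * 1) * err n x) =
   2 * c * (2 * Num.max (bump n x) 0 * (bump n x + 1) * err n x).
  by rewrite /bump subrK; ring.
rewrite (_ : 8 * c = 2 * c * 4); last by ring.
apply: ler_wpM2l; first by rewrite mulr_ge0.
rewrite [X in X <= _](_ : _ = (2 * Num.max (bump n x) 0 * (bump n x + 1)) / (1 + pos2 (bump n
    x)))//.
rewrite ler_pdivrMr ?pos2_D1_gt0//.
move: (bump n x) => u; rewrite /pos2; case: (max0_cases u) => -[hu ->].
  by rewrite expr2; lra.
rewrite -subr_ge0 (_ : _ - _ = 2 * (u - 1) ^+ 2 + 2 * u + 2); last by ring.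
by rewrite !addr_ge0// mulr_ge0// sqr_ge0.
Qed.

(** Integration by parts against [sin (k pi x)], which does not have compact support in the open
    interval: it is tested through [test_sin k n], and both sides converge by dominated convergence
    as [n] grows. The sine vanishes at 0 and 1, so no boundary term appears. *)
Lemma weak_derivative_sin f g k : buc01 f -> square_integrable01 g ->
  is_weak_derivative f g ->
  int01 (fun x => f x * (k%:R * pi * cos (k%:R * pi * x))) = - sin_coef k g.
Proof.
move=> bf sg wd; have [M M0 HM] := buc_bound bf.
have c0 : 0 <= k%:R * pi :> R by rewrite mulr_ge0 ?pi_ge0.
have ct n : buc01 (@test_sin' R k n).
  by apply/continuous_buc01/continuous_subspaceT; exact: continuous_test_sin'.
have lim1 : (fun n => int01 (fun x => f x * test_sin' k n x)) @ \oo -->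
    int01 (fun x => f x * (k%:R * pi * cos (k%:R * pi * x))).
  apply: (@int01_dominated _ _ _ (fun=> M * (10 * (k%:R * pi)))).
  - move=> n; apply: integrable01_meas; apply: buc01_integrable.
    by apply: bucM; [exact: ltr_norm_mono | exact: bf | exact: ct].
  - apply: integrable01_meas; apply: buc01_integrable.
    apply: bucM; [exact: ltr_norm_mono | exact: bf |].
    by apply: bucZ; [exact: ltr_norm_mono | exact: buc01_cosZ].
  - exact: integrable01_cst.
  - move=> n x x01; rewrite normrM; apply: ler_pM => //; first exact/HM/unit_interval_01.
    rewrite -[test_sin' k n x](subrK (k%:R * pi * cos (k%:R * pi * x))).
    rewrite (le_trans (ler_normD _ _))//.
    rewrite (_ : 10 * (k%:R * pi) = 9 * (k%:R * pi) + k%:R * pi); last by ring.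
    apply: lerD; last by rewrite normrM (ger0_norm c0) ler_piMr// cos_max.
    apply: le_trans (test_sin'_err k n x01) _.
    by case/andP: (err01 n x) => _ h; rewrite ler_piMr// mulr_ge0.
  - move=> x x01; apply: cvgM; first exact: cvg_cst.
    have x01' : 0 <= x <= 1 by case/andP: x01 => /ltW -> /ltW ->.
    have lim : (fun n => 9 * (k%:R * pi) * err n x) @ \oo --> (0 : R).
      rewrite -(mulr0 (9 * (k%:R * pi))); apply: cvgM; first exact: cvg_cst.
      exact: err_cvg.
    apply/seq_cvgP => e e0; have /seq_cvgP/(_ e e0)[N HN] := lim.
    exists N => n Nn; apply: le_trans (test_sin'_err k n x01') _.
    by have := HN n Nn; rewrite subr0; apply: le_trans; exact: ler_norm.
have bt n : buc01 (test_sin k n).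
  apply/continuous_buc01/continuous_subspaceT.
  exact: is_derive_continuous (is_derive_test_sin k n).
have lim2 : (fun n => int01 (fun x => g x * test_sin k n x)) @ \oo --> sin_coef k g.
  have gi := sqint_integrable sg.
  apply: (@int01_dominated _ _ _ (fun x => `|g x|)).
  - move=> n; apply: integrable01_meas; apply: sqintM => //; exact: sqint_buc01.
  - by apply: integrable01_meas; exact: integrable_sin.
  - exact: (integrable_norm gi).
  - move=> n x x01; rewrite /test_sin !normrM -[leRHS]mulr1 ler_wpM2l//.
    rewrite -[leRHS]mulr1; apply: ler_pM => //; first exact: sin_max.
    rewrite /cutoff -/(err n x); case/andP: (err01 n x) => h0 h1.
    by rewrite ger0_norm ?subr_ge0// gerBl.
  - move=> x x01; apply: cvgM; first exact: cvg_cst.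
    rewrite -[X in _ --> X]mulr1; apply: cvgM; first exact: cvg_cst.
    rewrite -[X in _ --> X]subr0; apply: cvgB; first exact: cvg_cst.
    exact: err_cvg.
apply: (cvg_uniq lim1).
rewrite (_ : (fun n => _) = fun n => - int01 (fun x => g x * test_sin k n x)).
  exact: cvgN.
by apply/funext => n; exact: weak_derivative_test_sin.
Qed.

Lemma is_weak_derivativeB f1 f2 g1 g2 : buc01 f1 -> buc01 f2 ->
  square_integrable01 g1 -> square_integrable01 g2 ->
  is_weak_derivative f1 g1 -> is_weak_derivative f2 g2 ->
  is_weak_derivative (f1 \- f2) (fun x => g1 x - g2 x).
Proof.
move=> b1 b2 s1 s2 w1 w2 psi dpsi cpsi supp.
have E1 := w1 psi dpsi cpsi supp; have E2 := w2 psi dpsi cpsi supp.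
have bd : buc01 (derive1 psi) by exact/continuous_buc01/continuous_subspaceT.
have bp : buc01 psi.
  apply/continuous_buc01/continuous_subspaceT => x.
  by apply: differentiable_continuous; rewrite -derivable1_diffP; exact: dpsi.
have i (f : R -> R) : buc01 f -> integrable01 (fun x => f x * derive1 psi x).
  by move=> bf; apply/buc01_integrable/bucM => //; exact: ltr_norm_mono.
have j (g : R -> R) : square_integrable01 g -> integrable01 (fun x => g x * psi x).
  by move=> sg; apply: sqintM => //; exact: sqint_buc01.
transitivity (int01 (fun x => f1 x * derive1 psi x) - int01 (fun x => f2 x * derive1 psi x)).
  by rewrite -int01B; [|exact: i|exact: i]; apply: eq_int01 => x _; rewrite /= mulrBl.
rewrite E1 E2 opprK addrC -opprB; congr (- _).
by rewrite -int01B; [|exact: j|exact: j]; apply: eq_int01 => x _; rewrite mulrBl.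
Qed.

Lemma sob_oneP gamma f : carrier (sob_one gamma) f ->
  [/\ buc01 f, square_integrable01 (weak_derivative f) &
      is_weak_derivative f (weak_derivative f)].
Proof.
move=> [cf ex]; have := xgetPex (fun=> 0 : R) ex; rewrite -/(weak_derivative f) => -[h1 h2].
by split=> //; exact: continuous_buc01.
Qed.

(** Integration by parts equates [k pi] times the cosine coefficient with a multiple of the sine
    coefficient of the weak derivative, so the derivative term is Parseval's identity for sine
    series. The weight bound holds with equality, since [kappa 1 = pi ^+ 2]. *)
Lemma spectral_sob_eq1 (gamma : R) : 0 < gamma ->
  exists2 wt, spectral_weight 1 gamma wt & spectral1 wt (sob1 1 gamma).
Proof.
move=> g0; rewrite /sob1 ltxx eqxx.
have g2 : 0 <= gamma ^- 2 by rewrite invr_ge0 exprn_ge0// ltW.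
pose wt (k : nat) : R := (k == 0%N)%:R + gamma ^- 2 * (k%:R * pi) ^+ 2.
have wt0 k : 0 <= wt k.
  by apply: addr_ge0 => //; apply: mulr_ge0 => //; exact: sqr_ge0.
exists wt.
  split=> //; first by rewrite /wt mul0r expr0n /= mulr0 addr0.
  move=> k kp; rewrite /kappa ltxx eqxx /wt eqn0Ngt kp add0r mulr1.
  rewrite powR_mulrn// le_eqVlt; apply/orP; left; apply/eqP.
  by field; rewrite gt_eqF.
have coefE (f g : R -> R) k : carrier (sob_one gamma) f -> carrier (sob_one gamma) g ->
    (k%:R * pi) ^+ 2 * (cos_coef1 k f * cos_coef1 k g) =
    2 * (sin_coef k (weak_derivative f) * sin_coef k (weak_derivative g)).
  have E h : carrier (sob_one gamma) h -> k%:R * pi * cos_coef1 k h =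
      - (cos_scale k * sin_coef k (weak_derivative h)).
    move=> /sob_oneP[bh sh wh]; rewrite -mulrN -(weak_derivative_sin k bh sh wh).
    have ih : integrable01 (fun x => h x * (k%:R * pi * cos (k%:R * pi * x))).
      apply/buc01_integrable/bucM => //; first exact: ltr_norm_mono.
      by apply: bucZ; [exact: ltr_norm_mono | exact: buc01_cosZ].
    have ih' : integrable01 (fun x => h x * cos_basis k x).
      by apply/buc01_integrable/bucM => //; [exact: ltr_norm_mono | exact: buc01_cos_basis].
    rewrite /cos_coef1 -!int01Z//; apply: eq_int01 => x _.
    by rewrite cos_basisE; ring.
  move=> cf cg; rewrite expr2 mulrACA (E _ cf) (E _ cg) mulrNN mulrACA -expr2 cos_scale_sqr.
  by case: eqP => [->|//]; rewrite sin_coef0 !mul0r !mulr0.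
have c0E (f : R -> R) : cos_coef1 0 f = int01 f.
  by apply: eq_int01 => x _; rewrite mulr1.
have sumE (f g : R -> R) K : carrier (sob_one gamma) f -> carrier (sob_one gamma) g ->
    \sum_(k < K.+1) wt k * (cos_coef1 k f * cos_coef1 k g) = int01 f * int01 g +
    gamma ^- 2 * \sum_(k < K.+1) 2 * (sin_coef k (weak_derivative f) * sin_coef k
        (weak_derivative g)).
  move=> cf cg; rewrite -!c0E mulr_sumr.
  have -> : cos_coef1 0 f * cos_coef1 0 g = \sum_(k < K.+1) (k == 0 :> nat)%:R * (cos_coef1 k f
      * cos_coef1 k g).
    by rewrite big_ord_recl /= mul1r big1 ?addr0// => k _; rewrite mul0r.
  rewrite -big_split; apply: eq_bigr => k _ /=.
  by rewrite -(coefE _ _ _ cf cg) /wt; ring.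
split.
- by move=> f /sob_oneP[].
- move=> f g cf cg; have [bf sf wf] := sob_oneP cf; have [bg sg wg] := sob_oneP cg.
  split.
    by apply: buc01_continuous; apply: bucB => //; exact: ltr_norm_mono.
  exists (fun x => weak_derivative f x - weak_derivative g x); split; first exact: sqintB.
  exact: is_weak_derivativeB.
- move=> K f cf; have [bf sf wf] := sob_oneP cf.
  (* One more term makes the sum nonempty, so that it contains the frequency 0, which carries the
     product of the means. *)
  apply: (@le_trans _ _ (\sum_(k < K.+1) wt k * cos_coef1 k f ^+ 2)).
    by rewrite /spectral_norm2 big_ord_recr /= lerDl; apply: mulr_ge0 => //; exact: sqr_ge0.
  under eq_bigr do rewrite expr2.
  rewrite sumE// lerD2l ler_wpM2l//.
  apply: le_trans (bessel_sin K.+1 sf) _; rewrite le_eqVlt; apply/orP; left; apply/eqP.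
  by apply: eq_int01 => x _; rewrite expr2.
- move=> f g cf cg; have [bf sf wf] := sob_oneP cf; have [bg sg wg] := sob_oneP cg.
  have lim := parseval_sin sf sg.
  rewrite -(cvg_shiftS (fun K => spectral_form _ _ K f g)).
  rewrite (_ : (fun n => _) = fun K => int01 f * int01 g +
    gamma ^- 2 * \sum_(k < K.+1) 2 * (sin_coef k (weak_derivative f) * sin_coef k
        (weak_derivative g))); last first.
    by apply/funext => K; exact: sumE.
  apply: cvgD; first exact: cvg_cst.
  apply: cvgM; first exact: cvg_cst.
  by rewrite (cvg_shiftS (fun K => \sum_(k < K) 2 * (sin_coef k (weak_derivative f) * sin_coef
      k (weak_derivative g)))).
Qed.

End SobolevOne.

(** * From the Sobolev ball to cosine polynomials and the dual lattice *)

Section SobolevApproximation.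
Context {R : realType}.

Lemma spectral_sob1 (alpha gamma : R) : 1 / 2 < alpha < 2 -> 0 < gamma -> 0 < kappa alpha ->
  exists2 wt, spectral_weight alpha gamma wt & spectral1 wt (sob1 alpha gamma).
Proof.
move=> /andP[a0 a2] g0 k0; case: (ltgtP alpha 1) => a1.
- by apply: spectral_sob_lt1 => //; rewrite a0.
- by apply: spectral_sob_gt1 => //; rewrite a1.
- by rewrite a1; exact: spectral_sob_eq1.
Qed.

(** The weight [r] of the half-period cosine space; it is used with [Gam = gamma / sqrt kappa],
    which is at most 1 in the theorem. *)
Definition freq_weight (alpha Gam : R) (k : nat) : R :=
  if k == 0%N then 1 else k%:R `^ alpha / Gam.

Definition cos_expansion d N (c : {ffun 'I_d -> 'I_N} -> R) (x : d.-tuple R) : R :=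
  \sum_k c k * cos_tensor (fun j => k j) x.

(** Fejer means instead of partial sums: they converge uniformly for every element, their
    multipliers lie in [[0, 1]] so the weighted l2 norm does not grow, and the multiplier of the
    zero frequency is 1, which keeps the integral exact. *)
Lemma sob_cos_approx d (alpha : R) (gamma : 'I_d -> R) (f : d.-tuple R -> R) (e : R) :
  (0 < d)%N -> 1 / 2 < alpha < 2 -> (forall j, 0 < gamma j) -> 0 < kappa alpha ->
  carrier (sob alpha gamma) f -> ip_norm (sob alpha gamma) f <= 1 -> 0 < e ->
  exists N (c : {ffun 'I_d -> 'I_N.+1} -> R),
  [/\ \sum_k (c k * \prod_(j < d) freq_weight alpha ((Num.sqrt (kappa alpha))^-1 * gamma j) (k
      j)) ^+ 2 <= 1,
      forall x, cube d x -> `|cos_expansion c x - f x| <= e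
    & c [ffun=> ord0] = cube_int f].
Proof.
move=> d0 a12 g0 k0 cf nf e0.
have /choice [wt Hwt] j : exists wt, spectral_weight alpha (gamma j) wt /\
    spectral1 wt (sob1 alpha (gamma j)).
  by have [wt w1 w2] := spectral_sob1 a12 (g0 j) k0; exists wt.
have wt0 j k : 0 <= wt j k by have [[] ] := Hwt j.
have [cb _ bes _] := spectral_hilbert_tensor d0 wt0 (fun j => (Hwt j).2).
have bf := cb _ cf; have [N HN] := fejer_mean_cvg bf e0.
have fc01 (k : 'I_N.+1) : 0 <= (fejer_coef N.+1 k : R) <= 1.
  rewrite /fejer_coef subr_ge0 lerBlDr lerDl divr_ge0// andbT ler_pdivrMr ?ltr0n// mul1r.
  by rewrite ler_nat ltnW.
exists N, (fun k => (fejer_tensor_coef k : R) * cos_coef (fun j => k j) f); split.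
- apply: (@le_trans _ _ (ip (sob alpha gamma) f f)); last first.
    by rewrite -(@ler_sqrt _ _ 1)// sqrtr1.
  apply: le_trans (bes N.+1 f cf); apply: ler_sum => k _.
  have /andP[t0 t1] : 0 <= (fejer_tensor_coef k : R) <= 1.
    rewrite prodr_ge0 => [|j _]; last by case/andP: (fc01 (k j)).
    by apply: prodr_ile1 => j _; exact: fc01.
  rewrite !exprMn mulrC mulrA ler_wpM2r ?sqr_ge0//.
  apply: (@le_trans _ _ ((\prod_(j < d) freq_weight alpha ((Num.sqrt (kappa alpha))^-1 * gamma
      j) (k j)) ^+ 2)).
    by rewrite ler_piMr ?sqr_ge0// expr_le1.
  rewrite -prodrXl; apply: ler_prod => j _; rewrite sqr_ge0 /=.
  have [[_ w00 wk] _] := Hwt j; rewrite /freq_weight.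
  case: (posnP (k j)) => [->|kp]; first by rewrite w00 /= expr1n.
  apply: le_trans (wk _ kp).
  have s0 : Num.sqrt (kappa alpha) != 0 by rewrite gt_eqF// sqrtr_gt0.
  rewrite -[X in X * _ / _]sqr_sqrtr ?(ltW k0)//.
  rewrite (_ : (k j)%:R `^ (2 * alpha) = ((k j)%:R `^ alpha) ^+ 2); last first.
    by rewrite mulrC powRrM powR_mulrn ?powR_ge0.
  by rewrite le_eqVlt; apply/orP; left; apply/eqP; field; rewrite s0 gt_eqF.
- by move=> x cx; apply: le_trans (HN x cx); rewrite /cos_expansion /fejer_mean.
- rewrite /fejer_tensor_coef big1 => [|j _]; last by rewrite ffunE /fejer_coef mul0r subr0.
  rewrite mul1r; apply: eq_cube_int => x _.
  by rewrite /cos_tensor big1 ?mulr1// => j _; rewrite ffunE.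
Qed.

End SobolevApproximation.

Section ProductsOfCosines.
Context {R : realType}.
Implicit Types (m : int) (x : R).

Lemma cos_sin_2pi_int m : cos (2 * pi * m%:~R) = 1 :> R /\ sin (2 * pi * m%:~R) = 0 :> R.
Proof.
have nat_case (k : nat) : cos (2 * pi * k%:R) = 1 :> R /\ sin (2 * pi * k%:R) = 0 :> R.
  elim: k => [|k [c s]]; first by rewrite mulr0 cos0 sin0.
  rewrite -[k.+1]addn1 natrD mulrDr mulr1 cosD sinD c s !mul1r !mul0r subr0 add0r.
  by rewrite mulrC mulr_natr cos2pi sin2pi.
case: (intP m) => [|k|k]; first by rewrite mulr0 cos0 sin0.
  exact: nat_case.
by rewrite mulrNz mulrN cosN sinN; have [-> ->] := nat_case k.+1; rewrite oppr0.
Qed.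

Lemma cosD2pi_int x m : cos (x + 2 * pi * m%:~R) = cos x.
Proof. by have [c s] := cos_sin_2pi_int m; rewrite cosD c s mulr1 mulr0 subr0. Qed.

(* The tent transformation turns cosines into functions of period one. *)
Lemma cos_tent_frac (k : nat) x :
  cos (k%:R * pi * tent (frac_part x)) = cos (k%:R * (2 * pi * x)).
Proof.
have E : cos (k%:R * (2 * pi * x)) = cos (k%:R * (2 * pi * frac_part x)).
  rewrite -[RHS](cosD2pi_int _ (k%:Z * Num.floor x)) /frac_part; congr cos.
  by rewrite intrM; ring.
rewrite E /tent; set y := frac_part x; case: (leP 0 (2 * y - 1)) => h.
  rewrite ger0_norm// -[LHS]cosN -[RHS](cosD2pi_int _ (- k%:Z)); congr cos.
  by rewrite mulrNz; ring.
by rewrite ltr0_norm//; congr cos; ring.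
Qed.

(** If [n] does not divide [m], then with [th = pi m / n] the sum multiplied by [2 sin th]
    telescopes to [sin (2 pi m - th) + sin th = 0], and [sin th] is nonzero. *)
Lemma average_cos (n : nat) m : (0 < n)%N ->
  n%:R^-1 * \sum_(i < n) cos (i%:R * (2 * pi * m%:~R / n%:R)) = ((n%:Z %| m)%Z)%:R :> R.
Proof.
move=> n0; have nR : n%:R != 0 :> R by rewrite pnatr_eq0 -lt0n.
case: (boolP (n%:Z %| m)%Z) => [/dvdzP[q ->]|nm].
  rewrite (eq_bigr (fun=> 1)) => [|i _].
    by rewrite sumr_const card_ord mulVf.
  rewrite intrM (_ : i%:R * _ = 0 + 2 * pi * (i%:Z * q)%:~R); last by rewrite intrM; field.
  by rewrite cosD2pi_int cos0.
suff -> : \sum_(i < n) cos (i%:R * (2 * pi * m%:~R / n%:R)) = 0 :> R by rewrite mulr0.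
pose th : R := pi * m%:~R / n%:R.
have s0 : sin th != 0.
  have mE := divz_eq m n; set q := (m %/ n)%Z in mE; set r := (m %% n)%Z in mE.
  have rn : 0 <= r < n by rewrite modz_ge0 ?ltz_pmod//= -lt0n.
  have r0 : 0 < r by rewrite lt_neqAle eq_sym; case/andP: rn => -> _; rewrite andbT; apply:
      contra nm => /eqP h; exact/dvdz_mod0P.
  have -> : th = pi * r%:~R / n%:R + pi * q%:~R.
    by rewrite /th mE intrD intrM; field.
  have [_ s2] := cos_sin_2pi_int q.
  have sq : sin (pi * q%:~R) = 0 :> R.
    case: (intP q) => [|k|k]; first by rewrite mulr0 sin0.
      by rewrite mulrC sin_natpi.
    by rewrite mulrNz mulrN sinN mulrC sin_natpi oppr0.
  rewrite sinD sq mulr0 addr0 mulf_neq0//.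
    apply: lt0r_neq0; apply: sin_gt0_pi; apply/andP; split.
      by rewrite divr_gt0 ?mulr_gt0 ?pi_gt0 ?ltr0z ?ltr0n.
    rewrite ltr_pdivrMr ?ltr0n// ltr_pM2l ?pi_gt0//.
    by rewrite -[ltRHS]/(n%:Z%:~R) ltr_int; case/andP: rn.
  have := cos2Dsin2 (pi * q%:~R : R); rewrite sq expr0n addr0 => c2.
  by apply/eqP => c; move: c2; rewrite c expr0n /= => /eqP; rewrite eq_sym oner_eq0.
have tele K : 2 * sin th * \sum_(i < K) cos (i%:R * (2 * pi * m%:~R / n%:R)) =
    sin ((2 * K%:R - 1) * th) + sin th.
  elim: K => [|K IH].
    by rewrite big_ord0 mulr0 mulr0 sub0r mulN1r sinN addNr.
  rewrite big_ord_recr mulrDr IH /=.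
  have -> : K%:R * (2 * pi * m%:~R / n%:R) = 2 * K%:R * th by rewrite /th; ring.
  have -> : (2 * K%:R - 1) * th = 2 * K%:R * th - th by ring.
  have -> : (2 * K.+1%:R - 1) * th = 2 * K%:R * th + th by rewrite -natr1; ring.
  by rewrite sinB sinD; ring.
have := tele n; have -> : (2 * n%:R - 1) * th = 2 * pi * m%:~R - th.
  by rewrite /th; field.
have [c s] := cos_sin_2pi_int m; rewrite sinB c s mul0r mul1r sub0r addNr.
by move/eqP; rewrite !mulf_eq0 (negbTE s0) pnatr_eq0 /= => /eqP.
Qed.

Definition signed_int (p : nat * bool) : int := if p.2 then p.1%:Z else - p.1%:Z.

(* Each frequency has two signs, except that zero is given the sign [true]. *)
Definition sign_count (p : nat * bool) : R := if p.1 == 0%N then p.2%:R else 1.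

(** The coefficient of one exponential in [cos t = (e^(it) + e^(-it)) / 2]; the frequency zero keeps
    a single exponential. *)
Definition sign_weight (p : nat * bool) : R :=
  sign_count p * (if p.1 == 0%N then 1 else 2^-1).

Lemma sum_sign_count (k : nat) : \sum_(s : bool) sign_count (k, s) = cos_scale k ^+ 2.
Proof. by rewrite big_bool /= cos_scale_sqr /sign_count /=; case: eqP; rewrite ?addr0. Qed.

Local Notation expi t := (Complex (cos t) (sin t)).

Lemma expiD (s t : R) : expi (s + t) = expi s * expi t.
Proof. by rewrite cosD sinD; congr Complex; rewrite addrC mulrC. Qed.

(** The product of the factors [(e^(it) + e^(-it)) / 2] is expanded over all sign patterns, and real
    parts are taken. *)
Lemma prod_cos_signs d (k : 'I_d -> nat) (t : 'I_d -> R) :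
  \prod_(j < d) cos ((k j)%:R * t j) =
  \sum_(s : {ffun 'I_d -> bool}) (\prod_(j < d) sign_weight (k j, s j)) *
     cos (\sum_(j < d) (signed_int (k j, s j))%:~R * t j).
Proof.
pose toC (x : R) : R[i] := real_complex R x.
have E (s : {ffun 'I_d -> bool}) :
    \prod_(j < d) (toC (sign_weight (k j, s j)) * expi ((signed_int (k j, s j))%:~R * t j)) =
    toC (\prod_(j < d) sign_weight (k j, s j)) *
    expi (\sum_(j < d) (signed_int (k j, s j))%:~R * t j).
  rewrite big_split /= /toC rmorph_prod; congr (_ * _).
  by rewrite (big_morph (fun t => expi t : R[i]) (id1 := 1) (op1 := *%R) expiD) ?cos0 ?sin0.
have P : toC (\prod_(j < d) cos ((k j)%:R * t j)) = \sum_(s : {ffun 'I_d -> bool})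
    toC (\prod_(j < d) sign_weight (k j, s j)) *
    expi (\sum_(j < d) (signed_int (k j, s j))%:~R * t j).
  rewrite -(eq_bigr _ (fun s _ => E s)).
  rewrite -(bigA_distr_bigA (fun j s => toC (sign_weight (k j, s)) *
    expi ((signed_int (k j, s))%:~R * t j))) /toC rmorph_prod.
  apply: eq_bigr => j _; rewrite big_bool /= /sign_weight /sign_count /signed_int /=.
  case: (k j) => [|m] /=.
    by rewrite oppr0 !mul0r cos0 sin0 !mulr1 addr0.
  rewrite mul1r mulrNz mulNr cosN sinN -mulrDr; apply/eqP; rewrite eq_complex /=.
  by rewrite subrr mulr0 mul0r addr0 subr0 mulrDr -mulrDl; apply/andP; split; apply/eqP; field.
have := congr1 (@complex.Re R) P; rewrite /= => ->.
rewrite (big_morph (@complex.Re R) (id1 := 0) (op1 := +%R))//=; last by case=> a b [].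
by apply: eq_bigr => s _; rewrite /= mul0r subr0.
Qed.

End ProductsOfCosines.

Section LatticeError.
Context {R : realType}.

Definition sfreq (d N : nat) : finType := {ffun 'I_d -> 'I_N.+1 * bool}.

Definition sfreq0 d N : sfreq d N := [ffun=> (ord0, true)].

Definition sign_mult d N (l : sfreq d N) : R :=
  \prod_(j < d) sign_count ((l j).1 : nat, (l j).2).

Definition sfreq_weight d N (r : 'I_d -> nat -> R) (l : sfreq d N) : R :=
  \prod_(j < d) r j (l j).1.

Definition in_dual d N (n : nat) (z : 'I_d -> nat) (l : sfreq d N) : bool :=
  (n%:Z %| \sum_(j < d) signed_int ((l j).1 : nat, (l j).2) * (z j)%:Z)%Z.

Lemma sign_count01 (p : nat * bool) : sign_count p = 0 :> R \/ sign_count p = 1 :> R.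
Proof. by rewrite /sign_count; case: eqP => _; [case: p.2; [right|left]|right]. Qed.

Lemma sign_mult01 d N (l : sfreq d N) : sign_mult l = 0 \/ sign_mult l = 1.
Proof.
rewrite /sign_mult; elim/big_ind: _ => [|x y|j _]; [by right| |exact: sign_count01].
by move=> [->|->] [->|->]; rewrite ?mulr0 ?mulr1; [left|left|left|right].
Qed.

Lemma sign_mult_ge0 d N (l : sfreq d N) : 0 <= sign_mult l.
Proof. by case: (sign_mult01 l) => ->. Qed.

Lemma sfreq_neq0 d N (l : sfreq d N) : l != sfreq0 d N -> sign_mult l != 0 ->
  exists j, (l j).1 != ord0.
Proof.
move=> l0 sl; apply/existsP; rewrite -negb_forall; apply: contra l0 => /forallP h.
apply/eqP/ffunP => j; rewrite ffunE; have /eqP hj := h j.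
case E : (l j) hj => [k s] /= ->; congr pair; apply/negbNE; apply: contra sl => sF.
rewrite /sign_mult (bigD1 j)//= E /sign_count /= (negbTE sF).
by have /eqP := h j; rewrite E /= => ->; rewrite eqxx mul0r.
Qed.

Lemma sum_sfreq d N (F : {ffun 'I_d -> 'I_N.+1} -> {ffun 'I_d -> bool} -> R) :
  \sum_k \sum_s F k s =
  \sum_(l : sfreq d N) F [ffun j => (l j).1] [ffun j => (l j).2].
Proof.
rewrite pair_bigA /=.
pose h (l : sfreq d N) := ([ffun j => (l j).1] : {ffun 'I_d -> 'I_N.+1}, [ffun j => (l j).2] :
    {ffun 'I_d -> bool}).
rewrite (reindex h); last first.
  exists (fun p : {ffun 'I_d -> 'I_N.+1} * {ffun 'I_d -> bool} => [ffun j => (p.1 j, p.2 j)])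
      => [l|p] _.
    by apply/ffunP => j; rewrite !ffunE; case: (l j).
  by case: p => k s; congr pair; apply/ffunP => j; rewrite !ffunE.
by [].
Qed.

Lemma tent_lattice_cos_tensor d n z (k : 'I_d -> nat) : (0 < n)%N ->
  tent_lattice_rule n z (cos_tensor k) =
  (\prod_(j < d) cos_scale (k j)) *
  \sum_(s : {ffun 'I_d -> bool}) (\prod_(j < d) sign_weight (k j, s j)) *
    ((n%:Z %| \sum_(j < d) signed_int (k j, s j) * (z j)%:Z)%Z)%:R :> R.
Proof.
move=> n0; have nR : n%:R != 0 :> R by rewrite pnatr_eq0 -lt0n.
rewrite /tent_lattice_rule.
rewrite (eq_bigr (fun i : 'I_n => (\prod_(j < d) cos_scale (k j)) *
    \sum_(s : {ffun 'I_d -> bool}) (\prod_(j < d) sign_weight (k j, s j)) *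
    cos (i%:R * (2 * pi * (\sum_(j < d) signed_int (k j, s j) * (z j)%:Z)%:~R / n%:R)))) => [|i _].
  rewrite -mulr_sumr mulrCA; congr (_ * _); rewrite exchange_big mulr_sumr /=.
  by apply: eq_bigr => s _; rewrite -mulr_sumr mulrCA average_cos.
rewrite /cos_tensor; under eq_bigr do rewrite cos_basisE !tnth_map tnth_ord_tuple cos_tent_frac.
rewrite big_split /= prod_cos_signs; congr (_ * _); apply: eq_bigr => s _; congr (_ * cos _).
rewrite rmorph_sum /= mulr_sumr mulr_suml mulr_sumr; apply: eq_bigr => j _.
by rewrite intrM; field.
Qed.

(* The factor cos_scale k / 2 of each nonzero frequency comes from splitting a cosine
   coefficient evenly between the 2^m sign patterns of m nonzero frequencies. *)
Lemma tent_lattice_error d N (c : {ffun 'I_d -> 'I_N.+1} -> R) (r : 'I_d -> nat -> R) :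
  \sum_k (c k * \prod_(j < d) r j (k j)) ^+ 2 <= 1 ->
  exists beta : sfreq d N -> R,
  [/\ forall l, 0 <= beta l,
      \sum_l sign_mult l * (beta l * sfreq_weight r l) ^+ 2 <= 1
    & forall n z, (0 < n)%N ->
      `|c [ffun=> ord0] - tent_lattice_rule n z (cos_expansion c)| <=
      \sum_(l | l != sfreq0 d N) sign_mult l * (beta l * (in_dual n z l)%:R)].
Proof.
move=> hc; pose v (k : nat) : R := cos_scale k / (if k == 0%N then 1 else 2).
have v0 k : 0 <= v k by rewrite divr_ge0 ?cos_scale_ge0//; case: eqP.
pose V (k : {ffun 'I_d -> 'I_N.+1}) := \prod_(j < d) v (k j).
have V0 k : 0 <= V k by apply: prodr_ge0.
exists (fun l : sfreq d N => `|c [ffun j => (l j).1]| * V [ffun j => (l j).1]); split.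
- by move=> l; rewrite mulr_ge0.
- have -> : \sum_(l : sfreq d N) sign_mult l * (`|c [ffun j => (l j).1]| * V [ffun j => (l
    j).1] * sfreq_weight r l) ^+ 2 =
      \sum_(k : {ffun 'I_d -> 'I_N.+1}) \sum_(s : {ffun 'I_d -> bool}) (\prod_(j < d)
          sign_count (k j : nat, s j)) * (`|c k| * V k * \prod_(j < d) r j (k j)) ^+ 2.
    rewrite sum_sfreq; apply: eq_bigr => l _; rewrite /sign_mult /sfreq_weight.
    by congr (_ * (_ * _) ^+ 2); apply: eq_bigr => j _; rewrite !ffunE.
  apply: le_trans hc; apply: ler_sum => k _; rewrite -mulr_suml.
  rewrite -(bigA_distr_bigA (fun j s => sign_count (k j : nat, s))) /=.
  set S := \prod_(j < d) \sum_s _; set P := \prod_(j < d) r j _.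
  rewrite (_ : S * _ = (c k * P) ^+ 2 * (S * V k ^+ 2)); last first.
    by rewrite !exprMn real_normK ?num_real//; ring.
  (* In each coordinate the factor is 1: a nonzero frequency has 2 signs and [v ^+ 2 = 2 / 4]. *)
  rewrite ler_piMr ?sqr_ge0// /S /V -prodrXl -big_split /= le_eqVlt; apply/orP; left; apply/eqP.
  rewrite big1// => j _; rewrite sum_sign_count /v exprMn cos_scale_sqr.
  by case: eqP => _; [rewrite invr1 expr1n !mulr1 | field].
- move=> n z n0.
  have QE : tent_lattice_rule n z (cos_expansion c) =
      \sum_(k : {ffun 'I_d -> 'I_N.+1}) c k * tent_lattice_rule n z (cos_tensor (fun j => k j)).
    rewrite /tent_lattice_rule /cos_expansion exchange_big mulr_sumr; apply: eq_bigr => k _.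
    by rewrite -mulr_sumr mulrCA.
  pose G (l : sfreq d N) := c [ffun j => (l j).1] * (sign_mult l * V [ffun j => (l j).1] *
      (in_dual n z l)%:R).
  have {}QE : tent_lattice_rule n z (cos_expansion c) = \sum_l G l.
    rewrite QE.
    transitivity (\sum_(k : {ffun 'I_d -> 'I_N.+1}) \sum_(s : {ffun 'I_d -> bool}) c k *
        ((\prod_(j < d) sign_count (k j : nat, s j)) * V k *
       ((n%:Z %| \sum_(j < d) signed_int (k j : nat, s j) * (z j)%:Z)%Z)%:R)).
      apply: eq_bigr => k _; rewrite tent_lattice_cos_tensor// mulr_sumr mulr_sumr.
      apply: eq_bigr => s _; congr (_ * _); rewrite mulrA; congr (_ * _).
      rewrite /V -!big_split; apply: eq_bigr => j _ /=; rewrite /sign_weight /v /=.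
      by case: eqP => _; rewrite ?invr1 //; ring.
    rewrite sum_sfreq; apply: eq_bigr => l _; rewrite /G /sign_mult /in_dual.
    congr (_ * (_ * _ * (_ %| _)%Z%:R)).
      by apply: eq_bigr => j _; rewrite !ffunE.
    by apply: eq_bigr => j _; rewrite !ffunE.
  have G0 : G (sfreq0 d N) = c [ffun=> ord0].
    rewrite /G (_ : [ffun j => _] = [ffun=> ord0]); last by apply/ffunP => j; rewrite !ffunE.
    rewrite /V /sign_mult /in_dual !big1 => [|j _|j _|j _]; rewrite ?ffunE.
    - by rewrite dvdz0 !mulr1.
    - by rewrite /= mul0r.
    - by rewrite /v /cos_scale eqxx divr1.
    - by rewrite /sign_count eqxx.
  rewrite QE (bigD1 (sfreq0 d N))//= G0 opprD addrA subrr sub0r normrN.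
  apply: le_trans (ler_norm_sum _ _ _) _; apply: ler_sum => l _.
  rewrite /G normrM !normrM (ger0_norm (sign_mult_ge0 l)) (ger0_norm (V0 _)) normr_nat.
  by rewrite le_eqVlt; apply/orP; left; apply/eqP; ring.
Qed.

End LatticeError.

(** * Probability that a frequency lies in the dual lattice *)

Section DualLatticeProbability.
Context {R : realType}.
Variables (nmax d : nat).

Definition generator (n : nat) : pred {ffun 'I_d -> 'I_nmax.+1} :=
  fun z => [forall j, 0 < z j < n]%N.

Lemma card_positive_below (n : nat) : (0 < n <= nmax)%N ->
  #|[pred a : 'I_nmax.+1 | 0 < a < n]%N| = n.-1.
Proof.
move=> /andP[n0 nN].
have f (i : 'I_n.-1) : (i.+1 < nmax.+1)%N by case: i => i /=; lia.
rewrite -[RHS]card_ord -(card_imset (fun i : 'I_n.-1 => true) (f := fun i => Ordinal (f i)));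
    last first.
  by move=> i i' /(congr1 val) /= [] ?; exact: val_inj.
apply: eq_card => a; rewrite inE; apply/idP/imsetP.
  move=> /andP[a0 an]; have h : (a.-1 < n.-1)%N by lia.
  by exists (Ordinal h) => //; apply: val_inj => /=; lia.
by move=> [i _ ->] /=; case: i => i /=; lia.
Qed.

Lemma card_generator (n : nat) : (0 < n <= nmax)%N -> #|generator n| = (n.-1 ^ d)%N.
Proof.
move=> nN; pose A := [pred a : 'I_nmax.+1 | 0 < a < n]%N.
have -> : #|generator n| = #|(ffun_on A : simpl_pred {ffun 'I_d -> 'I_nmax.+1})|.
  by apply: eq_card => z; rewrite !unfold_in; apply/forallP/forallP => h j; have := h j;
      rewrite ?inE.
by rewrite card_ffun_on card_ord card_positive_below.
Qed.

(** [(l j).1] is invertible modulo the prime [n], so the other components determine [z j] modulo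
    [n], hence [z j] itself. Erasing the component [j], the map [g], is therefore injective on these
    generators. *)
Lemma card_dual_generator N (n : nat) (l : sfreq d N) (j : 'I_d) :
  prime n -> (n <= nmax)%N -> ~~ (n %| (l j).1)%N ->
  (#|[pred z | generator n z && in_dual n (fun j => z j) l]| <= n.-1 ^ d.-1)%N.
Proof.
move=> pn nN nj; have n1 := prime_gt1 pn.
pose A := [pred a : 'I_nmax.+1 | 0 < a < n]%N.
pose F (i : 'I_d) : pred 'I_nmax.+1 := if i == j then pred1 ord0 else A.
have cA : #|A| = n.-1 by rewrite card_positive_below// nN prime_gt0.
have -> : (n.-1 ^ d.-1)%N = #|family F|.
  rewrite card_family foldrE big_map big_enum /= (bigD1 j)//= /F eqxx card1 mul1n.
  rewrite (eq_bigr (fun=> n.-1)) => [|i /negbTE ->//].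
  by rewrite prod_nat_const cardC1 card_ord.
set S := [pred z | _].
pose g (z : {ffun 'I_d -> 'I_nmax.+1}) : {ffun 'I_d -> 'I_nmax.+1} := [ffun i => if i == j then
    ord0 else z i].
rewrite -(card_in_imset (f := g) (D := S)); last first.
  move=> z z' /andP[gz dz] /andP[gz' dz'] /ffunP E; apply/ffunP => i; have := E i.
  rewrite !ffunE; case: eqP => [->|//] _; apply: val_inj => /=.
  have dd : (n%:Z %| signed_int ((l j).1 : nat, (l j).2) * ((z j)%:Z - (z' j)%:Z))%Z.
    have := rpredB dz dz'; rewrite -sumrB (bigD1 j)//= big1 ?addr0 => [|i' ij].
      by rewrite -mulrBr.
    by have := E i'; rewrite !ffunE (negbTE ij) => ->; rewrite subrr.
  have cop : coprimez n%:Z (signed_int ((l j).1 : nat, (l j).2)).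
    by rewrite coprimezE prime_coprime// /signed_int /=; case: (l j).2; rewrite ?abszN.
  move: dd; rewrite Gauss_dvdzr// -eqz_mod_dvd !modz_nat eqz_nat.
  have /andP[_ h1] := forallP gz j; have /andP[_ h2] := forallP gz' j.
  by rewrite !modn_small// => /eqP.
apply: subset_leq_card; apply/fintype.subsetP => y /imsetP[z /andP[gz _] ->].
apply/familyP => i; rewrite ffunE /F; case: eqP => _; first by rewrite inE.
exact: (forallP gz i).
Qed.

Definition prime_count : nat := #|[set n : 'I_nmax.+1 | admissible nmax n]|%SET.

Definition common_prime_count N (l : sfreq d N) : nat :=
  #|[set n : 'I_nmax.+1 | admissible nmax n && [forall j, n %| (l j).1]%N]|%SET.

Notation prob := (@draw_prob R nmax d).

Lemma draw_prob_ge0 w : 0 <= prob w.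
Proof. by rewrite /draw_prob; case: ifP => // _; rewrite mulr_ge0// invr_ge0. Qed.

(** Conditioning on the prime: given [n], the generator is uniform among [(n - 1) ^ d], so [b n]
    bounds the conditional probability of [B]. *)
Lemma draw_sum_bound (B : pred (nat * {ffun 'I_d -> 'I_nmax.+1})) (b : 'I_nmax.+1 -> R) :
  (forall n : 'I_nmax.+1, admissible nmax n ->
     #|[pred z | generator n z && B (n : nat, z)]|%:R <= b n * (n.-1 ^ d)%N%:R) ->
  \sum_w prob w * (B (w.1 : nat, w.2))%:R <=
  prime_count%:R^-1 * \sum_(n : 'I_nmax.+1 | admissible nmax n) b n.
Proof.
move=> hb.
rewrite -(pair_bigA _ (fun n z => prob (n, z) * (B (n : nat, z))%:R)) /= [X in _ <= _ *
    X]big_mkcond mulr_sumr.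
apply: ler_sum => n _; rewrite /draw_prob /=.
case: (boolP (admissible nmax n)) => an /=; last first.
  by rewrite mulr0 big1// => z _; rewrite mul0r.
have n1 : (0 < n.-1)%N by case/and3P: an => /prime_gt1; case: (n : nat) => [|[]].
rewrite -/(prime_count).
rewrite (eq_bigr (fun z => prime_count%:R^-1 * (((n.-1 ^ d)%N%:R)^-1 * (generator n z && B (n :
    nat, z))%:R))) => [|z _].
  rewrite -!mulr_sumr ler_wpM2l ?invr_ge0//.
  rewrite ler_pdivrMl ?ltr0n ?expn_gt0 ?n1// mulrC.
  apply: le_trans (hb n an); rewrite le_eqVlt; apply/orP; left; apply/eqP.
  by rewrite -sum1_card natr_sum [RHS]big_mkcond; apply: eq_bigr => z _; rewrite inE /=; case: andP.
by rewrite -/(generator n z); case: (generator n z); rewrite /= ?mulr0 ?mul0r// mulrA.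
Qed.

(** An inequality, because the mass function is 0 if no prime is admissible; it is enough for the
    Chernoff and mean bounds. *)
Lemma draw_prob_sum_le1 : \sum_w prob w <= 1.
Proof.
have := @draw_sum_bound (fun=> true) (fun=> 1) _.
under eq_bigr do rewrite mulr1.
move=> /(_ _)/le_trans; apply.
  move=> n /and3P[/prime_gt0 n0 _ nN]; rewrite mul1r ler_nat -card_generator ?n0//.
  by apply/subset_leq_card/fintype.subsetP => z; rewrite !inE andbT.
rewrite sumr_const (_ : #|_| = prime_count); last by rewrite /prime_count cardsE.
case: (posnP prime_count) => [->|p0]; first by rewrite mulr0n mulr0.
by rewrite mulVf// pnatr_eq0 -lt0n.
Qed.

(** If the prime [n] divides every entry of [l], the conditional probability is bounded by 1, which
    yields the second term; otherwise it is at most [1 / (n - 1)], and [n - 1 >= nmax / 2] because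
    [n] exceeds [uphalf nmax]. *)
Lemma draw_prob_in_dual N (l : sfreq d N) : (2 <= nmax)%N -> l != sfreq0 d N ->
  sign_mult l != 0 :> R ->
  \sum_w prob w * (in_dual w.1 (fun j => w.2 j) l)%:R <=
  2 / nmax%:R + (common_prime_count l)%:R / prime_count%:R.
Proof.
move=> nmax2 l0 sl.
have [j0 hj0] := sfreq_neq0 l0 sl.
pose all_div (n : nat) := [forall j, n %| (l j).1]%N.
have := @draw_sum_bound (fun p => in_dual p.1 (fun j => p.2 j) l)
  (fun n => 2 / nmax%:R + (all_div n)%:R) _.
move=> /(_ _)/le_trans; apply.
  move=> n /and3P[pn hn nN]; have n1 := prime_gt1 pn.
  case: (boolP (all_div n)) => [_|/forallPn[j nj]].
    apply: (@le_trans _ _ (1 * (n.-1 ^ d)%N%:R)); last by rewrite ler_wpM2r// lerDr divr_ge0.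
    rewrite mul1r ler_nat -card_generator ?nN ?(ltnW n1)//.
    by apply/subset_leq_card/fintype.subsetP => z; rewrite !inE => /andP[].
  rewrite addr0; apply: (@le_trans _ _ (n.-1 ^ d.-1)%N%:R).
    by rewrite ler_nat; exact: card_dual_generator nj.
  have -> : (n.-1 ^ d)%N = (n.-1 * n.-1 ^ d.-1)%N.
    by rewrite -expnS; congr (_ ^ _)%N; have := ltn_ord j; lia.
  rewrite natrM mulrA ler_peMl// mulrAC ler_pdivlMr ?ltr0n; last by lia.
  by rewrite mul1r -natrM ler_nat; lia.
rewrite big_split /= mulrDr lerD//.
  rewrite sumr_const (_ : #|_| = prime_count); last by rewrite /prime_count cardsE.
  case: (posnP prime_count) => [->|p0]; first by rewrite mulr0n mulr0 divr_ge0.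
  by rewrite -[X in _ * X]mulr_natl mulrA mulVf ?mul1r// pnatr_eq0 -lt0n.
rewrite mulrC ler_wpM2r ?invr_ge0// -natr_sum ler_nat /common_prime_count -sum1_card big_mkcond
    [leqRHS]big_mkcond.
by apply: leq_sum => n _; rewrite inE; case: (admissible nmax n) => //=; rewrite -/(all_div n);
    case: (all_div n).
Qed.

End DualLatticeProbability.

(** * Amplification by the median *)

Section MedianOfIndependentValues.
Context {R : realType}.

(** In sorted order, if the median is below [a] then the first [m + 1] entries are at least as far
    from [a], otherwise the last [m + 1] are. *)
Lemma median_far (s : seq R) (a c : R) (m : nat) : size s = (2 * m + 1)%N ->
  c < `|a - median s| -> (m < count (fun x => (c < `|a - x|)%R) s)%N.
Proof.
move=> ss hc; pose s' := sort (fun x y : R => x <= y) s.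
have ms : size s' = (2 * m + 1)%N by rewrite size_sort.
have mE : median s = nth 0 s' m by rewrite /median ss; congr nth; lia.
have tot : total (fun x y : R => x <= y) by move=> x y; exact: le_total.
have srt : sorted (fun x y : R => x <= y) s' by exact: sort_sorted.
have mono i j : (i < 2 * m + 1)%N -> (j < 2 * m + 1)%N -> (i <= j)%N -> nth 0 s' i <= nth 0 s' j.
  move=> hi hj; apply: (sorted_leq_nth _ _ 0 srt); rewrite ?inE ?ms//.
  by move=> y x z; exact: le_trans.
rewrite -(permP (_ : perm_eq s' s)); last by rewrite perm_sort.
rewrite mE in hc; case: (ltP (nth 0 s' m) a) => h.
  rewrite -(cat_take_drop m.+1 s') count_cat; apply: leq_trans (leq_addr _ _).
  have st : size (take m.+1 s') = m.+1 by rewrite size_take ms; case: ifP => //; lia.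
  suff : all (fun x => (c < `|a - x|)%R) (take m.+1 s') by rewrite all_count => /eqP ->; rewrite st.
  apply/(all_nthP 0) => i; rewrite st => im; rewrite nth_take//; apply: lt_le_trans hc _.
  have {}hm : nth 0 s' i <= nth 0 s' m by apply: mono => //; lia.
  by rewrite !gtr0_norm ?subr_gt0 ?(le_lt_trans hm)// lerB.
rewrite -(cat_take_drop m s') count_cat; apply: leq_trans (leq_addl _ _).
have st : size (drop m s') = m.+1 by rewrite size_drop ms; lia.
suff : all (fun x => (c < `|a - x|)%R) (drop m s') by rewrite all_count => /eqP ->; rewrite st.
apply/(all_nthP 0) => i; rewrite st => im; rewrite nth_drop; apply: lt_le_trans hc _.
have hm : nth 0 s' m <= nth 0 s' (m + i) by apply: mono; lia.
by rewrite !ler0_norm ?subr_le0 ?(le_trans h)// lerN2 lerD2l lerN2.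
Qed.

Variables (Omega : finType) (p : Omega -> R).
Hypotheses (p_ge0 : forall w, 0 <= p w) (p_le1 : \sum_w p w <= 1).

(** The indicator is at most 15 to the number of bad draws minus [m + 1], whose mean factors over
    the draws. Each factor is at most [1 + 14/16 = 15/8], and
    [(15/8)^(2m+1) / 15^(m+1) = (15/64)^m / 8]. The base 15 is optimal for failure probability
    1/16. *)
Lemma chernoff (bad : pred Omega) (m : nat) : \sum_w p w * (bad w)%:R <= 1 / 16 ->
  \sum_(w : {ffun 'I_(2 * m + 1) -> Omega}) (\prod_r p (w r)) *
    (m < #|[pred r | bad (w r)]|)%N%:R <= 4^-1 ^+ m / 8.
Proof.
move=> hb; apply: (@le_trans _ _ (\sum_(w : {ffun 'I_(2 * m + 1) -> Omega})
    15^-1 ^+ m.+1 * \prod_r (p (w r) * (if bad (w r) then 15 else 1)))).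
  apply: ler_sum => w _; rewrite big_split /= mulrCA; apply: ler_wpM2l.
    exact: prodr_ge0.
  rewrite -big_mkcond prodr_const /=.
  case: ltnP => hm; last by rewrite mulr_ge0// exprn_ge0.
  rewrite exprVn mulrC ler_pdivlMr ?exprn_gt0// mul1r.
  by rewrite ler_weXn2l// ler1n.
rewrite -mulr_sumr -(bigA_distr_bigA (fun _ w => p w * (if bad w then 15 else 1))) /=.
rewrite prodr_const card_ord; set S := \sum_w _.
have S1 : 0 <= S <= 15 / 8.
  apply/andP; split.
    by apply: sumr_ge0 => w _; rewrite mulr_ge0//; case: ifP.
  have -> : S = \sum_w p w + 14 * \sum_w p w * (bad w)%:R.
    rewrite mulr_sumr -big_split; apply: eq_bigr => w _ /=.
    by case: (bad w) => /=; ring.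
  by move: p_le1 hb; lra.
have -> : (4^-1 ^+ m / 8 : R) = 15^-1 ^+ m.+1 * ((15 / 4) ^+ m * (15 / 8)).
  have {1}-> : 4^-1 = 15^-1 * (15 / 4) :> R by field.
  by rewrite exprMn exprS; move: (15^-1 ^+ m) ((15 / 4) ^+ m) => x y; field.
apply: ler_wpM2l; first by rewrite exprn_ge0.
case/andP: S1 => S0 S1; rewrite addn1 exprSr exprM.
apply: ler_pM => //; first by rewrite !exprn_ge0.
apply: lerXn2r; rewrite ?nnegrE ?exprn_ge0//.
apply: (@le_trans _ _ ((15 / 8) ^+ 2)); first by apply: lerXn2r; rewrite ?nnegrE.
by rewrite expr2; lra.
Qed.

(** If at most [m] draws are bad the median is within [c]; otherwise it is still one of the drawn
    values and errs by at most [B], on an event whose probability [chernoff] bounds. *)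
Lemma expected_median_error (Q : Omega -> R) (a c B : R) (m : nat) :
  0 <= c -> 0 <= B -> (forall w, p w != 0 -> `|a - Q w| <= B) ->
  \sum_w p w * (c < `|a - Q w|)%R%:R <= 1 / 16 ->
  \sum_(w : {ffun 'I_(2 * m + 1) -> Omega}) (\prod_r p (w r)) *
    `|a - median [seq Q (w r) | r : 'I_(2 * m + 1)]| <= c + B * (4^-1 ^+ m / 8).
Proof.
move=> c0 B0 hB hbad; pose bad w := c < `|a - Q w|.
apply: (@le_trans _ _ (\sum_(w : {ffun 'I_(2 * m + 1) -> Omega})
   (c * \prod_r p (w r) + B * ((\prod_r p (w r)) * (m < #|[pred r | bad (w r)]|)%N%:R)))).
  apply: ler_sum => w _; case: (eqVneq (\prod_r p (w r)) 0) => [->|pw].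
    by rewrite !mul0r !mulr0 addr0.
  rewrite [c * _]mulrC [B * _]mulrCA -mulrDr ler_wpM2l ?prodr_ge0//.
  set s := [seq _ | _ in _].
  have ss : size s = (2 * m + 1)%N by rewrite size_map -cardE card_ord.
  case: (leP `|a - median s| c) => h; first by rewrite (le_trans h)// lerDl mulr_ge0.
  have := median_far ss h; rewrite count_map.
  rewrite (_ : count _ _ = #|[pred r | bad (w r)]|); last first.
    by rewrite cardE /enum_mem size_filter count_filter; apply: eq_count => r; rewrite /= inE andbT.
  move=> ->; rewrite mulr1 (@le_trans _ _ B)// ?lerDr//.
  have : median s \in s.
    by rewrite /median -(mem_sort (fun x y : R => x <= y)) mem_nth// size_sort ss; lia.
  move=> /mapP[r _ ->]; apply: hB; apply: contra pw => /eqP pr.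
  by rewrite (bigD1 r)//= pr mul0r.
rewrite big_split /= -!mulr_sumr lerD//; last by rewrite ler_wpM2l// chernoff.
rewrite ler_piMr// -(bigA_distr_bigA (fun _ w => p w)) /= prodr_const card_ord.
by rewrite exprn_ile1// sumr_ge0.
Qed.

(** Markov's inequality on the event [A] bounds the probability of an error above [32 M] by 1/32;
    with 1/32 for the complement this makes the 1/16 of [chernoff]. *)
Lemma median_of_means_error (Q : Omega -> R) (A : pred Omega) (a M B : R) (m : nat) :
  0 < M -> 0 <= B -> (forall w, p w != 0 -> `|a - Q w| <= B) ->
  \sum_w p w * (~~ A w)%:R <= 1 / 32 ->
  \sum_w p w * (`|a - Q w| * (A w)%:R) <= M ->
  \sum_(w : {ffun 'I_(2 * m + 1) -> Omega}) (\prod_r p (w r)) *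
    `|a - median [seq Q (w r) | r : 'I_(2 * m + 1)]| <= 32 * M + B * (4^-1 ^+ m / 8).
Proof.
move=> M0 B0 hB hA hM; apply: expected_median_error => //; first by rewrite mulr_ge0 ?ltW.
have -> : 1 / 16 = 1 / 32 + (32 * M)^-1 * M :> R by field; rewrite gt_eqF.
apply: le_trans (lerD hA (ler_wpM2l _ hM)); last by rewrite invr_ge0 mulr_ge0 ?ltW.
rewrite mulr_sumr -big_split /=; apply: ler_sum => w _.
rewrite mulrCA -mulrDr; apply: ler_wpM2l => //.
case: (A w); rewrite /= ?add0r ?mulr0 ?addr0 ?mulr1; last by case: (_ < _).
case: ltP => h; last by rewrite mulr_ge0// invr_ge0 mulr_ge0 ?ltW.
by rewrite ler_pdivlMl ?mulr_gt0// mulr1 ltW.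
Qed.

End MedianOfIndependentValues.

(** * Zeta values and weighted sums over frequencies *)

Section Zeta.
Context {R : realType}.

(* Pairing the terms 2k and 2k+1 gives S(2n+1) <= 1 + 2^(1-s) S(n). *)
Lemma zeta_partial_sum_bound (s : R) (n : nat) : 1 < s ->
  series (fun k => k.+1%:R `^ (- s)) n <= (1 - 2 * 2 `^ (- s))^-1.
Proof.
move=> s1; pose u (k : nat) : R := k.+1%:R `^ (- s).
have u0 k : 0 <= u k by exact: powR_ge0.
have u_anti i j : (i <= j)%N -> u j <= u i.
  move=> ij; rewrite /u !powRN lef_pV2 ?posrE ?powR_gt0 ?ltr0n//.
  by apply: ge0_ler_powR; rewrite ?nnegrE ?ler_nat ?(le_trans _ (ltW s1)).
have half : 2 `^ (- s) < 2^-1 :> R.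
  rewrite powRN ltf_pV2 ?posrE ?powR_gt0// -[ltLHS]powRr1//.
  by rewrite /powR !pnatr_eq0 /= ltr_expR ltr_pM2r ?ln_gt0 ?ltr1n.
have step m : series u (2 * m + 1)%N <= 1 + 2 * 2 `^ (- s) * series u m.
  elim: m => [|m IH].
    by rewrite /series /= big_nat1 big_geq// mulr0 addr0 /u powR1.
  rewrite (_ : (2 * m.+1 + 1 = (2 * m + 1).+2)%N); last by lia.
  rewrite !seriesSr (_ : 2 * 2 `^ (- s) * (_ + u m) = 2 * 2 `^ (- s) * series u m + (u (2 * m +
      1)%N + u (2 * m + 1)%N)); last first.
    have -> : u (2 * m + 1)%N = 2 `^ (- s) * u m.
      by rewrite /u -powRM// -natrM; congr (_%:R `^ _); lia.
    by ring.
  rewrite [leRHS]addrA -[leLHS]addrA; apply: lerD => //; rewrite lerD2l; apply: u_anti.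
  by lia.
have mono : series u n <= series u (2 * n + 1)%N.
  by apply: nondecreasing_series => //; lia.
rewrite -[leRHS]mul1r ler_pdivlMr; last by lra.
by have := step n; move: mono; set a := series u n; nra.
Qed.

(** [zeta] is a [limn], meaningful only once the series converges; the bound on the partial sums
    provides this by monotonicity. *)
Lemma zeta_ge_partial_sum (s : R) (n : nat) : 1 < s ->
  \sum_(k < n) k.+1%:R `^ (- s) <= zeta s.
Proof.
move=> s1; pose u (k : nat) : R := k.+1%:R `^ (- s).
have nd : nondecreasing_seq (series u).
  by apply: nondecreasing_series => k _ _; exact: powR_ge0.
have cv : cvgn (series u).
  apply: nondecreasing_is_cvgn => //; exists (1 - 2 * 2 `^ (- s))^-1 => _ [m _ <-].
  exact: zeta_partial_sum_bound.
by have := nondecreasing_cvgn_le nd cv n; rewrite /series /= big_mkord.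
Qed.

Lemma zeta_ge1 (s : R) : 1 < s -> 1 <= zeta s.
Proof. by move=> s1; have := zeta_ge_partial_sum 1 s1; rewrite big_ord1 powR1. Qed.

End Zeta.

Section WeightedSums.
Context {R : realType}.
Variables (L : finType) (P : pred L) (U r : L -> R) (lambda W : R).
Hypotheses (lambda_gt : 1 / 2 < lambda) (W_gt0 : 0 < W).
Hypotheses (U01 : forall l, U l = 0 \/ U l = 1) (r_gt0 : forall l, 0 < r l).
Hypothesis sum_le : \sum_(l | P l) U l * r l `^ (- lambda^-1) <= W.

Let U_ge0 l : 0 <= U l.
Proof. by case: (U01 l) => ->. Qed.

Let lambda_gt0 : 0 < lambda. Proof. by move: lambda_gt; lra. Qed.

Let inv2E l : (r l) ^- 2 = r l `^ (- lambda^-1) * r l `^ (lambda^-1 - 2).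
Proof.
rewrite -powRD; last by rewrite (gt_eqF (r_gt0 l)) implybT.
by rewrite addrA addNr sub0r powR_invn// ltW.
Qed.

(** Each contributing term is at most the whole sum, so [r^(-2) = r^(-1/lambda) (r^(-1/lambda))^(2
    lambda - 1)] is at most [r^(-1/lambda) W^(2 lambda - 1)]; the exponent is positive as
    [lambda > 1/2]. *)
Lemma sum_inv_sqr_le : \sum_(l | P l) U l * (r l) ^- 2 <= W `^ (2 * lambda).
Proof.
have -> : W `^ (2 * lambda) = W * W `^ (2 * lambda - 1).
  by rewrite mulr_powRB1 ?ltW// mulr_gt0.
apply: le_trans (ler_wpM2r _ sum_le); last exact: powR_ge0.
rewrite mulr_suml; apply: ler_sum => l Pl; rewrite inv2E mulrA.
case: (U01 l) => Ul; first by rewrite Ul !mul0r.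
apply: ler_wpM2l; first by rewrite mulr_ge0 ?powR_ge0.
have h : r l `^ (- lambda^-1) <= W.
  apply: le_trans sum_le; rewrite (bigD1 l)//= Ul mul1r lerDl.
  by apply: sumr_ge0 => i _; rewrite mulr_ge0 ?powR_ge0.
have -> : r l `^ (lambda^-1 - 2) = (r l `^ (- lambda^-1)) `^ (2 * lambda - 1).
  by rewrite -powRrM; congr (_ `^ _); field; rewrite gt_eqF.
by apply: ge0_ler_powR; rewrite ?nnegrE ?powR_ge0 ?(ltW W_gt0)//; move: lambda_gt; lra.
Qed.

(** The exponent [1/lambda - 2] is negative, so [r^(1/lambda - 2)] is largest at the threshold. *)
Lemma sum_inv_sqr_tail T : 0 < T ->
  \sum_(l | P l && (T < r l)) U l * (r l) ^- 2 <= T `^ (lambda^-1 - 2) * W.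
Proof.
move=> T0; apply: (@le_trans _ _ (\sum_(l | P l && (T < r l)) T `^ (lambda^-1 - 2) * (U l * r l
    `^ (- lambda^-1)))).
  apply: ler_sum => l /andP[_ Tr]; rewrite inv2E mulrA mulrC.
  apply: ler_wpM2r; first by rewrite mulr_ge0 ?powR_ge0.
  rewrite -opprB !powRN lef_pV2 ?posrE ?powR_gt0//.
  have l2 : 0 <= 2 - lambda^-1.
    by rewrite subr_ge0 invf_ple ?posrE//; move: lambda_gt; lra.
  by apply: (ge0_ler_powR l2); [exact: ltW | exact/ltW/r_gt0 | exact: ltW].
rewrite -mulr_sumr ler_wpM2l ?powR_ge0//; apply: le_trans sum_le.
rewrite big_mkcondr; apply: ler_sum => l _; case: ifP => // _.
by rewrite mulr_ge0 ?powR_ge0.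
Qed.

(** Rankin's trick: [1 <= (T / r)^(1/lambda)] when [r <= T]. *)
Lemma sum_count_le T : 0 < T ->
  \sum_(l | P l && (r l <= T)) U l <= T `^ (lambda^-1) * W.
Proof.
move=> T0; apply: (@le_trans _ _ (\sum_(l | P l && (r l <= T)) T `^ (lambda^-1) * (U l * r l `^
    (- lambda^-1)))).
  apply: ler_sum => l /andP[_ rT]; rewrite mulrCA ler_peMr//.
  rewrite powRN ler_pdivlMr ?powR_gt0// mul1r.
  have l0 : 0 <= lambda^-1 by rewrite invr_ge0 ltW.
  by apply: (ge0_ler_powR l0); [exact/ltW/r_gt0 | exact: ltW | exact: rT].
rewrite -mulr_sumr ler_wpM2l ?powR_ge0//; apply: le_trans sum_le.
rewrite big_mkcondr; apply: ler_sum => l _; case: ifP => // _.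
by rewrite mulr_ge0 ?powR_ge0.
Qed.

End WeightedSums.

Section FrequencySums.
Context {R : realType}.

Lemma powR_prod (I : finType) (F : I -> R) (s : R) : (forall i, 0 <= F i) ->
  (\prod_i F i) `^ s = \prod_i F i `^ s.
Proof.
move=> F0; have [] : 0 <= \prod_i F i /\ (\prod_i F i) `^ s = \prod_i F i `^ s; last by [].
apply: (big_ind2 (fun x y => 0 <= x /\ x `^ s = y)) => [|x1 y1 x2 y2 [h1 <-] [h2 <-]|i _].
- by rewrite powR1.
- by rewrite mulr_ge0// powRM.
- by split.
Qed.

Variables (d K : nat) (alpha lambda : R) (Gam : 'I_d -> R).
Hypotheses (lambda_gt : 1 / 2 < lambda) (lambda_lt : lambda < alpha).
Hypothesis Gam01 : forall j, 0 < Gam j <= 1.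

Let lambda_gt0 : 0 < lambda. Proof. by move: lambda_gt; lra. Qed.
Let alpha_gt0 : 0 < alpha. Proof. exact: lt_trans lambda_lt. Qed.

Let V : R := \prod_(j < d) (1 + 2 * Gam j `^ lambda^-1 * zeta (alpha / lambda)).

Local Notation fw := (fun j => freq_weight alpha (Gam j)).
Local Notation U := (@sign_mult R d K).
Local Notation r := (@sfreq_weight R d K fw).

Lemma freq_weight_ge1 j k : 1 <= freq_weight alpha (Gam j) k.
Proof.
rewrite /freq_weight; case: (eqVneq k 0%N) => [//|k0].
have /andP[g0 g1] := Gam01 j; rewrite ler_pdivlMr// mul1r (le_trans g1)//.
by rewrite -[leLHS](powRr0 k%:R) ler_powR ?ler1n ?lt0n// ltW.
Qed.

Let fw_gt0 j k : 0 < freq_weight alpha (Gam j) k.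
Proof. exact: lt_le_trans (freq_weight_ge1 j k). Qed.

Lemma sfreq_weight_gt0 l : 0 < r l.
Proof. by rewrite prodr_gt0. Qed.

(** Over all frequencies the sum is the product over [j] of [1 + 2 Gam_j^(1/lambda) \sum_k
    k^(-alpha/lambda)], the 2 counting the signs; the zero frequency accounts for the 1
    subtracted. *)
Lemma sum_sfreq_weight_le :
  \sum_(l : sfreq d K | l != sfreq0 d K) U l * r l `^ (- lambda^-1) <= V - 1.
Proof.
have s1 : 1 < alpha / lambda by rewrite ltr_pdivlMr// mul1r.
rewrite lerBrDr.
have -> : (1 : R) = U (sfreq0 d K) * r (sfreq0 d K) `^ (- lambda^-1).
  rewrite /sign_mult /sfreq_weight !big1 ?powR1 ?mulr1// => j _; rewrite ffunE//.
rewrite [leLHS](_ : _ = \sum_l U l * r l `^ (- lambda^-1)); last first.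
  by rewrite [RHS](bigD1 (sfreq0 d K))//= addrC.
pose g j (p : 'I_K.+1 * bool) : R :=
  sign_count (p.1 : nat, p.2) * freq_weight alpha (Gam j) p.1 `^ (- lambda^-1).
rewrite (eq_bigr (fun l : sfreq d K => \prod_j g j (l j))) => [|l _]; last first.
  by rewrite /sfreq_weight powR_prod => [|j]; [rewrite -big_split | exact: ltW].
rewrite -(bigA_distr_bigA g); apply: ler_prod => j _; apply/andP; split.
  by apply: sumr_ge0 => p _; rewrite mulr_ge0 ?powR_ge0//; case: (sign_count01 (R := R) (p.1 :
      nat, p.2)) => ->.
rewrite -(pair_bigA _ (fun (k : 'I_K.+1) s => g j (k, s))) /=.
rewrite (eq_bigr (fun k : 'I_K.+1 => cos_scale k ^+ 2 * freq_weight alpha (Gam j) k `^ (-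
    lambda^-1))) => [|k _]; last first.
  by rewrite /g /= -mulr_suml sum_sign_count.
rewrite big_ord_recl cos_scale_sqr eqxx mul1r /freq_weight eqxx powR1 lerD2l.
have /andP[g0 _] := Gam01 j.
rewrite (eq_bigr (fun k : 'I_K => 2 * Gam j `^ lambda^-1 * k.+1%:R `^ (- (alpha / lambda)))) =>
    [|k _].
  by rewrite -mulr_sumr ler_wpM2l ?mulr_ge0 ?powR_ge0// zeta_ge_partial_sum.
rewrite cos_scale_sqr /= powRM ?powR_ge0 ?invr_ge0 ?(ltW g0)//.
rewrite -[(Gam j)^-1]powR_inv1 ?(ltW g0)// -!powRrM mulrN mulrNN mul1r; ring.
Qed.

Lemma V_gt1 : (0 < d)%N -> 1 < V.
Proof.
move=> d0; have s1 : 1 < alpha / lambda by rewrite ltr_pdivlMr// mul1r.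
have F j : 1 < 1 + 2 * Gam j `^ lambda^-1 * zeta (alpha / lambda).
  have /andP[g0 _] := Gam01 j; rewrite ltrDl mulr_gt0 ?mulr_gt0 ?powR_gt0//.
  exact: lt_le_trans (zeta_ge1 s1).
rewrite /V (bigD1 (Ordinal d0))//=; apply: (lt_le_trans (F (Ordinal d0))).
rewrite ler_peMr//; first by rewrite ltW ?(lt_trans _ (F _)).
elim/big_ind: _ => // [x y x1 y1|j _]; last exact/ltW/F.
by rewrite -[leLHS]mulr1; apply: ler_pM.
Qed.

Hypothesis d_gt0 : (0 < d)%N.

Let W_gt0 : 0 < V - 1. Proof. by rewrite subr_gt0 V_gt1. Qed.

(** Dividing all entries by [q], the map [h], is injective and keeps the signs; it divides the
    weight by [q^alpha] for each nonzero entry, and there is at least one. So the sum is at most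
    [q^(-2 alpha)] times the sum over all nonzero frequencies. *)
Lemma sum_divisible_le (q : nat) : (0 < q)%N ->
  \sum_(l : sfreq d K | (l != sfreq0 d K) && [forall j, q %| (l j).1]%N) U l * (r l) ^- 2 <=
  q%:R `^ (- (2 * alpha)) * (V - 1) `^ (2 * lambda).
Proof.
move=> q0; pose h (l : sfreq d K) : sfreq d K := [ffun j => (inord ((l j).1 %/ q), (l j).2)].
have hE (l : sfreq d K) j : (h l j).1 = ((l j).1 %/ q)%N :> nat.
  by rewrite ffunE inordK// ltnS (leq_trans (leq_div _ _))// -ltnS.
pose S := [set l : sfreq d K | [&& l != sfreq0 d K, U l != 0 & [forall j, q %| (l j).1]%N]]%SET.
have Uh l : l \in S -> U (h l) = U l.
  rewrite inE => /and3P[_ _ /forallP ql]; apply: eq_bigr => j _; rewrite /sign_count /= hE ffunE /=.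
  by rewrite -leqn0 leq_divLR// mul0n leqn0.
have hS l : l \in S -> h l != sfreq0 d K.
  rewrite inE => /and3P[l0 Ul /forallP ql]; have [j hj] := sfreq_neq0 l0 Ul.
  apply: contra hj => /eqP E; have := hE l j; rewrite E ffunE /= => /esym/eqP.
  by rewrite -leqn0 leq_divLR// mul0n leqn0.
have rS l : l \in S -> q%:R `^ alpha * r (h l) <= r l.
  move=> lS; have := lS; rewrite inE => /and3P[l0 Ul /forallP ql].
  have [j hj] := sfreq_neq0 l0 Ul.
  have fwM i : ((l i).1 != 0 :> nat) -> fw i (l i).1 = q%:R `^ alpha * fw i (h l i).1.
    move=> li; rewrite /freq_weight (negbTE li) hE.
    have := divnK (ql i); move: (_ %/ _)%N => m E.
    have m0 : m != 0%N by apply: contra li => /eqP m0; rewrite -E m0.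
    by rewrite (negbTE m0) mulrA -powRM// -natrM -E mulnC.
  rewrite /sfreq_weight (bigD1 j)//= [leRHS](bigD1 j)//= mulrA -fwM//.
  apply: ler_wpM2l; first exact: ltW.
  apply: ler_prod => i _; rewrite ltW//=.
  case: (eqVneq ((l i).1 : nat) 0%N) => li.
    by rewrite /freq_weight hE li div0n.
  rewrite (fwM i li); apply: ler_peMl; first exact: ltW.
  by rewrite -[leLHS](powRr0 q%:R) ler_powR ?ler1n// ltW.
have injh : {in S &, injective h}.
  move=> l l' lS l'S E; apply/ffunP => j; have := congr1 (fun f : sfreq d K => f j) E.
  have q1 : (q %| (l j).1)%N by move: lS; rewrite inE => /and3P[_ _ /forallP].
  have q2 : (q %| (l' j).1)%N by move: l'S; rewrite inE => /and3P[_ _ /forallP].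
  have E1 := hE l j; have E2 := hE l' j; rewrite E in E1.
  rewrite !ffunE => -[_ s2].
  have k2 : (l j).1 = (l' j).1.
    by apply: val_inj; rewrite /= -(divnK q1) -(divnK q2) -E1 E2.
  by case: (l j) (l' j) k2 s2 => [a b] [a' b'] /= -> ->.
apply: (@le_trans _ _ (\sum_(l in S) q%:R `^ (- (2 * alpha)) * (U (h l) * (r (h l)) ^- 2))).
  rewrite [leRHS]big_mkcond [leLHS]big_mkcond; apply: ler_sum => l _.
  case: (boolP (l \in S)) => lS; last first.
    case: ifP => // /andP[l0 ql]; move: lS; rewrite inE l0 ql andbT negbK => /eqP ->.
    by rewrite mul0r.
  rewrite Uh//; move: (lS); rewrite inE => /and3P[-> _ ->] /=.
  rewrite mulrCA; apply: ler_wpM2l; first exact: sign_mult_ge0.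
  have -> : q%:R `^ (- (2 * alpha)) = (q%:R `^ alpha) ^- 2.
    by rewrite powRN mulrC powRrM powR_mulrn ?powR_ge0.
  rewrite -invfM -exprMn lef_pV2 ?posrE ?exprn_gt0 ?mulr_gt0 ?powR_gt0 ?ltr0n ?sfreq_weight_gt0//.
  apply: lerXn2r; [|exact/ltW/sfreq_weight_gt0|exact: rS].
  by apply: mulr_ge0; [exact: powR_ge0 | exact/ltW/sfreq_weight_gt0].
rewrite -mulr_sumr; apply: ler_wpM2l; first exact: powR_ge0.
have U01 l : U l = 0 \/ U l = 1 by exact: sign_mult01.
apply: le_trans (sum_inv_sqr_le lambda_gt W_gt0 U01 sfreq_weight_gt0 sum_sfreq_weight_le).
rewrite -(big_imset (fun l => U l * (r l) ^- 2) injh) /= big_mkcond [leRHS]big_mkcond.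
apply: ler_sum => l _; case: ifP => [/imsetP[l' l'S ->]|_]; first by rewrite hS.
by case: ifP => // _; rewrite mulr_ge0 ?sign_mult_ge0// invr_ge0 sqr_ge0.
Qed.

(* Such a frequency lies in the dual lattice of every generating vector modulo q. *)
Lemma divisible_weight_ge (q : nat) (l : sfreq d K) : (0 < q)%N -> l != sfreq0 d K ->
  U l != 0 -> [forall j, q %| (l j).1]%N -> q%:R `^ alpha * (V - 1) `^ (- lambda) <= r l.
Proof.
move=> q0 l0 Ul ql.
have U1 : U l = 1 by case: (sign_mult01 (R := R) l) Ul => -> //; rewrite eqxx.
have h : (r l) ^- 2 <= q%:R `^ (- (2 * alpha)) * (V - 1) `^ (2 * lambda).
  apply: le_trans (sum_divisible_le q0); rewrite (bigD1 l) ?l0//= U1 mul1r lerDl.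
  by apply: sumr_ge0 => i _; rewrite mulr_ge0 ?sign_mult_ge0// invr_ge0 sqr_ge0.
rewrite -(@ler_pXn2r _ 2) ?nnegrE ?mulr_ge0 ?powR_ge0 ?(ltW (sfreq_weight_gt0 l))//.
rewrite -lef_pV2 ?posrE ?exprn_gt0 ?mulr_gt0 ?powR_gt0 ?ltr0n ?sfreq_weight_gt0//.
apply: le_trans h _; rewrite exprMn invfM le_eqVlt; apply/orP; left; apply/eqP; congr (_ * _).
  by rewrite powRN mulrC powRrM powR_mulrn ?powR_ge0.
by rewrite powRN exprVn invrK mulrC powRrM powR_mulrn ?powR_ge0.
Qed.

End FrequencySums.

(** * Lower bound for the number of admissible primes *)

Section PrimesInDyadicIntervals.
Local Open Scope nat_scope.

Lemma prod_primes_dvd (s : seq nat) N : uniq s -> all prime s ->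
  {in s, forall p, p %| N} -> \prod_(p <- s) p %| N.
Proof.
elim: s => [|p s IH] /=; first by rewrite big_nil dvd1n.
move=> /andP[ps us] /andP[pp als] H; rewrite big_cons Gauss_dvd.
  by rewrite H ?inE ?eqxx// IH// => q qs; apply: H; rewrite inE qs orbT.
rewrite big_seq; elim/big_ind: _ => [|a b ca cb|q qs]; first exact: coprimen1.
  by rewrite coprimeMr ca.
have pq : prime q by exact: (allP als).
by rewrite prime_coprime// dvdn_prime2//; apply: contra ps => /eqP ->.
Qed.

Lemma prime_ndvd_fact p k : prime p -> k < p -> ~~ (p %| k`!).
Proof.
move=> pp; elim: k => [|k IH] kp; first by rewrite dvdn1 gtn_eqF// prime_gt1.
by rewrite factS Euclid_dvdM// negb_or gtnNdvd// IH// ltnW.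
Qed.

(** The binomial occurs twice, at [m] and [m + 1], in the expansion of [(1 + 1)^(2m+1)]. *)
Lemma bin_odd_middle_le m : 'C(2 * m + 1, m) <= 4 ^ m.
Proof.
suff : 2 * 'C(2 * m + 1, m) <= 2 ^ (2 * m + 1) by rewrite expnD expn1 expnM -[2 ^ 2]/4; lia.
have -> : 2 * 'C(2 * m + 1, m) = 'C(2 * m + 1, m) + 'C(2 * m + 1, m.+1).
  rewrite mul2n -addnn; congr (_ + _); rewrite -bin_sub; last by lia.
  by congr 'C(_, _); lia.
rewrite -[2 ^ _]/((1 + 1) ^ (2 * m + 1)) Pascal (eq_bigr (fun i : 'I_(2 * m + 1).+1 => 'C(2 * m
    + 1, i))) => [|i _].
  have h1 : m < (2 * m + 1).+1 by lia.
  have h2 : m.+1 < (2 * m + 1).+1 by lia.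
  rewrite (bigD1 (Ordinal h1))//= (bigD1 (Ordinal h2))//= ?addnA ?leq_addr//.
  by rewrite -val_eqE /= gtn_eqF.
by rewrite !exp1n !muln1.
Qed.

Definition primorial n := \prod_(0 <= p < n.+1 | prime p) p.

(** Strong induction. For [n = 2m + 1] the primes above [m + 1] divide ['C(2m+1, m)], which is at
    most [4^m], and the others fall under the induction hypothesis; an even [n > 2] is not prime. *)
Lemma primorial_le n : primorial n <= 4 ^ n.
Proof.
elim/ltn_ind: n => n IH; rewrite /primorial.
case: (leqP n 2) => [n2|n2].
  by case: n n2 {IH} => [|[|[|]]]//= _; rewrite unlock.
case: (boolP (odd n)) => on; last first.
  have np : ~~ prime n by apply: contra on => /even_prime[nE|//]; rewrite nE in n2.
  rewrite big_mkcond big_nat_recr//= (negbTE np) muln1 -big_mkcond.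
  have nE : n.-1.+1 = n by lia.
  have := IH n.-1; rewrite /primorial nE leqnn => /(_ isT) /leq_trans; apply.
  by rewrite leq_exp2l; lia.
pose m := n./2; have nE : n = 2 * m + 1 by rewrite /m; lia.
rewrite (@big_cat_nat _ _ _ m.+2)//=; last by lia.
have h1 : \prod_(0 <= p < m.+2 | prime p) p <= 4 ^ m.+1 by apply: (IH m.+1); lia.
have h2 : \prod_(m.+2 <= p < n.+1 | prime p) p <= 4 ^ m.
  apply: leq_trans (bin_odd_middle_le m).
  apply: dvdn_leq; first by rewrite bin_gt0; lia.
  rewrite -big_filter; apply: prod_primes_dvd.
  - by rewrite filter_uniq ?iota_uniq.
  - exact: filter_all.
  - move=> p; rewrite mem_filter mem_index_iota => /and3P[pp mp pn].
    have : p %| 'C(2 * m + 1, m) * (m`! * (2 * m + 1 - m)`!).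
      by rewrite bin_fact ?dvdn_fact ?prime_gt0//; lia.
    rewrite !Euclid_dvdM// => /orP[//|/orP[h|h]].
      by rewrite (negbTE (prime_ndvd_fact pp _)) in h; lia.
    by rewrite (negbTE (prime_ndvd_fact pp _)) in h; lia.
apply: leq_trans (leq_mul h1 h2) _.
by rewrite -expnD leq_exp2l; lia.
Qed.

Lemma central_binomial_ge n : 4 ^ n <= (2 * n + 1) * 'C(2 * n, n).
Proof.
elim: n => [|n IH]; first by rewrite muln0 bin0.
have e1 : n.+1 * 'C(2 * n.+1, n.+1) = (2 * n.+1) * 'C(2 * n + 1, n).
  by have := mul_bin_diag (2 * n.+1) n; rewrite (_ : (2 * n.+1).-1 = 2 * n + 1); lia.
have e2 : (2 * n + 1) * 'C(2 * n, n) = n.+1 * 'C(2 * n + 1, n).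
  have := mul_bin_down (2 * n + 1) n; rewrite (_ : (2 * n + 1).-1 = 2 * n); last by lia.
  by rewrite (_ : 2 * n + 1 - n = n.+1); lia.
by rewrite expnS; nia.
Qed.

Section CentralBinomial.
Variables (n p : nat).
Hypotheses (n_gt0 : 0 < n) (p_prime : prime p).

Lemma logn_central_binomial : logn p 'C(2 * n, n) =
  \sum_(1 <= k < (2 * n).+1) (2 * n %/ p ^ k - 2 * (n %/ p ^ k)).
Proof.
have p1 := prime_gt1 p_prime.
have E : logn p 'C(2 * n, n) + 2 * logn p n`! = logn p (2 * n)`!.
  have := @bin_fact (2 * n) n; rewrite (_ : 2 * n - n = n); last by lia.
  move=> <-; last by lia.
  by rewrite !lognM ?muln_gt0 ?fact_gt0 ?bin_gt0; lia.
have fE : logn p n`! = \sum_(1 <= k < (2 * n).+1) n %/ p ^ k.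
  rewrite logn_fact// (@big_cat_nat _ _ _ n.+1 1 (2 * n).+1)//=; last by lia.
  suff -> : \sum_(n.+1 <= k < (2 * n).+1) n %/ p ^ k = 0 by rewrite addn0.
  rewrite big_nat big1// => k /andP[nk _].
  by rewrite divn_small// (leq_trans nk)// ltnW// ltn_expl.
rewrite sumnB => [|k _]; last first.
  by rewrite leq_divRL ?expn_gt0 ?(ltnW p1)// -mulnA leq_mul2l leq_trunc_div.
by rewrite -big_distrr /= -fE -logn_fact// -E addnK.
Qed.

Lemma logn_central_term k : 2 * n %/ p ^ k - 2 * (n %/ p ^ k) <= (p ^ k <= 2 * n).
Proof.
have pk : 0 < p ^ k by rewrite expn_gt0 prime_gt0.
case: (leqP (p ^ k) (2 * n)) => h; last by rewrite divn_small.
rewrite leq_subLR -ltnS ltn_divLR//.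
by have := divn_eq n (p ^ k); have := ltn_pmod n pk; nia.
Qed.

(** Legendre's formula leaves a term at most 1 for each power [p^k <= 2n] and none beyond; hence the
    [p]-part of the central binomial is at most [2n]. *)
Lemma logn_central_le : logn p 'C(2 * n, n) <= trunc_log p (2 * n).
Proof.
rewrite logn_central_binomial; set T := trunc_log _ _.
apply: (@leq_trans (\sum_(1 <= k < (2 * n).+1) (k <= T))).
  apply: leq_sum => k _; apply: leq_trans (logn_central_term k) _.
  case: (leqP (p ^ k)) => // h.
  by rewrite trunc_log_max ?prime_gt1.
suff H m : \sum_(1 <= k < m.+1) (k <= T) <= minn m T by apply: leq_trans (H _) (geq_minr _ _).
elim: m => [|m IH]; first by rewrite big_geq.
by rewrite big_nat_recr//=; move: IH; case: (leqP m.+1 T); lia.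
Qed.

End CentralBinomial.

End PrimesInDyadicIntervals.

Section ErdosBound.
Local Open Scope nat_scope.

Lemma primes_prod_range m N : 0 < N -> (forall p, prime p -> p %| N -> p <= m) ->
  N = \prod_(0 <= p < m.+1 | prime p) p ^ logn p N.
Proof.
move=> N0 H; rewrite [LHS]prod_prime_decomp// prime_decompE big_map /=.
have E : perm_eq (primes N) [seq p <- index_iota 0 m.+1 | prime p && (p %| N)].
  apply: uniq_perm; rewrite ?primes_uniq ?filter_uniq ?iota_uniq// => p.
  rewrite mem_filter mem_index_iota mem_primes N0 /= ltnS.
  by apply/andP/andP => [[pp pN]|[/andP[-> ->]]//]; rewrite pp pN H.
rewrite (perm_big _ E) big_filter big_mkcondr; apply: eq_bigr => p pp.
by case: ifP => // /negbT h; rewrite lognE pp N0 (negbTE h).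
Qed.

Lemma prod_const_range (P : pred nat) x m :
  \prod_(0 <= p < m | P p) x = x ^ #|[pred p : 'I_m | P p]|.
Proof. by rewrite big_mkord prod_nat_const. Qed.

(* Erdos' factorization of C(2n,n): the primes up to s contribute at most 2n each,
   those in (s, 2n/3] at most their primorial, those in (2n/3, n] nothing. *)
Lemma erdos_bound n s : 3 <= n -> 2 * n < s.+1 ^ 2 ->
  4 ^ n <= (2 * n + 1) * ((2 * n) ^ s * 4 ^ (2 * n %/ 3) *
    (2 * n) ^ #|[pred p : 'I_(2 * n).+1 | prime p && (n < p)]|).
Proof.
move=> n3 hs; have n0 : 0 < n by lia.
apply: leq_trans (central_binomial_ge n) _; rewrite leq_mul2l; apply/orP; right.
set C := 'C(2 * n, n); have C0 : 0 < C by rewrite bin_gt0; lia.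
have pw p : prime p -> p ^ logn p C <= 2 * n.
  move=> pp; apply: leq_trans (trunc_logP (prime_gt1 pp) _); last by lia.
  by rewrite leq_pexp2l ?prime_gt0// logn_central_le.
have pC p : prime p -> p %| C -> p <= 2 * n.
  move=> pp pdC; apply: leq_trans (pw p pp).
  rewrite -[leqLHS]expn1; apply: leq_pexp2l; first exact: prime_gt0.
  by rewrite -pfactor_dvdn.
rewrite [leqLHS](primes_prod_range C0 pC).
pose A p := if p <= s then 2 * n else 1.
pose B p := if p <= 2 * n %/ 3 then p else 1.
pose D p := if n < p then 2 * n else 1.
apply: (@leq_trans (\prod_(0 <= p < (2 * n).+1 | prime p) (A p * B p * D p))).
  apply: leq_prod => p pp; have p1 := prime_gt1 pp; have hp := pw p pp; rewrite /A /B /D.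
  have Bp : 0 < B p by rewrite /B; case: ifP => //; lia.
  case: (leqP p s) => ps.
    by move: Bp; rewrite -/(B p); case: (n < p); nia.
  have l1 : logn p C <= 1.
    apply: leq_trans (logn_central_le n0 pp) _; rewrite -ltnS -[_ < _]negbK -leqNgt.
    apply/negP => h; have := trunc_logP p1 (_ : 0 < 2 * n); rewrite muln_gt0 n0 => /(_ isT).
    have := leq_pexp2l (ltnW p1) h => h1 h2; have {h1 h2} := leq_trans h1 h2.
    have : s.+1 ^ 2 <= p ^ 2 by rewrite leq_exp2r.
    by lia.
  case: (ltnP n p) => np; first by rewrite mul1n; move: Bp; rewrite -/(B p); nia.
  rewrite mul1n muln1; case: (leqP p (2 * n %/ 3)) => p3.
    by rewrite -[leqRHS]expn1 leq_pexp2l ?(ltnW p1).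
  suff -> : logn p C = 0 by [].
  rewrite logn_central_binomial// big_nat big1// => k /andP[k1 _].
  (* For [2n/3 < p <= n] the term [k = 1] is [2 - 2 * 1 = 0], and higher powers exceed [2n] because
     [3 p <= p^2]. *)
  have p3' : 2 * n < 3 * p.
    by move: p3; rewrite ltn_divLR//; lia.
  case: k k1 => [//|[|k]] _.
    have -> : n %/ p ^ 1 = 1 by apply/eqP; rewrite expn1 eqn_leq -ltnS ltn_divLR ?leq_divRL; lia.
    have -> : 2 * n %/ p ^ 1 = 2 by apply/eqP; rewrite expn1 eqn_leq -ltnS ltn_divLR
        ?leq_divRL; lia.
    by [].
  have pk : 2 * n < p ^ k.+2.
    apply: (@leq_trans (p ^ 2)); last by rewrite leq_pexp2l ?(ltnW p1).
    by rewrite expnS expn1; nia.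
  by rewrite divn_small.
rewrite !big_split /=; apply: leq_mul; first apply: leq_mul.
- rewrite /A -big_mkcondr prod_const_range leq_pexp2l//; first by lia.
  rewrite -[leqRHS](size_iota 1) cardE -(size_map val); apply: uniq_leq_size.
    by rewrite map_inj_uniq ?enum_uniq//; exact: val_inj.
  move=> _ /mapP[p + ->]; rewrite mem_enum !inE mem_iota => /andP[/prime_gt0].
  by move=> /= p0 ps; rewrite p0 ltnS.
- rewrite /B -big_mkcondr; apply: leq_trans (primorial_le _).
  by rewrite /primorial [leqRHS](big_nat_widen _ _ (2 * n).+1)//; lia.
- by rewrite /D -big_mkcondr prod_const_range.
Qed.

Lemma erdos_prime_count nmax s : 7 <= nmax -> nmax < s.+1 ^ 2 ->
  4 ^ (nmax./2 %/ 3) <= nmax.+1 ^ (s + 2 + prime_count nmax).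
Proof.
move=> n7 hs; pose n := nmax./2; have nE := odd_double_half nmax.
have n3 : 3 <= n by rewrite /n; lia.
have hs' : 2 * n < s.+1 ^ 2 by apply: leq_ltn_trans hs; rewrite /n; lia.
have hn : 2 * n + 1 <= nmax.+1 by rewrite /n; lia.
pose c := #|[pred p : 'I_(2 * n).+1 | prime p && (n < p)]|.
(* If [nmax] is odd, [uphalf nmax] is [n + 1], so a prime [n + 1] is counted by [c] without being
   admissible. *)
have cP : c <= prime_count nmax + 1.
  have w : (2 * n).+1 <= nmax.+1 by rewrite /n; lia.
  have h1 : n.+1 < nmax.+1 by rewrite /n; lia.
  have wi : injective (widen_ord w) by move=> a b /(congr1 val) /= ?; exact: val_inj.
  rewrite /c -(card_imset _ wi) /prime_count.
  apply: (@leq_trans #|[set p : 'I_nmax.+1 | admissible nmax p] :|: [set Ordinal h1]|).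
    apply: subset_leq_card; apply/fintype.subsetP => _ /imsetP[p + ->].
    rewrite !inE /admissible => /andP[-> np] /=; rewrite -val_eqE /=.
    by have := ltn_ord p; rewrite uphalf_half; move: np nE; rewrite /n; lia.
  by rewrite (leq_trans (leq_card_setU _ _))// cards1.
have := erdos_bound n3 hs'; rewrite -/c => E.
have e3 : 4 ^ (n %/ 3) * 4 ^ (2 * n %/ 3) <= 4 ^ n by rewrite -expnD leq_exp2l//; lia.
have {e3 E} := leq_trans e3 E; rewrite [X in _ <= _ * X]mulnAC mulnA leq_mul2r expn_eq0 /= =>
    /leq_trans; apply.
apply: (@leq_trans (nmax.+1 * (nmax.+1 ^ s * nmax.+1 ^ (prime_count nmax + 1)))).
  apply: leq_mul => //; apply: leq_mul; first by rewrite leq_exp2r; lia.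
  apply: (@leq_trans (nmax.+1 ^ c)); last by rewrite leq_pexp2l.
  by case: (posnP c) => [->//|c0]; rewrite leq_exp2r//; lia.
by rewrite -expnD -expnS leq_pexp2l//; lia.
Qed.

End ErdosBound.

Section PrimeCountLowerBound.
Context {R : realType}.

Lemma ln_le_powR (x t : R) : 0 < x -> 0 < t -> ln x <= t^-1 * x `^ t.
Proof.
move=> x0 t0; rewrite ler_pdivlMl// -ln_powR; apply/ltW/ln_sublinear.
exact: powR_gt0.
Qed.

Lemma ln4_ge1 : 1 <= ln (4 : R).
Proof.
have h : ln (1 + - 2^-1 : R) <= - 2^-1 by apply: le_ln1Dx; lra.
have e : (1 + - 2^-1 : R) = 2^-1 by field.
rewrite e lnV ?posrE// lerN2 in h.
rewrite (_ : (4 : R) = 2 ^+ 2) ?lnXn//; last by rewrite expr2; ring.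
by rewrite mulr2n; lra.
Qed.

(** Logarithms of [erdos_prime_count], with [s] the integer part of the square root. The factor
    [ln (nmax + 1)] is traded for [t^-1 (2 nmax)^t], and from 11 on [nmax / 12] is a lower bound for
    [nmax./2 %/ 3]. *)
Lemma prime_count_ge (t : R) (nmax : nat) : 0 < t -> (11 <= nmax)%N ->
  nmax%:R / 12 <= (Num.sqrt nmax%:R + 2 + (prime_count nmax)%:R) *
     (t^-1 * 2 `^ t * nmax%:R `^ t) :> R.
Proof.
move=> t0 n11; set x : R := nmax%:R.
pose s := Num.truncn (Num.sqrt x).
have sx : s%:R <= Num.sqrt x by rewrite truncn_le sqrtr_ge0.
have xs : (nmax < s.+1 ^ 2)%N.
  rewrite -(ltr_nat R) natrX -/x -[x]sqr_sqrtr ?ler0n//.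
  by rewrite ltr_pXn2r ?nnegrE ?sqrtr_ge0 ?ler0n// truncnS_gt.
have n7 : (7 <= nmax)%N by lia.
have E : ln (4 ^+ (nmax./2 %/ 3)) <= ln (nmax.+1%:R ^+ (s + 2 + prime_count nmax)) :> R.
  by rewrite ler_ln ?posrE ?exprn_gt0 ?ltr0n// -!natrX ler_nat erdos_prime_count.
rewrite !lnXn ?ltr0n// in E.
have h1 : x / 12 <= ln 4 *+ (nmax./2 %/ 3).
  rewrite -[leRHS]mulr_natl; apply: (@le_trans _ _ (nmax./2 %/ 3)%N%:R); last first.
    by rewrite ler_peMr// ln4_ge1.
  by rewrite ler_pdivrMr// -natrM ler_nat; lia.
apply: le_trans h1 _; apply: le_trans E _; rewrite -[leLHS]mulr_natl !natrD.
apply: ler_pM; first by rewrite !addr_ge0.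
- by rewrite ln_ge0// ler1n.
- by rewrite !lerD2r.
apply: le_trans (ln_le_powR _ t0) _; rewrite ?ltr0n//.
rewrite -mulrA ler_pM2l ?invr_gt0// -powRM ?ler0n//.
apply: (ge0_ler_powR (ltW t0)); rewrite ?nnegrE ?ler0n ?mulr_ge0//.
by rewrite /x -natrM ler_nat; lia.
Qed.

(** The exponent may lose [2 delta] because only the square root of this bound enters the error. As
    the inverse of 0 is 0, the inequality is true also when no prime is admissible. *)
Lemma inv_prime_count_le (delta : R) : 0 < delta -> exists2 C : R, 0 < C &
  forall nmax, (0 < nmax)%N ->
    (prime_count nmax)%:R^-1 <= C * nmax%:R `^ (2 * delta - 1).
Proof.
move=> d0.
have inv_le1 nmax : (prime_count nmax)%:R^-1 <= 1 :> R.
  case: (prime_count nmax) => [|k]; first by rewrite invr0.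
  by rewrite invf_le1 ?ltr0n// ler1n.
case: (leP (1 / 2) delta) => [hd|hd].
  exists 1 => // nmax n0; rewrite mul1r (le_trans (inv_le1 _))//.
  by rewrite -[leLHS](powRr0 nmax%:R) ler_powR ?ler1n//; lra.
pose A : R := delta^-1 * 2 `^ delta.
have A0 : 0 < A by rewrite mulr_gt0 ?invr_gt0 ?powR_gt0.
(* Beyond [N0], [72 A sqrt x <= x^(1 - delta)]: then [sqrt x + 2 <= 3 sqrt x] uses up at most half
   of [x^(1 - delta) / (12 A)], and the primes account for the other half. Smaller [x] are absorbed
   in the constant. *)
pose N0 : R := (72 * A) `^ (1 / 2 - delta)^-1.
have N00 : 0 <= N0 by exact: powR_ge0.
exists (24 * A + N0 + 11); first by rewrite addr_gt0// ltr_wpDr// mulr_gt0.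
move=> nmax n0; set x : R := nmax%:R.
have x1 : 1 <= x by rewrite ler1n.
have x0 : 0 < x by exact: lt_le_trans x1.
have -> : x `^ (2 * delta - 1) = (x `^ (1 - 2 * delta))^-1 by rewrite -opprB powRN.
have xp : 0 < x `^ (1 - 2 * delta) by exact: powR_gt0.
case: (leP (N0 + 11) x) => hx; last first.
  rewrite (le_trans (inv_le1 _))// ler_pdivlMr// mul1r.
  apply: (@le_trans _ _ x); last by rewrite (le_trans (ltW hx))// -addrA lerDr mulr_ge0 ?ltW.
  by rewrite -[leRHS]powRr1 ?(ltW x0)// ler_powR//; lra.
have n11 : (11 <= nmax)%N.
  by rewrite -(ler_nat R) -/x; apply: le_trans hx; rewrite lerDr.
have := prime_count_ge d0 n11; rewrite -/x -/A; set P : R := (prime_count nmax)%:R => hP.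
have xd : x = x `^ (1 - delta) * x `^ delta.
  by rewrite -powRD ?subrK ?powRr1 ?(ltW x0)// (gt_eqF x0) implybT.
have {hP} hP : x `^ (1 - delta) / (12 * A) <= Num.sqrt x + 2 + P.
  suff : x `^ (1 - delta) * x `^ delta <= (Num.sqrt x + 2 + P) * (12 * A) * x `^ delta.
    by rewrite ler_pM2r ?powR_gt0// ler_pdivrMr// mulr_gt0.
  rewrite -xd.
  by move: hP; rewrite ler_pdivrMr// => h; apply: le_trans h _; rewrite le_eqVlt; apply/orP;
      left; apply/eqP; ring.
have sq : 72 * A * Num.sqrt x <= x `^ (1 - delta).
  have -> : x `^ (1 - delta) = x `^ (1 / 2 - delta) * Num.sqrt x.
    by rewrite -powR12_sqrt ?(ltW x0)// -powRD ?(gt_eqF x0) ?implybT//; congr (_ `^ _); field.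
  apply: ler_wpM2r; first exact: sqrtr_ge0.
  have -> : 72 * A = N0 `^ (1 / 2 - delta).
    have nz : 1 / 2 - delta != 0 by rewrite gt_eqF// subr_gt0.
    by rewrite /N0 -powRrM mulVf// powRr1// mulr_ge0// ltW.
  by apply: ge0_ler_powR; rewrite ?nnegrE ?(ltW x0)// ?subr_ge0 ?(ltW hd)// (le_trans _ hx)// lerDl.
have sq1 : 1 <= Num.sqrt x by rewrite -sqrtr1 ler_sqrt// ltW.
have A24 : 0 < 24 * A by rewrite mulr_gt0.
have Pge : x `^ (1 - delta) / (24 * A) <= P.
  have h3 : 3 * Num.sqrt x <= x `^ (1 - delta) / (24 * A).
    rewrite ler_pdivlMr//.
    by rewrite (_ : 3 * Num.sqrt x * (24 * A) = 72 * A * Num.sqrt x); [exact: sq | ring].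
  have e2 : x `^ (1 - delta) / (12 * A) = x `^ (1 - delta) / (24 * A) + x `^ (1 - delta) / (24 * A).
    by field; rewrite gt_eqF.
  by move: hP h3 sq1; rewrite e2; lra.
have P0 : 0 < P by apply: lt_le_trans Pge; rewrite divr_gt0// powR_gt0.
apply: (@le_trans _ _ (24 * A / x `^ (1 - 2 * delta))); last first.
  by rewrite ler_wpM2r ?invr_ge0 ?(ltW xp)// -addrA lerDl addr_ge0.
rewrite -[leRHS]invrK lef_pV2 ?posrE//; last by rewrite invr_gt0 divr_gt0.
apply: le_trans Pge; rewrite invf_div; apply: ler_wpM2r; first by rewrite invr_ge0 ltW.
by rewrite ler_powR//; lra.
Qed.

End PrimeCountLowerBound.

(** * Mean error on good draws for a cosine polynomial *)

Section PolynomialError.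
Context {R : realType}.
Variables (d K nmax : nat) (alpha lambda : R) (Gam : 'I_d -> R).
Hypotheses (lambda_gt : 1 / 2 < lambda) (lambda_lt : lambda < alpha).
Hypotheses (Gam01 : forall j, 0 < Gam j <= 1) (d_gt0 : (0 < d)%N) (nmax_ge2 : (2 <= nmax)%N).

Let lambda_gt0 : 0 < lambda. Proof. by move: lambda_gt; lra. Qed.
Let alpha_gt0 : 0 < alpha. Proof. exact: lt_trans lambda_lt. Qed.

Let W : R := \prod_(j < d) (1 + 2 * Gam j `^ lambda^-1 * zeta (alpha / lambda)) - 1.
Let W_gt0 : 0 < W. Proof. by rewrite subr_gt0; exact: (V_gt1 lambda_gt lambda_lt). Qed.

Local Notation fw := (fun j => freq_weight alpha (Gam j)).
Local Notation U := (@sign_mult R d K).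
Local Notation r := (@sfreq_weight R d K fw).
Local Notation prob := (@draw_prob R nmax d).
Local Notation dual w := (in_dual w.1 (fun j => w.2 j)).
Local Notation NR := (nmax%:R : R).
Local Notation P := ((prime_count nmax)%:R : R).
Local Notation nu l := ((common_prime_count nmax l)%:R : R).

Let U01 l : U l = 0 \/ U l = 1. Proof. exact: sign_mult01. Qed.
Let U0 l : 0 <= U l. Proof. exact: sign_mult_ge0. Qed.
Let r0 l : 0 < r l. Proof. exact: (sfreq_weight_gt0 lambda_gt lambda_lt Gam01). Qed.
Let N0 : 0 < NR. Proof. by rewrite ltr0n; apply: leq_trans nmax_ge2. Qed.
Let S1 : \sum_(l : sfreq d K | l != sfreq0 d K) U l * r l `^ (- lambda^-1) <= W.
Proof. exact: (sum_sfreq_weight_le K lambda_gt lambda_lt Gam01). Qed.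

(** Chosen so that [T^(1/lambda) W (2 / NR) = 1/32], the bound on the failure probability that the
    union bound gives. *)
Let T : R := (NR / (64 * W)) `^ lambda.
Let T_gt0 : 0 < T. Proof. by rewrite powR_gt0// divr_gt0// mulr_gt0. Qed.

Let half_le n : admissible nmax n -> NR / 2 <= n%:R.
Proof. by case/and3P => _ h _; rewrite ler_pdivrMr// -natrM ler_nat; lia. Qed.

(** A prime [n >= NR / 2] dividing all entries would force [r l >= (n / W)^lambda], which exceeds
    [T] since [NR / 2 > NR / 64]. So such a frequency is dual with probability at most [2 / NR]. *)
Let common_prime_count0 (l : sfreq d K) : l != sfreq0 d K -> U l != 0 -> r l <= T ->
  common_prime_count nmax l = 0%N.
Proof.
move=> l0 Ul rT; apply/eqP; rewrite cards_eq0; apply/eqP/setP => n; rewrite !inE.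
apply/negbTE/negP => /andP[an nl].
have n0 : (0 < n)%N by case/and3P: an => /prime_gt0.
have := divisible_weight_ge lambda_gt lambda_lt Gam01 d_gt0 n0 l0 Ul nl.
apply/negP; rewrite -ltNge; apply: le_lt_trans rT _.
have n1 : 1 <= (n%:R : R) by rewrite ler1n.
apply: (@lt_le_trans _ _ (n%:R `^ lambda * W `^ (- lambda))); last first.
  by rewrite ler_wpM2r ?powR_ge0// ler_powR// ltW.
have -> : W `^ (- lambda) = W^-1 `^ lambda.
  by rewrite -[W^-1]powR_inv1 ?(ltW W_gt0)// -powRrM mulN1r.
rewrite -powRM ?ler0n ?invr_ge0 ?(ltW W_gt0)//.
apply: gt0_ltr_powR => //; rewrite ?nnegrE ?divr_ge0 ?mulr_ge0 ?(ltW W_gt0)//.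
rewrite invfM mulrA ltr_pM2r ?invr_gt0//.
by apply: lt_le_trans (half_le an); rewrite ltr_pM2l//; lra.
Qed.

Definition good_draw (w : draw nmax d) : bool :=
  [forall l : sfreq d K, [&& l != sfreq0 d K, U l != 0 & r l <= T] ==> ~~ dual w l].

Lemma prob_bad_draw_le : \sum_w prob w * (~~ good_draw w)%:R <= 1 / 32.
Proof.
pose D (l : sfreq d K) := (l != sfreq0 d K) && (r l <= T).
apply: (@le_trans _ _ (\sum_w prob w * \sum_(l | D l) U l * (dual w l)%:R)).
  apply: ler_sum => w _; apply: ler_wpM2l; first exact: draw_prob_ge0.
  have t0 l : 0 <= U l * (dual w l)%:R by rewrite mulr_ge0.
  case: (boolP (good_draw w)) => [_|]; first by rewrite sumr_ge0.
  move=> /forallPn[l]; rewrite negb_imply negbK => /andP[/and3P[l0 Ul rT] dl].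
  rewrite (bigD1 l) /D ?l0 ?rT//= dl mulr1.
  by case: (U01 l) Ul => [->|-> _]; rewrite ?eqxx// lerDl sumr_ge0.
under eq_bigr do rewrite mulr_sumr.
rewrite exchange_big /=.
apply: (@le_trans _ _ (\sum_(l | D l) U l * (2 / NR))).
  apply: ler_sum => l /andP[l0 rT].
  under eq_bigr do rewrite mulrCA.
  rewrite -mulr_sumr; case: (eqVneq (U l) 0) => [->|Ul]; first by rewrite !mul0r.
  apply: ler_wpM2l => //; apply: le_trans (draw_prob_in_dual nmax_ge2 l0 Ul) _.
  by rewrite common_prime_count0// mul0r addr0.
rewrite -mulr_suml; apply: (@le_trans _ _ (T `^ (lambda^-1) * W * (2 / NR))).
  by rewrite ler_wpM2r ?divr_ge0//; exact: (sum_count_le lambda_gt U01 r0 S1).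
rewrite /T -powRrM divff ?gt_eqF// powRr1; last by rewrite divr_ge0 ?mulr_ge0// ltW.
by rewrite le_eqVlt; apply/orP; left; apply/eqP; field; rewrite !gt_eqF.
Qed.

Variable beta : sfreq d K -> R.
Hypotheses (beta_ge0 : forall l, 0 <= beta l)
  (beta_le1 : \sum_l U l * (beta l * r l) ^+ 2 <= 1).

Definition dual_error (w : draw nmax d) : R :=
  \sum_(l | l != sfreq0 d K) U l * (beta l * (dual w l)%:R).

(** Cauchy-Schwarz against [beta l * r l], whose weighted l2 norm is at most 1. *)
Let weighted_sum_le (D : pred (sfreq d K)) (x : sfreq d K -> R) (e : R) : 0 <= e ->
  \sum_(l | D l) U l * (x l ^+ 2 * (r l) ^- 2) <= e ^+ 2 -> \sum_(l | D l) U l * (beta l * x l)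
      <= e.
Proof.
move=> e0 he; pose w l := if D l then U l else 0.
have w0 l : 0 <= w l by rewrite /w; case: ifP.
have h : \sum_(l | D l) U l * (beta l * x l) = \sum_l w l * ((beta l * r l) * (x l / r l)).
  rewrite big_mkcond; apply: eq_bigr => l _; rewrite /w; case: ifP => _; last by rewrite mul0r.
  by rewrite mulrACA divff ?gt_eqF// mulr1.
rewrite h; apply: le_trans (ler_norm _) _.
apply: (@norm_le_cauchy_schwarz _ _ w _ _ 1 (e ^+ 2)) => //; last by rewrite mul1r.
  apply: le_trans beta_le1; apply: ler_sum => l _; apply: ler_wpM2r; first exact: sqr_ge0.
  by rewrite /w; case: ifP.
apply: le_trans he; rewrite [leRHS]big_mkcond; apply: ler_sum => l _.
by rewrite /w; case: ifP => _; rewrite ?mul0r// exprMn exprVn.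
Qed.

(** The indicator of the dual lattice is bounded by 1: this is the deterministic worst case, used
    where the median fails. *)
Lemma dual_error_le w : dual_error w <= W `^ lambda.
Proof.
apply: (@le_trans _ _ (\sum_(l | l != sfreq0 d K) U l * (beta l * 1))).
  apply: ler_sum => l _; apply: ler_wpM2l => //; apply: ler_wpM2l => //.
  by case: (dual w l).
apply: weighted_sum_le; first exact: powR_ge0.
rewrite -[leRHS]powR_mulrn ?powR_ge0// -powRrM [lambda * _]mulrC.
under eq_bigr do rewrite expr1n mul1r.
exact: (sum_inv_sqr_le lambda_gt W_gt0 U01 r0 S1).
Qed.

Lemma common_prime_countE (l : sfreq d K) : nu l =
  \sum_(n : 'I_nmax.+1 | admissible nmax n) ([forall j, n %| (l j).1]%N)%:R.
Proof.
rewrite /common_prime_count -sum1_card natr_sum big_mkcond [RHS]big_mkcond.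
by apply: eq_bigr => n _; rewrite inE; case: (admissible nmax n) => //=; case: [forall j, _].
Qed.

Let E2 : R := W `^ lambda * (Num.sqrt P * (NR / 2) `^ (- alpha) + P * (NR / 2) `^ (- (2 * alpha))).

(** Squaring [nu] gives a double sum over primes [n] and [n']. Equal primes give [n^(-2 alpha)] by
    [sum_divisible_le]; distinct primes are coprime, so their product divides all entries, giving
    [(n n')^(-2 alpha)]. The [P] diagonal terms and at most [P^2] others correspond to the two parts
    of [E2]. *)
Lemma sum_common_prime_count_le :
  \sum_(l | l != sfreq0 d K) U l * (nu l ^+ 2 * (r l) ^- 2) <= E2 ^+ 2.
Proof.
pose q : R := NR / 2; have q0 : 0 < q by rewrite divr_gt0.
pose W2 := W `^ (2 * lambda); have W20 : 0 <= W2 by exact: powR_ge0.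
pose all_div n (l : sfreq d K) := [forall j, n %| (l j).1]%N.
have one (n n' : 'I_nmax.+1) : admissible nmax n -> admissible nmax n' ->
    \sum_(l | l != sfreq0 d K) U l * ((all_div n l)%:R * (all_div n' l)%:R * (r l) ^- 2) <=
    ((n == n')%:R * q `^ (- (2 * alpha)) + (q `^ (- (2 * alpha))) ^+ 2) * W2.
  move=> an an'; have pn : prime n by case/and3P: an.
  have pn' : prime n' by case/and3P: an'.
  have hq (m : nat) (b : R) : 0 < b -> b <= m%:R ->
      m%:R `^ (- (2 * alpha)) <= b `^ (- (2 * alpha)).
    move=> b0 bm; rewrite !powRN lef_pV2 ?posrE ?powR_gt0 ?(lt_le_trans b0)//.
    have a2 : 0 <= 2 * alpha by rewrite mulr_ge0// ltW.
    by apply: (ge0_ler_powR a2) => //; rewrite nnegrE ?ler0n// ltW.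
  have reduce (m : nat) (b : R) : (0 < m)%N -> 0 < b -> b <= m%:R ->
      (forall l, all_div n l -> all_div n' l -> all_div m l) ->
      \sum_(l | l != sfreq0 d K) U l * ((all_div n l)%:R * (all_div n' l)%:R * (r l) ^- 2) <=
      b `^ (- (2 * alpha)) * W2.
    move=> m0 b0 bm hm; apply: le_trans (ler_wpM2r W20 (hq _ _ b0 bm)).
    apply: le_trans (sum_divisible_le K lambda_gt lambda_lt Gam01 d_gt0 m0).
    rewrite [leRHS]big_mkcondr; apply: ler_sum => l _.
    have t0 : 0 <= U l * (r l) ^- 2 by rewrite mulr_ge0// invr_ge0 sqr_ge0.
    case: (boolP (all_div n l)) => h1; last by rewrite !mul0r mulr0; case: ifP.
    case: (boolP (all_div n' l)) => h2; last by rewrite mulr0 mul0r mulr0; case: ifP.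
    by rewrite (hm l h1 h2 : [forall j, m %| (l j).1]%N) !mul1r.
  case: (eqVneq n n') => [nn'|nn'].
    apply: le_trans (reduce n q _ q0 (half_le an) _) _ => //; first exact: prime_gt0.
    by rewrite mul1r ler_wpM2r// lerDl sqr_ge0.
  have -> : (q `^ (- (2 * alpha))) ^+ 2 = (q ^+ 2) `^ (- (2 * alpha)).
    by rewrite -powR_mulrn ?powR_ge0// -powRrM mulrC powRrM powR_mulrn ?(ltW q0).
  rewrite mul0r add0r; apply: (reduce (n * n')%N (q ^+ 2)).
  - by rewrite muln_gt0 !prime_gt0.
  - by rewrite exprn_gt0.
  - by rewrite natrM expr2 ler_pM// ?half_le// ltW.
  - move=> l /forallP h1 /forallP h2; apply/forallP => j; rewrite Gauss_dvd ?h1 ?h2//.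
    by rewrite prime_coprime// dvdn_prime2//; apply: contra nn' => /eqP /val_inj ->.
have -> : \sum_(l | l != sfreq0 d K) U l * (nu l ^+ 2 * (r l) ^- 2) =
    \sum_(n : 'I_nmax.+1 | admissible nmax n) \sum_(n' : 'I_nmax.+1 | admissible nmax n')
    \sum_(l | l != sfreq0 d K) U l * ((all_div n l)%:R * (all_div n' l)%:R * (r l) ^- 2).
  under eq_bigr do rewrite common_prime_countE expr2 mulr_suml.
  under [RHS]eq_bigr do rewrite exchange_big /=.
  rewrite exchange_big /=; apply: eq_bigr => l _.
  rewrite mulr_suml mulr_sumr; apply: eq_bigr => n _.
  by rewrite mulr_sumr mulr_suml mulr_sumr.
apply: (@le_trans _ _ (\sum_(n : 'I_nmax.+1 | admissible nmax n) \sum_(n' : 'I_nmax.+1 |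
    admissible nmax n')
   ((n == n')%:R * q `^ (- (2 * alpha)) + (q `^ (- (2 * alpha))) ^+ 2) * W2)).
  by apply: ler_sum => n an; apply: ler_sum => n' an'; exact: one.
have cst (x : R) : \sum_(n : 'I_nmax.+1 | admissible nmax n) x = P * x.
  rewrite sumr_const (_ : #|_| = prime_count nmax) ?mulr_natl//.
  by rewrite /prime_count cardsE.
rewrite (eq_bigr (fun=> (q `^ (- (2 * alpha)) + P * (q `^ (- (2 * alpha))) ^+ 2) * W2)) => [|n
    an]; last first.
  rewrite -mulr_suml big_split /= cst; congr ((_ + _) * _).
  rewrite -mulr_suml (bigD1 n)//= eqxx big1 ?addr0 ?mul1r// => n' /andP[_ nn'].
  by rewrite eq_sym (negbTE nn').
rewrite cst /E2 -/q exprMn -[(W `^ lambda) ^+ 2]powR_mulrn ?powR_ge0// -powRrM.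
rewrite [lambda * _]mulrC -/W2 [leRHS]mulrC mulrA; apply: ler_wpM2r => //.
have -> : q `^ (- (2 * alpha)) = (q `^ (- alpha)) ^+ 2.
  by rewrite -powR_mulrn ?powR_ge0// -powRrM mulNr mulrC.
rewrite sqrrD [(Num.sqrt P * _) ^+ 2]exprMn sqr_sqrtr//.
(* The cross term in the square of [E2] is pure slack. *)
have c0 : 0 <= Num.sqrt P * q `^ (- alpha) * (P * (q `^ (- alpha)) ^+ 2).
  by rewrite !mulr_ge0 ?sqrtr_ge0 ?powR_ge0 ?sqr_ge0.
move: c0; set c := _ * _ * (P * _) => c0.
rewrite [leLHS](_ : _ = P * (q `^ (- alpha)) ^+ 2 + (P * (q `^ (- alpha)) ^+ 2) ^+ 2); last by ring.
by rewrite addrAC lerDl mulrn_wge0.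
Qed.

Let E1 : R := (NR / 64) `^ (1 / 2 - lambda) * W `^ lambda.

(** On a good draw no frequency with [r l <= T] contributes, so the sums run over [T < r l].
    Exchanging sum and mean and inserting [draw_prob_in_dual] leaves one sum with the constant
    factor [2 / NR] and one with [nu l / P], each handled by Cauchy-Schwarz. *)
Lemma expected_dual_error_le :
  \sum_w prob w * (dual_error w * (good_draw w)%:R) <= 2 / NR * E1 + P^-1 * E2.
Proof.
pose D (l : sfreq d K) := (l != sfreq0 d K) && (T < r l).
apply: (@le_trans _ _ (\sum_w prob w * \sum_(l | D l) U l * (beta l * (dual w l)%:R))).
  apply: ler_sum => w _; apply: ler_wpM2l; first exact: draw_prob_ge0.
  have t0 l : 0 <= U l * (beta l * (dual w l)%:R) by rewrite !mulr_ge0.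
  case: (boolP (good_draw w)) => [/forallP gw|]; last by rewrite mulr0 sumr_ge0.
  rewrite mulr1 /dual_error [leRHS]big_mkcondr; apply: ler_sum => l l0.
  case: ltP => // rT; case: (eqVneq (U l) 0) => [->|Ul]; first by rewrite mul0r.
  by have := gw l; rewrite l0 Ul rT /= => /negbTE ->; rewrite !mulr0.
under eq_bigr do rewrite mulr_sumr.
rewrite exchange_big /=.
apply: (@le_trans _ _ (\sum_(l | D l) (2 / NR * (U l * (beta l * 1)) + P^-1 * (U l * (beta l *
    nu l))))).
  apply: ler_sum => l /andP[l0 rT].
  rewrite (eq_bigr (fun w => U l * beta l * (prob w * (dual w l)%:R))) => [|w _]; last by ring.
  rewrite -mulr_sumr; case: (eqVneq (U l) 0) => [->|Ul]; first by rewrite !mul0r !mulr0 addr0.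
  rewrite (_ : 2 / NR * _ + _ = U l * beta l * (2 / NR + nu l / P)); last by ring.
  by apply: ler_wpM2l; [exact: mulr_ge0 | exact: draw_prob_in_dual].
rewrite big_split /= -!mulr_sumr; apply: lerD.
  apply: ler_wpM2l; first by rewrite divr_ge0.
  apply: weighted_sum_le; first by rewrite mulr_ge0 ?powR_ge0.
  under eq_bigr do rewrite expr1n mul1r.
  apply: le_trans (sum_inv_sqr_tail lambda_gt U01 r0 S1 T_gt0) _.
  rewrite le_eqVlt; apply/orP; left; apply/eqP.
  (* The identity to check is [T^(1/lambda - 2) W = (NR / 64)^(1 - 2 lambda) W^(2 lambda)], the
     square of [E1]. *)
  have w64 : NR / (64 * W) = (NR / 64) * W^-1 by field; rewrite gt_eqF.
  rewrite /T /E1 w64 -powRrM powRM ?invr_ge0 ?(ltW W_gt0) ?divr_ge0// exprMn -mulrA; congr (_ * _).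
    rewrite -powR_mulrn ?powR_ge0// -powRrM; congr (_ `^ _); field; exact: lt0r_neq0.
  rewrite -[W^-1]powR_inv1 ?(ltW W_gt0)// -powRrM -{2}[W]powRr1 ?(ltW W_gt0)//.
  rewrite -powRD; last by rewrite (gt_eqF W_gt0) implybT.
  rewrite -powR_mulrn ?powR_ge0// -powRrM; congr (_ `^ _); field; exact: lt0r_neq0.
apply: ler_wpM2l; first by rewrite invr_ge0.
apply: weighted_sum_le.
  by rewrite mulr_ge0 ?powR_ge0// addr_ge0// mulr_ge0 ?sqrtr_ge0 ?powR_ge0.
apply: le_trans sum_common_prime_count_le.
rewrite big_mkcondr; apply: ler_sum => l _; case: ifP => // _.
by rewrite !mulr_ge0 ?invr_ge0 ?sqr_ge0.
Qed.

End PolynomialError.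

(** * Error of the median rule on the unit ball *)

Section MedianRuleError.
Context {R : realType}.

Lemma tent_frac_part01 (x : R) : 0 <= tent (frac_part x) <= 1.
Proof.
have /andP[h1 h2] := real_floor_itv (num_real x).
rewrite intrD in h2; rewrite /tent /frac_part; set y := x - _.
have [y0 y1] : 0 <= y /\ y < 1 by rewrite /y subr_ge0 ltrBlDl.
rewrite subr_ge0 lerBlDr lerDl normr_ge0 andbT ler_norml.
by apply/andP; split; lra.
Qed.

Lemma cube_tent_lattice_point d n (z : 'I_d -> nat) i :
  cube d (map_tuple (@tent R) (lattice_point R n z i)).
Proof. by move=> j; rewrite tnth_map tnth_mktuple; exact: tent_frac_part01. Qed.

Lemma tent_lattice_rule_dist d n z (f g : d.-tuple R -> R) (e : R) : (0 < n)%N ->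
  (forall x, cube d x -> `|f x - g x| <= e) ->
  `|tent_lattice_rule n z f - tent_lattice_rule n z g| <= e.
Proof.
move=> n0 H; rewrite /tent_lattice_rule -mulrBr -sumrB normrM ger0_norm ?invr_ge0//.
rewrite ler_pdivrMl ?ltr0n//; apply: le_trans (ler_norm_sum _ _ _) _.
apply: (@le_trans _ _ (\sum_(i < n) e)); last by rewrite sumr_const card_ord mulr_natl.
by apply: ler_sum => i _; apply/H/cube_tent_lattice_point.
Qed.

Variables (d nmax : nat) (alpha lambda : R) (gamma : 'I_d -> R).
Hypotheses (alpha12 : 1 / 2 < alpha < 2) (lambda_gt : 1 / 2 < lambda) (lambda_lt : lambda < alpha).
Hypotheses (d_gt0 : (0 < d)%N) (nmax_ge2 : (2 <= nmax)%N).
Hypothesis gamma_le : forall j, 0 < gamma j <= Num.sqrt (kappa alpha).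

Local Notation Gam := (fun j => (Num.sqrt (kappa alpha))^-1 * gamma j).
Local Notation W := (Vd alpha lambda gamma - 1).
Local Notation NR := (nmax%:R : R).
Local Notation P := ((prime_count nmax)%:R : R).

Let gamma_gt0 j : 0 < gamma j. Proof. by case/andP: (gamma_le j). Qed.

Let sqrt_kappa_gt0 : 0 < Num.sqrt (kappa alpha).
Proof. by have /andP[h1 h2] := gamma_le (Ordinal d_gt0); exact: lt_le_trans h2. Qed.

Let Gam01 j : 0 < Gam j <= 1.
Proof.
by rewrite mulr_gt0 ?invr_gt0//= ler_pdivrMl// mulr1; case/andP: (gamma_le j).
Qed.

Let W_gt0 : 0 < W. Proof. by rewrite subr_gt0; exact: (V_gt1 lambda_gt lambda_lt Gam01). Qed.

Definition mean_error : R :=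
  2 / NR * ((NR / 64) `^ (1 / 2 - lambda) * W `^ lambda) +
  P^-1 * (W `^ lambda * (Num.sqrt P * (NR / 2) `^ (- alpha) + P * (NR / 2) `^ (- (2 * alpha)))).

Lemma mean_error_ge0 : 0 <= mean_error.
Proof.
by rewrite addr_ge0// !mulr_ge0 ?powR_ge0// ?invr_ge0// addr_ge0// !mulr_ge0 ?sqrtr_ge0 ?powR_ge0.
Qed.

(** [f] is replaced by a cosine polynomial at the cost of an arbitrarily small [e]. The polynomial
    and its degree depend on [e], but the bounds on [dual_error] and on bad draws do not. *)
Lemma expected_median_rule_error (m : nat) (f : d.-tuple R -> R) :
  carrier (sob alpha gamma) f -> ip_norm (sob alpha gamma) f <= 1 ->
  \sum_(w : {ffun 'I_(2 * m + 1) -> draw nmax d}) (\prod_r draw_prob R (w r)) *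
    `|cube_int f - median [seq tent_lattice_rule (w r).1 (fun j => (w r).2 j : nat) f
                          | r : 'I_(2 * m + 1)]|
  <= 32 * mean_error + W `^ lambda * (4^-1 ^+ m / 8).
Proof.
move=> cf nf; apply/ler_addgt0Pr => e0 e0_gt0.
(* The error [e] is multiplied by 32 in the threshold of the median and by at most 1 on the
   exceptional event. *)
pose e := e0 / 33; have e_gt0 : 0 < e by rewrite divr_gt0.
have k_gt0 : 0 < kappa alpha by move: sqrt_kappa_gt0; rewrite sqrtr_gt0.
have [K [c [hc hcf c0]]] := sob_cos_approx d_gt0 alpha12 gamma_gt0 k_gt0 cf nf e_gt0.
have [beta [beta0 beta1 hbeta]] := @tent_lattice_error R d K c (fun j => freq_weight alpha (Gam
    j)) hc.
pose Q (w : draw nmax d) := tent_lattice_rule w.1 (fun j => w.2 j : nat) f.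
(* Outcomes of mass 0 include [n = 0], where the rule is no average, and are excluded. *)
have err w : draw_prob R w != 0 -> `|cube_int f - Q w| <= dual_error beta w + e.
  move=> pw; have n0 : (0 < w.1)%N.
    by move: pw; rewrite /draw_prob; case: ifP => [/andP[/and3P[/prime_gt0]]//|]; rewrite eqxx.
  rewrite -(subrKA (tent_lattice_rule w.1 (fun j => w.2 j) (cos_expansion c))).
  apply: le_trans (ler_normD _ _) _; apply: lerD.
    by rewrite -c0; exact: hbeta.
  exact: tent_lattice_rule_dist.
have := @median_of_means_error R (draw nmax d) (@draw_prob R nmax d)
  (@draw_prob_ge0 R nmax d) (@draw_prob_sum_le1 R nmax d) Q
  (@good_draw R d K nmax alpha lambda Gam) (cube_int f) (mean_error + e) (W `^ lambda + e) m.
move=> /(_ _ _ _ _ _) main.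
apply: (@le_trans _ _ (32 * (mean_error + e) + (W `^ lambda + e) * (4^-1 ^+ m / 8))).
  apply: main.
  - by rewrite ltr_wpDl// mean_error_ge0.
  - by rewrite addr_ge0 ?powR_ge0// ltW.
  - move=> w /err /le_trans; apply; rewrite lerD2r.
    exact: (dual_error_le lambda_gt lambda_lt Gam01).
  - exact: (prob_bad_draw_le K lambda_gt lambda_lt Gam01).
  - apply: (@le_trans _ _ (\sum_w (draw_prob R w * (dual_error beta w * (@good_draw R d K nmax
      alpha lambda Gam w)%:R) + e * draw_prob R w))).
      apply: ler_sum => w _; case: (eqVneq (draw_prob R w) 0) => [->|pw].
        by rewrite !mul0r mulr0 addr0.
      rewrite [e * _]mulrC -mulrDr ler_wpM2l ?draw_prob_ge0//.
      case: (good_draw _ _ _ _); rewrite ?mulr1 ?mulr0 ?add0r; first exact: err.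
      exact: ltW.
    rewrite big_split /= -mulr_sumr lerD//.
      exact: (expected_dual_error_le lambda_gt lambda_lt Gam01).
    by rewrite ler_piMr ?(ltW e_gt0)// draw_prob_sum_le1.
have p1 : 4^-1 ^+ m / 8 <= 1 :> R.
  by rewrite ler_pdivrMr// mul1r (@le_trans _ _ 1)// ?exprn_ile1//; lra.
have p2 : e * (4^-1 ^+ m / 8) <= e by rewrite ler_piMr// ltW.
have e33 : e0 = 33 * e by rewrite /e; field.
by rewrite mulrDr mulrDl e33; move: p2; lra.
Qed.

Variables (delta CP : R).
Hypotheses (delta_gt0 : 0 < delta) (CP_gt0 : 0 < CP).
Hypothesis prime_bound : P^-1 <= CP * NR `^ (2 * delta - 1).

(** The three summands correspond to the three constants. The first has the exact rate
    [lambda + 1/2], the third the rate [2 alpha], which is larger, and the middle one, of order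
    [P^(-1/2) NR^(-alpha)], is where the prime count enters and [delta] is spent. *)
Lemma mean_error_le : mean_error <=
  (2 * 64 `^ (lambda - 1 / 2) + Num.sqrt CP * 2 `^ lambda + 2 `^ (lambda + 1 / 2)) *
  (W `^ lambda / NR `^ (lambda + 1 / 2 - delta)).
Proof.
have x2 : 2 <= NR by rewrite ler_nat.
have x1 : 1 <= NR by apply: le_trans x2; lra.
have x0 : 0 < NR by apply: lt_le_trans x1.
have half1 : 1 <= NR / 2 by rewrite ler_pdivlMr// mul1r.
set y := NR `^ (lambda + 1 / 2 - delta).
have yE : y^-1 = NR `^ (- (lambda + 1 / 2 - delta)) by rewrite powRN.
have mono s : s <= - (lambda + 1 / 2 - delta) -> NR `^ s <= y^-1.
  by move=> h; rewrite yE ler_powR.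
have divp (b s : R) : 0 < b -> (NR / b) `^ (- s) = b `^ s * NR `^ (- s).
  move=> b0; rewrite powRM ?invr_ge0 ?(ltW x0) ?(ltW b0)// mulrC; congr (_ * _).
  by rewrite -[b^-1]powR_inv1 ?(ltW b0)// -powRrM mulN1r opprK.
have -> : mean_error = 2 / NR * ((NR / 64) `^ (1 / 2 - lambda) * W `^ lambda) +
    W `^ lambda * ((P^-1 * Num.sqrt P) * (NR / 2) `^ (- alpha)) +
    W `^ lambda * ((P^-1 * P) * (NR / 2) `^ (- (2 * alpha))).
  by rewrite /mean_error; ring.
rewrite [leRHS]mulrDl [X in _ <= X + _]mulrDl.
have Wl : 0 <= W `^ lambda by exact: powR_ge0.
apply: lerD; first apply: lerD.
- rewrite (_ : 1 / 2 - lambda = - (lambda - 1 / 2)); last by ring.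
  rewrite divp// [leLHS](_ : _ = 2 * 64 `^ (lambda - 1 / 2) * (W `^ lambda * (NR `^ (- (lambda
      - 1 / 2)) / NR))); last by ring.
  rewrite ler_wpM2l ?mulr_ge0 ?powR_ge0//; apply: ler_wpM2l => //.
  rewrite -[NR^-1]powR_inv1 ?(ltW x0)// -powRD; last by rewrite (gt_eqF x0) implybT.
  by apply: mono; move: delta_gt0; lra.
- rewrite [leRHS]mulrCA; apply: ler_wpM2l => //.
  have s1 : P^-1 * Num.sqrt P <= Num.sqrt CP * NR `^ (delta - 1 / 2).
    have -> : P^-1 * Num.sqrt P = Num.sqrt P^-1.
      case: (eqVneq P 0) => [->|P0]; first by rewrite invr0 mul0r sqrtr0.
      have sP : Num.sqrt P != 0 by rewrite gt_eqF// sqrtr_gt0 lt_neqAle eq_sym P0 ler0n.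
      by rewrite sqrtrV// -{1}[P]sqr_sqrtr ?ler0n// expr2 invfM -mulrA mulVf// mulr1.
    have <- : Num.sqrt (NR `^ (2 * delta - 1)) = NR `^ (delta - 1 / 2).
      by rewrite -powR12_sqrt ?powR_ge0// -powRrM; congr (_ `^ _); field.
    by rewrite -sqrtrM ?(ltW CP_gt0)// ler_sqrt// mulr_ge0 ?powR_ge0// ltW.
  have s2 : (NR / 2) `^ (- alpha) <= 2 `^ lambda * NR `^ (- lambda).
    rewrite -divp//; apply: ler_powR => //; rewrite lerN2 ltW//.
  apply: le_trans (ler_pM _ _ s1 s2) _; rewrite ?mulr_ge0 ?powR_ge0 ?invr_ge0 ?sqrtr_ge0//.
  rewrite mulrACA; apply: ler_wpM2l; first by rewrite mulr_ge0 ?sqrtr_ge0 ?powR_ge0.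
  rewrite -powRD; last by rewrite (gt_eqF x0) implybT.
  by apply: mono; lra.
- rewrite [leRHS]mulrCA; apply: ler_wpM2l => //.
  apply: (@le_trans _ _ ((NR / 2) `^ (- (lambda + 1 / 2)))).
    apply: (@le_trans _ _ (1 * (NR / 2) `^ (- (2 * alpha)))).
      apply: ler_wpM2r; first exact: powR_ge0.
      by case: (eqVneq P 0) => [->|P0]; rewrite ?mulr0// mulVf.
    by rewrite mul1r; apply: ler_powR => //; rewrite lerN2; move: lambda_gt lambda_lt; lra.
  rewrite divp//; apply: ler_wpM2l; first exact: powR_ge0.
  by apply: mono; move: delta_gt0; lra.
Qed.

(** [m >= (lambda + 1/2) log2 nmax] gives [2^m >= nmax^(lambda + 1/2)], and the failure bound
    [4^-m / 8] is smaller than [2^-m]. *)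
Lemma repetition_error_le (h : nat -> R) (m : nat) : lambda + 1 / 2 <= h nmax ->
  m = `|Num.ceil (h nmax * (ln nmax%:R / ln 2))|%N ->
  4^-1 ^+ m / 8 <= (NR `^ (lambda + 1 / 2 - delta))^-1.
Proof.
move=> hh mE; have x1 : 1 <= NR by rewrite ler1n; apply: leq_trans nmax_ge2.
have x0 : 0 < NR by apply: lt_le_trans x1.
have l2 : 0 < ln (2 : R) by rewrite ln_gt0// ltr1n.
have lx : 0 <= ln NR by rewrite ln_ge0.
have hm : (lambda + 1 / 2) * ln NR <= ln 2 * m%:R.
  rewrite -ler_pdivrMl//; apply: (@le_trans _ _ (h nmax * (ln NR / ln 2))).
    rewrite mulrC -mulrA ler_wpM2r//.
    by rewrite mulr_ge0// invr_ge0 ltW.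
  apply: le_trans (ceil_ge _) _; rewrite mE -[leRHS]/(Posz _)%:~R ler_int.
  by rewrite abszE ler_norm.
have step : NR `^ (lambda + 1 / 2) <= 4 ^+ m.
  apply: (@le_trans _ _ (2 ^+ m)); last by apply: lerXn2r; rewrite ?nnegrE//; lra.
  rewrite -ler_ln ?posrE ?powR_gt0 ?exprn_gt0// ln_powR lnXn// -[leRHS]mulr_natr.
  exact: hm.
rewrite exprVn; apply: (@le_trans _ _ (4 ^+ m)^-1).
  by rewrite ler_pdivrMr// ler_peMr ?invr_ge0 ?exprn_ge0//; lra.
rewrite lef_pV2 ?posrE ?powR_gt0 ?exprn_gt0//; apply: le_trans step.
by apply: ler_powR => //; move: delta_gt0; lra.
Qed.

End MedianRuleError.

Theorem theorem4p4 (R : realType) (lambda delta : R)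
    (hlambda : 1 / 2 < lambda)
    (hdelta : 0 < delta < Num.min (lambda - 1 / 2) 1) :
  exists C : R, 0 < C /\
  forall (alpha : R) (d : nat) (gamma : 'I_d -> R) (nmax : nat) (h : nat -> R),
    1 / 2 < alpha < 2 ->
    lambda < alpha ->
    (0 < d)%N ->
    (forall j, 0 < gamma j <= Num.sqrt (kappa alpha)) ->
    (2 <= nmax)%N ->
    nmax%:R >= 2 * inf [set (Vd alpha l gamma - 1) / (1 - 31 / 32)
                         | l in [set l : R | 1 / 2 <= l < alpha]] ->
    (forall n, (0 < n)%N -> 1 <= h n) ->
    h n @[n --> \oo] --> +oo ->
    h nmax >= lambda + 1 / 2 ->
    (eran (sob alpha gamma) (@med_prob R nmax d h) (@med_rule R nmax d h)
     <= (C * ((Vd alpha lambda gamma - 1) `^ lambda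
              / nmax%:R `^ (lambda + 1 / 2 - delta)))%:E)%E.
Proof.
have /andP[d0 _] := hdelta.
have [CP CP0 hCP] := @inv_prime_count_le R delta d0.
pose C1 : R := 2 * 64 `^ (lambda - 1 / 2) + Num.sqrt CP * 2 `^ lambda + 2 `^ (lambda + 1 / 2).
have C10 : 0 < C1.
  by rewrite ltr_wpDl ?powR_gt0// addr_ge0// mulr_ge0 ?powR_ge0 ?sqrtr_ge0.
(* 32 is the factor of the Markov threshold, 1 covers the event on which the median fails. *)
exists (32 * C1 + 1); split; first by rewrite addr_gt0// mulr_gt0.
move=> alpha d gamma nmax h ha hla hd hg hn _ _ _ hh.
apply: ub_ereal_sup => _ [f [cf nf] <-]; rewrite lee_fin.
(* With this [m], [repetitions nmax h] is [2 * m + 1] by definition, and the bound for [2 * m + 1]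
   draws applies by conversion. *)
pose m := `|Num.ceil (h nmax * (ln (nmax%:R : R) / ln 2))|%N.
have n0 : (0 < nmax)%N by exact: leq_trans hn.
apply: le_trans (expected_median_rule_error ha hlambda hla hd hn hg m cf nf) _.
rewrite [leRHS]mulrDl [X in _ <= _ + X]mul1r -mulrA; apply: lerD.
  by rewrite ler_pM2l//; exact: (mean_error_le gamma hlambda hla hn d0 CP0 (hCP _ n0)).
apply: ler_wpM2l; first exact: powR_ge0.
exact: (repetition_error_le hn d0 hh erefl).
Qed.
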